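(* For every poset $P$, the flow $\mathrm{Ch}(P)$ is q-cofibrant and the augmentation $\epsilon_P:\mathrm{Ch}(P)\to P$ is a trivial q-fibration of flows. Moreover, if $P\subset Q$ is an inclusion of posets, the induced map $\mathrm{Ch}(P)\to\mathrm{Ch}(Q)$ is a q-cofibration. More precisely, it is a relative cell complex.
   Context: **Spaces.** $\mathrm{Top}$ denotes either the category of $\Delta$-generated spaces (spaces carrying the final topology with respect to all continuous maps from $[0,1]$) or its full subcategory of $\Delta$-Hausdorff ones (the image of every continuous map from $[0,1]$ is closed); the result holds for either choice. It is bicomplete and cartesian closed; products, limits and colimits are taken in $\mathrm{Top}$. **Flows.** A flow $X$ is a small semicategory (category without required identities) enriched over $\mathrm{Top}$: a set of states $X^0$, spaces of execution paths $\mathbb P_{u,v}X\in\mathrm{Top}$ for $u,v\in X^0$, and a strictly associative continuous composition $*:\mathbb P_{u,v}X\times\mathbb P_{v,w}X\to\mathbb P_{u,w}X$. Morphisms are enriched semifunctors; the category is $\mathrm{Flow}$. A set is viewed as a flow without execution paths. For a space $Z$, $\mathrm{Glob}(Z)$ is the flow with states $0,1$, $\mathbb P_{0,1}\mathrm{Glob}(Z)=Z$ and all other path spaces empty. **q-model structure on $\mathrm{Flow}$.** It is cofibrantly generated, with generating q-cofibrations $\mathrm{Glob}(S^{n-1})\subset\mathrm{Glob}(D^n)$ ($n\ge 0$, $S^{-1}=\varnothing$), $C:\varnothing\to\{0\}$ and $R:\{0,1\}\to\{0\}$. Weak equivalences are the maps $f$ that are bijective on states and such that every $\mathbb P_{u,v}X\to\mathbb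 P_{f(u),f(v)}Y$ is a weak homotopy equivalence; q-fibrations are the maps for which every such map is a Serre fibration. A relative cell complex is a transfinite composition of pushouts of generating q-cofibrations; q-cofibrations are the retracts of relative cell complexes. ''Trivial'' means being also a weak equivalence. A flow $X$ is q-cofibrant if $\varnothing\to X$ is a q-cofibration. **Posets.** A (small) poset $R$ is viewed as the flow with state set $R$, with exactly one execution path from $x$ to $y$ if $x<y$, and none otherwise. An inclusion of posets $P\subset Q$ is a subset $P$ of $Q$ with a partial order such that $x\le_P y$ implies $x\le_Q y$ (the order of $P$ need not be the induced one). **Chain replacement.** For a poset $P$ and $x<y$ in $P$, $\mathcal C_P(x,y)$ is the poset of strict chains $\gamma=(x=x_0<x_1<\cdots<x_k=y)$ in $P$, $k\ge1$, ordered by refinement: $\gamma\le\gamma'$ if $\gamma$ is obtained from $\gamma'$ by deleting intermediate vertices. If $x\not<y$, $\mathcal C_P(x,y)=\varnothing$. The flow $\mathrm{Ch}(P)$ has state set $P$ and $\mathbb P_{x,y}\mathrm{Ch}(P)=|N\mathcal C_P(x,y)|$, the geometric realization of the simplicial nerve (empty if $x\not<y$), with composition induced by concatenation of strict chains $\mathcal C_P(x,y)\times\mathcal C_P(y,z)\to\mathcal C_P(x,z)$ (realization and nerve preserve finite products). A strictly increasing map of posets sends strict chains to strict chains, so $\mathrm{Ch}$ is a functor from posets and strictly increasing maps to $\mathrm{Flow}$. The augmentation $\epsilon_P:\mathrm{Ch}(P)\to P$ is the identity on states and collapses each nonempty path space to the unique path of the poset flow $P$. *)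

(* Defs.v *)
(* The real numbers are an arbitrary R : realType. *)
From HB Require Import structures.
From Stdlib Require Import Relations.
From mathcomp Require Import all_boot all_order all_algebra generic_quotient.
From mathcomp Require Import all_classical reals topology normedtype.
Set Implicit Arguments.
Unset Strict Implicit.
Unset Printing Implicit Defensive.
Import Order.TTheory GRing.Theory Num.Theory numFieldNormedType.Exports.
Local Open Scope classical_set_scope.
Local Open Scope ring_scope.
Local Open Scope quotient_scope.

Record mono d d' (A : porderType d) (B : porderType d') := Mono {
  mono_fun :> A -> B;
  monoP : {homo mono_fun : x y / (x <= y)%O} }.

Lemma mono_eq d d' (A : porderType d) (B : porderType d') (f g : mono A B) :
  f =1 g -> f = g.
Proof.
case: f g => f fP [g gP] /= /funext fg; subst g.
by congr Mono; exact: Prop_irrelevance.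
Qed.

Definition mono_id d (A : porderType d) : mono A A :=
  @Mono _ _ A A id (fun _ _ h => h).

Definition mono_comp d d' d'' (A : porderType d) (B : porderType d')
    (C : porderType d'') (g : mono B C) (f : mono A B) : mono A C :=
  Mono (fun x y h => monoP g (monoP f h)).

Definition mono_fst d d' (A : porderType d) (B : porderType d') :
  mono (A *p B) A.
Proof. by exists (fun z : A *p B => z.1) => -[a b] [a' b'] /andP[]. Defined.

Definition mono_snd d d' (A : porderType d) (B : porderType d') :
  mono (A *p B) B.
Proof. by exists (fun z : A *p B => z.2) => -[a b] [a' b'] /andP[]. Defined.

(* Simplicial sets, as presheaves on the monotone maps [m] -> [n], where [n] is
   'I_n.+1. *)
Record sset := SSet {
  cell :> nat -> Type;
  sact : forall m n, mono 'I_m.+1 'I_n.+1 -> cell n -> cell m;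
  sact_id : forall n (x : cell n), sact (mono_id _) x = x;
  sact_comp : forall l m n (f : mono 'I_m.+1 'I_n.+1) (g : mono 'I_l.+1 'I_m.+1)
    (x : cell n), sact (mono_comp f g) x = sact g (sact f x) }.

Record sset_map (K L : sset) := SSetMap {
  cell_map :> forall n, K n -> L n;
  cell_map_nat : forall m n (f : mono 'I_m.+1 'I_n.+1) (x : K n),
    cell_map (sact f x) = sact f (cell_map x) }.

Definition nerve d (A : porderType d) : sset.
Proof.
apply: (@SSet (fun n => mono 'I_n.+1 A) (fun m n f x => mono_comp x f)).
- by move=> n x; exact: mono_eq.
- by move=> l m n f g x; exact: mono_eq.
Defined.

Definition nerve_map d d' (A : porderType d) (B : porderType d') (f : mono A B) :
  sset_map (nerve A) (nerve B).
Proof.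
apply: (@SSetMap (nerve A) (nerve B) (fun n x => mono_comp f x)).
by move=> m n g x; exact: mono_eq.
Defined.

Section realization.
Variable R : realType.
Implicit Types K L : sset.

Definition std_simplex n : set 'rV[R]_n.+1 :=
  [set t | (forall i, 0 <= t ord0 i) /\ \sum_i t ord0 i = 1].
Arguments std_simplex : clear implicits.
Definition simplex n : topologicalType := set_type (std_simplex n).

Lemma simplex_mapP m n (f : mono 'I_m.+1 'I_n.+1) (t : simplex m) :
  (\row_j \sum_(i | f i == j) set_val t ord0 i) \in std_simplex n.
Proof.
apply/mem_set; split=> [j|].
  rewrite mxE; apply: sumr_ge0 => i _; exact: (set_valP t).1.
under eq_bigr do rewrite mxE.
by rewrite -[RHS](set_valP t).2 [RHS](partition_big f predT).
Qed.

Definition simplex_map m n (f : mono 'I_m.+1 'I_n.+1) (t : simplex m) :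
  simplex n := SigSub (simplex_mapP f t).

Definition simplices (K : sset) := {n & K n}.
HB.instance Definition _ K := gen_eqMixin (simplices K).
HB.instance Definition _ K := gen_choiceMixin (simplices K).

Definition simplex_coproduct (K : sset) : topologicalType :=
  {s : simplices K & simplex (tag s)}.

Definition simplex_point (K : sset) n (x : K n) (t : simplex n) :
  simplex_coproduct K :=
  existT (fun s : simplices K => simplex (tag s)) (existT _ n x) t.

(* The realization is the coend of K_n x Delta^n: the coproduct of the standard
   simplices over all simplices of K, modulo the equivalence relation generated
   by (f^* x, t) ~ (x, f_* t), with the quotient topology. *)
Inductive glue (K : sset) : relation (simplex_coproduct K) :=
  Glue m n (f : mono 'I_m.+1 'I_n.+1) (x : K n) (t : simplex m) :
    glue (simplex_point (sact f x) t) (simplex_point x (simplex_map f t)).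

Definition glued (K : sset) (p q : simplex_coproduct K) : bool :=
  `[< clos_refl_sym_trans _ (@glue K) p q >].

Lemma glued_refl K : reflexive (@glued K).
Proof. by move=> p; apply/asboolP; exact: rst_refl. Qed.

Lemma glued_sym K : symmetric (@glued K).
Proof. by move=> p q; apply/asboolP/asboolP => ?; exact: rst_sym. Qed.

Lemma glued_trans K : transitive (@glued K).
Proof.
move=> p q r /asboolP pq /asboolP qr; apply/asboolP; exact: rst_trans pq qr.
Qed.

Canonical glued_equiv K :=
  EquivRel (@glued K) (@glued_refl K) (@glued_sym K) (@glued_trans K).

Definition realization (K : sset) : topologicalType :=
  quotient_topology {eq_quot (glued_equiv K)}.

Definition rpi (K : sset) (p : simplex_coproduct K) : realization K :=
  \pi_(quotient_topology {eq_quot (glued_equiv K)}) p.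

Definition rpoint (K : sset) n (x : K n) (t : simplex n) : realization K :=
  rpi (simplex_point x t).

Lemma rpi_eq K (p q : simplex_coproduct K) :
  rpi p = rpi q <-> glued p q.
Proof. by split=> [/eqmodP //|h]; exact/eqmodP. Qed.

Lemma rpointE K m n (f : mono 'I_m.+1 'I_n.+1) (x : K n) t :
  rpoint (sact f x) t = rpoint x (simplex_map f t).
Proof. by apply/rpi_eq/asboolP/rst_step. Qed.

Lemma rpointP K (z : realization K) : exists n (x : K n) t, z = rpoint x t.
Proof.
elim/quotW: z => -[[n x] t]; by exists n, x, t.
Qed.

Lemma rpi_lift K (T : Type) (f : simplex_coproduct K -> T) :
  (forall p q, glue p q -> f p = f q) ->
  forall p, f (repr (rpi p)) = f p.
Proof.
move=> h p.
have rst a b : clos_refl_sym_trans _ (@glue K) a b -> f a = f b.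
  by elim=> [x y /h|x|x y _ ->|x y z _ -> _ ->].
by apply/rst/asboolP/rpi_eq; exact: reprK.
Qed.

Lemma rcontinuous K (T : topologicalType) (f : realization K -> T) :
  (forall n (x : K n), continuous (f \o rpoint x)) -> continuous f.
Proof.
move=> h; apply/quotient_continuous => -[[n x] t]; exact: h.
Qed.

Lemma rpoint_continuous K n (x : K n) : continuous (@rpoint K n x).
Proof.
move=> t; exact: (@pi_continuous (simplex_coproduct K)).
Qed.

Definition realization_map K L (f : sset_map K L) (z : realization K) :
  realization L :=
  let p := repr z in rpoint (f _ (tagged (tag p))) (tagged p).

Lemma realization_mapE K L (f : sset_map K L) n (x : K n) t :
  realization_map f (rpoint x t) = rpoint (f n x) t.
Proof.
pose g (p : simplex_coproduct K) :=
  @rpoint L (tag (tag p)) (f _ (tagged (tag p))) (tagged p).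
apply: (rpi_lift (f := g)) => p q [m k h y s]; rewrite /g /=.
by rewrite -rpointE cell_map_nat.
Qed.

Lemma realization_map_continuous K L (f : sset_map K L) :
  continuous (realization_map f).
Proof.
apply: rcontinuous => n x.
rewrite (_ : _ \o _ = @rpoint L n (f n x)); first exact: rpoint_continuous.
by apply/funext => t; exact: realization_mapE.
Qed.

End realization.
Arguments rpoint {R K n}.
Arguments std_simplex : clear implicits.

(* Every al : C -> R extends affinely to a continuous function rexpect al on
   |N C|.  These functions separate points, which gives the Hausdorff property,
   and the bijectivity of |N (A x B)| -> |N A| x |N B|. *)
Section nerve_points.
Variable R : realType.

Section one.
Context {d : Order.disp_t} {C : porderType d}.
Implicit Types (al : C -> R) (z : realization R (nerve C)).

Definition expect al (p : simplex_coproduct R (nerve C)) : R :=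
  \sum_i set_val (tagged p) ord0 i * al (tagged (tag p) i).

Definition rexpect al z : R := expect al (repr z).

Lemma rexpectE al n (s : mono 'I_n.+1 C) (t : simplex R n) :
  rexpect al (rpoint (K := nerve C) s t)
    = \sum_i set_val t ord0 i * al (s i).
Proof.
apply: (rpi_lift (f := expect al)) => p q [m k f x u]; rewrite /expect /=.
rewrite [LHS](partition_big f predT) //=; apply: eq_bigr => j _.
rewrite !set_valE /= mxE mulr_suml; apply: eq_bigr => i /eqP <- //.
Qed.

Lemma rexpect_continuous al : continuous (rexpect al).
Proof.
apply: rcontinuous => n x.
have -> : rexpect al \o rpoint (K := nerve C) x
  = fun t : simplex R n => \sum_i set_val t ord0 i * al (x i).
  by apply/funext => t; exact: rexpectE.
apply: continuous_big => [|i _]; first exact: add_continuous.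
move=> t; apply: (@continuousM R (simplex R n) (fun t => set_val t ord0 i)
  (fun=> al (x i)) t); last exact: cst_continuous.
apply: (@continuous_comp _ _ _ (set_val : simplex R n -> 'rV[R]_n.+1)
  (fun v : 'rV[R]_n.+1 => v ord0 i)).
  exact: initial_continuous.
exact: coord_continuous.
Qed.

Lemma mono_path_subproof (x : C) s :
  path <%O x s -> {homo (fun i : 'I_(size s).+1 => nth x (x :: s) i) :
    i j / (i <= j)%O}.
Proof.
move=> h i j ij; have hs : sorted <=%O (x :: s).
  by have := h; rewrite -/(sorted <%O (x :: s)) lt_sorted_uniq_le => /andP[].
by apply: (sorted_leq_nth le_trans le_refl) => //=; rewrite ?inE.
Qed.

Definition mono_path (x : C) s (h : path <%O x s) := Mono (mono_path_subproof h).

Lemma mono_path_inj (x : C) s (h : path <%O x s) : injective (mono_path h).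
Proof.
have u : uniq (x :: s) by apply: (lt_sorted_uniq (s := x :: s)).
move=> i j /eqP; rewrite /= nth_uniq // => /eqP; exact: val_inj.
Qed.

Lemma mono_path_mem (x : C) s (h : path <%O x s) y :
  y \in x :: s -> exists i, mono_path h i = y.
Proof.
move=> ys; have hi : (index y (x :: s) < (size s).+1)%N by rewrite -index_mem in ys.
by exists (Ordinal hi); rewrite /= nth_index.
Qed.

Lemma mono_factor m n (s : mono 'I_n.+1 C) (t : mono 'I_m.+1 C) :
  injective t -> (forall i, exists j, t j = s i) ->
  exists r : mono 'I_n.+1 'I_m.+1, s = mono_comp t r.
Proof.
move=> tI ts; pose r i := sval (cid (ts i)).
have rE i : t (r i) = s i by rewrite /r; case: cid.
have rM : {homo r : i j / (i <= j)%O}.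
  move=> i j ij; case: (leP (r i) (r j)) => // ji.
  have := monoP t (ltW ji); rewrite !rE => sji.
  have /tI e : t (r i) = t (r j).
    by rewrite !rE; apply/le_anti; rewrite sji (monoP s ij).
  by rewrite e ltxx in ji.
by exists (Mono rM); apply: mono_eq => i; rewrite /= rE.
Qed.

Lemma rpoint_comp m n (t : mono 'I_m.+1 C) (r : mono 'I_n.+1 'I_m.+1) u :
  rpoint (R := R) (K := nerve C) (mono_comp t r) u
    = rpoint (K := nerve C) t (simplex_map r u).
Proof. exact: (@rpointE R (nerve C)). Qed.

End one.

Section two.
Context {d : Order.disp_t} {C : porderType d}.
Implicit Types (al : C -> R) (z : realization R (nerve C)).
Notation point s t := (@rpoint R (nerve C) _ s t).

Lemma ord_lt_sorted n : sorted <%O (enum 'I_n).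
Proof.
have := iota_ltn_sorted 0 n; rewrite -val_enum_ord sorted_map.
by apply: sub_sorted => i j; rewrite /= ltEord.
Qed.

Lemma rpoint_pos z : exists n (s : mono 'I_n.+1 C) (t : simplex R n),
  z = point s t /\ forall i, 0 < set_val t ord0 i.
Proof.
have [n [s [t ->]]] := rpointP z.
have [t0 t1] := set_valP t; set v : 'rV__ := set_val t in t0 t1 *.
have : sorted <%O [seq i <- enum 'I_n.+1 | 0 < v ord0 i].
  exact: (sorted_filter lt_trans) (ord_lt_sorted _).
case E : [seq _ <- _ | _] => [|x l] /= p.
  have : \sum_i v ord0 i = 0.
    apply: big1 => i _; apply/eqP; rewrite eq_le t0 andbT leNgt; apply/negP => h.
    by have : i \in [::] by rewrite -E mem_filter h mem_enum.
  by rewrite t1 => /eqP; rewrite oner_eq0.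
pose th := mono_path p; have thI := @mono_path_inj _ _ _ _ p.
have inE' i : (i \in x :: l) = (0 < v ord0 i).
  by rewrite -E mem_filter mem_enum andbT.
have thp i : 0 < v ord0 (th i) by rewrite -inE' /th /= mem_nth.
pose u : 'rV[R]_(size l).+1 := \row_i v ord0 (th i).
have sumu j : \sum_(i | th i == j) u ord0 i = v ord0 j.
  have [j0|j0] := boolP (0 < v ord0 j).
    have [i ij] : exists i, th i = j by apply: mono_path_mem; rewrite inE'.
    rewrite (big_pred1 i) ?mxE ?ij // => k; rewrite /= -ij; exact: (inj_eq thI).
  rewrite big_pred0 => [|i].
    by apply/eqP; rewrite eq_le t0 leNgt j0.
  by apply/negP => /eqP ij; rewrite -ij thp in j0.
have uP : u \in std_simplex R _.
  apply/mem_set; split=> [i|]; first by rewrite mxE t0.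
  by rewrite (partition_big th predT) //= (eq_bigr _ (fun j _ => sumu j)).
exists (size l), (mono_comp s th), (SigSub uP : simplex R _); split; last first.
  by move=> i; rewrite set_valE /= mxE.
rewrite rpoint_comp; congr (rpoint _ _); apply/val_inj/rowP => j /=.
by rewrite mxE -sumu; apply: eq_bigr => i _; rewrite set_valE.
Qed.

Lemma rpoint_nf z : exists n (s : mono 'I_n.+1 C) (t : simplex R n),
  [/\ z = point s t, injective s & forall i, 0 < set_val t ord0 i].
Proof.
have [n [s [t [-> t0]]]] := rpoint_pos z.
have : sorted <%O (undup (codom s)).
  rewrite lt_sorted_uniq_le undup_uniq /=.
  apply: (subseq_sorted le_trans (undup_subseq _)).
  rewrite codomE; apply: homo_sorted; last first.
    by apply: sub_sorted (ord_lt_sorted _); exact: ltW.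
  exact: monoP.
have memE y : (y \in undup (codom s)) = (y \in codom s) by rewrite mem_undup.
case: (undup _) memE => [memE _|x l memE /= p].
  by have := codom_f s ord0; rewrite -memE.
have [i|r sE] := @mono_factor _ _ _ _ s (mono_path p) (@mono_path_inj _ _ _ _ p).
  by apply: mono_path_mem; rewrite memE codom_f.
exists (size l), (mono_path p), (simplex_map r t); split.
- by rewrite sE rpoint_comp.
- exact: mono_path_inj.
move=> j; rewrite set_valE /= mxE.
have : mono_path p j \in codom s by rewrite -memE /= mem_nth.
move=> /codomP[i]; rewrite sE /= => /(@mono_path_inj _ _ _ _ p) ji.
rewrite (bigD1 i) /= -?ji //; apply: ltr_pwDl => //.
by apply: sumr_ge0 => k _; exact: (set_valP t).1.
Qed.

Definition bary z c := rexpect (fun x => (x == c)%:R) z.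

Lemma baryE n (s : mono 'I_n.+1 C) (t : simplex R n) c :
  bary (point s t) c = \sum_(i | s i == c) set_val t ord0 i.
Proof.
rewrite /bary rexpectE [RHS]big_mkcond /=; apply: eq_bigr => i _.
by case: eqP; rewrite ?mulr1 ?mulr0.
Qed.

Lemma bary_gt0 n (s : mono 'I_n.+1 C) (t : simplex R n) i :
  0 < set_val t ord0 i -> 0 < bary (point s t) (s i).
Proof.
move=> t0; rewrite baryE (bigD1 i) //=; apply: ltr_pwDl => //.
by apply: sumr_ge0 => k _; exact: (set_valP t).1.
Qed.

Lemma bary_gt0_mem n (s : mono 'I_n.+1 C) (t : simplex R n) c :
  0 < bary (point s t) c -> exists i, s i = c.
Proof.
rewrite baryE => h; apply: contrapT => /forallNP nh.
by rewrite big_pred0 ?ltxx // in h => i; apply/eqP/nh.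
Qed.

Lemma bary_inj z z' : (forall c, bary z c = bary z' c) -> z = z'.
Proof.
have [m [s [t [-> sI t0]]]] := rpoint_nf z.
have [n [s' [t' [-> t'0]]]] := rpoint_pos z' => h.
have [i|r sE] := @mono_factor _ _ _ _ s' s sI.
  by apply: (@bary_gt0_mem _ _ t); rewrite h bary_gt0.
rewrite sE rpoint_comp; congr (rpoint _ _); apply/val_inj/rowP => j /=.
have := h (s j); rewrite !baryE (big_pred1 j) => [|k]; last first.
  exact: (inj_eq sI).
rewrite -set_valE => ->; rewrite mxE; apply: eq_bigl => i; rewrite sE /=.
exact: (inj_eq sI).
Qed.

Lemma rexpect_sum n (s : mono 'I_n.+1 C) (t : simplex R n) (S : seq C) al :
  uniq S -> {subset codom s <= S} ->
  rexpect al (point s t) = \sum_(c <- S) al c * bary (point s t) c.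
Proof.
move=> uS sS; rewrite rexpectE.
under [RHS]eq_bigr do rewrite baryE mulr_sumr big_mkcond /=.
rewrite exchange_big /=; apply: eq_bigr => i _.
rewrite (bigD1_seq (s i)) ?sS ?codom_f //= eqxx.
rewrite mulrC big1 ?addr0 // => c; by rewrite eq_sym => /negPf ->.
Qed.

Definition below (c x : C) : R := (x <= c)%O%:R.

Lemma below_inj z z' :
  (forall c, rexpect (below c) z = rexpect (below c) z') -> z = z'.
Proof.
move=> h; apply: bary_inj.
have [n [s [t zE]]] := rpointP z; have [n' [s' [t' zE']]] := rpointP z'.
pose S := undup (codom s ++ codom s').
have uS : uniq S by exact: undup_uniq.
have sS : {subset codom s <= S} by move=> x xs; rewrite mem_undup mem_cat xs.
have sS' : {subset codom s' <= S}.
  by move=> x xs; rewrite mem_undup mem_cat xs orbT.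
have b0 c : c \notin S -> bary z c = bary z' c.
  move=> cS; rewrite zE zE' !baryE !big_pred0 // => i; apply/eqP => e.
    by case/negP: cS; apply: sS'; rewrite -e codom_f.
  by case/negP: cS; apply: sS; rewrite -e codom_f.
pose del c := bary z c - bary z' c.
have del0 a : \sum_(c <- S | (c <= a)%O) del c = 0.
  have := h a; rewrite {1}zE {1}zE' (rexpect_sum _ _ uS sS).
  rewrite (rexpect_sum _ _ uS sS') -zE -zE' => /eqP.
  rewrite -subr_eq0 -sumrB => /eqP h0.
  apply: etrans h0; rewrite big_mkcond /=.
  apply: eq_bigr => c _; rewrite /below /del.
  by case: ifP => _; rewrite ?mul1r ?mul0r ?subr0.
move=> c; have [k] := ubnP (count (fun x => x < c)%O S).
elim: k c => // k IH c; rewrite ltnS => ck.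
have [cS|/b0//] := boolP (c \in S).
have := del0 c; rewrite big_mkcond (bigD1_seq c) //= lexx big_seq_cond big1 ?addr0.
  by rewrite /del => /eqP; rewrite subr_eq0 => /eqP.
move=> a /andP[aS nac]; case: (boolP (a <= c)%O) => // ac.
apply/eqP; rewrite subr_eq0; apply/eqP/IH.
apply: leq_trans ck; have {nac}ac : (a < c)%O by rewrite lt_neqAle nac.
have := count_predUI (pred1 a) (fun x => x < a)%O S.
rewrite [count (predI _ _) _](_ : _ = 0)%N; last first.
  rewrite -(count_pred0 S); apply: eq_count => x /=.
  by case: eqP => //= ->; rewrite ltxx.
rewrite addn0 (count_uniq_mem _ uS) aS add1n => <-.
by apply: sub_count => x /= /orP[/eqP -> //|/lt_trans]; apply.
Qed.

End two.

Lemma rexpect_map d d' (A : porderType d) (B : porderType d') (f : mono A B)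
    (al : B -> R) (z : realization R (nerve A)) :
  rexpect al (realization_map (nerve_map f) z) = rexpect (al \o f) z.
Proof.
have [n [s [t ->]]] := rpointP z.
by rewrite realization_mapE !rexpectE.
Qed.

Section pair.
Context {d d' : Order.disp_t} {A : porderType d} {B : porderType d'}.

Definition rfst (z : realization R (nerve (A *p B))) : realization R (nerve A) :=
  realization_map (nerve_map (mono_fst A B)) z.
Definition rsnd (z : realization R (nerve (A *p B))) : realization R (nerve B) :=
  realization_map (nerve_map (mono_snd A B)) z.

Lemma below_pair (z : realization R (nerve (A *p B))) (c : A *p B) :
  rexpect (below c) z =
  Num.min (rexpect (below c.1) (rfst z)) (rexpect (below c.2) (rsnd z)).
Proof.
rewrite !rexpect_map; have [n [s [t ->]]] := rpointP z.
rewrite !rexpectE /below /=.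
have t0 i : 0 <= set_val t ord0 i by exact: (set_valP t).1.
have leE i : (s i <= c)%O = ((s i).1 <= c.1)%O && ((s i).2 <= c.2)%O by [].
have [h|/existsNP[i0 /not_implyP[i01 /negP i02]]] :=
    pselect (forall i, ((s i).1 <= c.1)%O -> ((s i).2 <= c.2)%O).
  rewrite min_l; last first.
    apply: ler_sum => i _; apply: ler_wpM2l => //.
    by case: (boolP (_ <= c.1)%O) => [/h ->|]; rewrite ?ler0n.
  apply: eq_bigr => i _; rewrite leE.
  by case: (boolP (_ <= c.1)%O) => [/h ->|].
have {i02}h i : ((s i).2 <= c.2)%O -> ((s i).1 <= c.1)%O.
  move=> si; apply: le_trans i01; case: (leP i i0) => [/(monoP s)/andP[]//|ii0].
  have /andP[_ le2] := monoP s (ltW ii0).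
  by rewrite (le_trans le2 si) in i02.
rewrite min_r; last first.
  apply: ler_sum => i _; apply: ler_wpM2l => //.
  by case: (boolP (_ <= c.2)%O) => [/h ->|]; rewrite ?ler0n.
apply: eq_bigr => i _; rewrite leE andbC.
by case: (boolP (_ <= c.2)%O) => [/h ->|].
Qed.

Lemma rpair_inj (z z' : realization R (nerve (A *p B))) :
  rfst z = rfst z' -> rsnd z = rsnd z' -> z = z'.
Proof.
by move=> h1 h2; apply: below_inj => c; rewrite !below_pair h1 h2.
Qed.

Lemma merge_weights (la : seq (A * R)) (lb : seq (B * R)) :
  sorted (fun x y : A * R => (x.1 <= y.1)%O) la ->
  sorted (fun x y : B * R => (x.1 <= y.1)%O) lb ->
  all (fun x : A * R => 0 <= x.2) la -> all (fun x : B * R => 0 <= x.2) lb ->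
  \sum_(x <- la) x.2 = \sum_(x <- lb) x.2 ->
  exists lc : seq ((A *p B) * R), [/\
    sorted (fun x y : (A *p B) * R => (x.1 <= y.1)%O) lc /\
      all (fun x : (A *p B) * R => 0 <= x.2) lc,
    all (fun x : (A *p B) * R => (x.1.1 \in map fst la) &&
                                 (x.1.2 \in map fst lb)) lc,
    forall al : A -> R,
      \sum_(x <- lc) x.2 * al x.1.1 = \sum_(x <- la) x.2 * al x.1 &
    forall al : B -> R,
      \sum_(x <- lc) x.2 * al x.1.2 = \sum_(x <- lb) x.2 * al x.1].
Proof.
have tA : transitive (fun x y : A * R => (x.1 <= y.1)%O).
  by move=> ? ? ?; exact: le_trans.
have tB : transitive (fun x y : B * R => (x.1 <= y.1)%O).
  by move=> ? ? ?; exact: le_trans.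
have tC : transitive (fun x y : (A *p B) * R => (x.1 <= y.1)%O).
  by move=> ? ? ?; exact: le_trans.
have zero (T : eqType) (l : seq (T * R)) (al : T -> R) :
    all (fun x : T * R => 0 <= x.2) l -> \sum_(x <- l) x.2 = 0 ->
    \sum_(x <- l) x.2 * al x.1 = 0.
  elim: l => [|[c w] l IHl]; rewrite ?big_nil // !big_cons /=.
  move=> /andP[w0 l0] /eqP; rewrite paddr_eq0 //; last first.
    by rewrite big_seq; apply: sumr_ge0 => x /(allP l0).
  by move=> /andP[/eqP -> /eqP /(IHl l0) ->]; rewrite mul0r addr0.
have [k] := ubnP (size la + size lb).
elim: k la lb => // k IH [|[a s] la] [|[b t] lb].
- by move=> *; exists [::]; split => // al; rewrite !big_nil.
- rewrite big_nil => _ _ _ _ p /esym e.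
  exists [::]; split => // al; rewrite !big_nil //; exact/esym/zero.
- rewrite big_nil => _ _ _ p _ e.
  exists [::]; split => // al; rewrite !big_nil //; exact/esym/zero.
rewrite /= addSn addnS !ltnS => sz pa pb /andP[s0 la0] /andP[t0 lb0].
rewrite !big_cons /= => e.
have saE : sorted (fun x y : A * R => (x.1 <= y.1)%O) la by exact: path_sorted pa.
have sbE : sorted (fun x y : B * R => (x.1 <= y.1)%O) lb by exact: path_sorted pb.
have geA x : x \in map fst la -> (a <= x)%O.
  move=> /mapP[y yl ->]; move: pa; rewrite path_sortedE // => /andP[/allP h _].
  exact: (h _ yl).
have geB x : x \in map fst lb -> (b <= x)%O.
  move=> /mapP[y yl ->]; move: pb; rewrite path_sortedE // => /andP[/allP h _].
  exact: (h _ yl).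
have [st|ts] := leP s t.
  have [||||||lc [[c1 c2] c3 c4 c5]] := IH la ((b, t - s) :: lb).
  - by rewrite /= addnS.
  - exact: saE.
  - by case: (lb) pb.
  - by [].
  - by rewrite /= lb0 subr_ge0 st.
  - by apply: (addrI s); rewrite big_cons /= addrA subrKC.
  exists (((a, b), s) :: lc); split.
  - split; last by rewrite /= s0.
    rewrite /= path_sortedE // c1 andbT; apply/allP => x /(allP c3).
    rewrite /= inE => /andP[xa xb]; apply/andP; split; first exact: geA.
    by case/orP: xb => [/eqP -> //|/geB].
  - rewrite /= !inE !eqxx /=; apply/allP => x /(allP c3).
    by rewrite /= !inE => /andP[xa xb]; rewrite xa xb orbT.
  - by move=> al; rewrite !big_cons /= c4.
  - by move=> al; rewrite !big_cons /= c5 big_cons /= addrA -mulrDl subrKC.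
have [||||||lc [[c1 c2] c3 c4 c5]] := IH ((a, s - t) :: la) lb.
- by rewrite /= addSn.
- by case: (la) pa.
- exact: sbE.
- by rewrite /= la0 subr_ge0 ltW.
- by [].
- by apply: (addrI t); rewrite big_cons /= addrA subrKC.
exists (((a, b), t) :: lc); split.
- split; last by rewrite /= t0.
  rewrite /= path_sortedE // c1 andbT; apply/allP => x /(allP c3).
  rewrite /= inE => /andP[xa xb]; apply/andP; split; last exact: geB.
  by case/orP: xa => [/eqP -> //|/geA].
- rewrite /= !inE !eqxx /=; apply/allP => x /(allP c3).
  by rewrite /= !inE => /andP[xa xb]; rewrite xa xb orbT.
- by move=> al; rewrite !big_cons /= c4 big_cons /= addrA -mulrDl subrKC.
- by move=> al; rewrite !big_cons /= c5.
Qed.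

Lemma rpair_surj (x : realization R (nerve A)) (y : realization R (nerve B)) :
  exists z, rfst z = x /\ rsnd z = y.
Proof.
have [n [s [t ->]]] := rpointP x; have [m [r [u ->]]] := rpointP y.
pose la := [seq (s i, set_val t ord0 i) | i <- enum 'I_n.+1].
pose lb := [seq (r i, set_val u ord0 i) | i <- enum 'I_m.+1].
have sumA al : \sum_(x <- la) x.2 * al x.1 = \sum_i set_val t ord0 i * al (s i).
  by rewrite big_map; exact: big_enum.
have sumB al : \sum_(x <- lb) x.2 * al x.1 = \sum_i set_val u ord0 i * al (r i).
  by rewrite big_map; exact: big_enum.
have sumA1 : \sum_(x <- la) x.2 = 1.
  have := sumA (fun=> 1); under eq_bigr do rewrite mulr1.
  move=> ->; under eq_bigr do rewrite mulr1; exact: (set_valP t).2.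
have sumB1 : \sum_(x <- lb) x.2 = 1.
  have := sumB (fun=> 1); under eq_bigr do rewrite mulr1.
  move=> ->; under eq_bigr do rewrite mulr1; exact: (set_valP u).2.
have [|||||lc [[c1 c2] _ c3 c4]] := @merge_weights la lb.
- rewrite sorted_map; apply: sub_sorted (ord_lt_sorted _) => i j /ltW.
  exact: monoP.
- rewrite sorted_map; apply: sub_sorted (ord_lt_sorted _) => i j /ltW.
  exact: monoP.
- by apply/allP => _ /mapP[i _ ->]; exact: (set_valP t).1.
- by apply/allP => _ /mapP[i _ ->]; exact: (set_valP u).1.
- by rewrite sumA1 sumB1.
have : \sum_(x <- lc) x.2 = 1.
  have := c3 (fun=> 1); under eq_bigr do rewrite mulr1.
  move=> ->; have := sumA1; by under eq_bigr do rewrite -[_.2]mulr1.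
case: lc c1 c2 c3 c4 => [|p l] c1 c2 c3 c4.
  by rewrite big_nil => /esym/eqP; rewrite oner_eq0.
have bigE (F : (A *p B) * R -> R) :
    \sum_(x <- p :: l) F x = \sum_(i < (size l).+1) F (nth p (p :: l) i).
  by rewrite (big_nth p) big_mkord.
move=> w1; pose wv : 'rV[R]_(size l).+1 := \row_i (nth p (p :: l) i).2.
have wP : wv \in std_simplex R _.
  apply/mem_set; split=> [i|].
    rewrite mxE; apply: (allP c2); exact: mem_nth.
  by rewrite -w1 bigE; apply: eq_bigr => i _; rewrite mxE.
have sM : {homo (fun i : 'I_(size l).+1 => (nth p (p :: l) i).1) :
    i j / (i <= j)%O}.
  move=> i j ij; have tr : transitive (fun x y : (A *p B) * R => (x.1 <= y.1)%O).
    by move=> ? ? ?; exact: le_trans.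
  have rf : reflexive (fun x y : (A *p B) * R => (x.1 <= y.1)%O).
    by move=> ?; exact: lexx.
  by apply: (sorted_leq_nth tr rf p c1); rewrite ?inE.
pose z := rpoint (R := R) (K := nerve (A *p B)) (Mono sM) (SigSub wP : simplex R _).
exists z; split; apply: bary_inj => c; rewrite /bary rexpect_map !rexpectE.
  transitivity (\sum_(x <- p :: l) x.2 * (x.1.1 == c)%:R).
    by rewrite bigE; apply: eq_bigr => i _; rewrite set_valE /= mxE.
  exact: etrans (c3 (fun x => (x == c)%:R)) (sumA _).
transitivity (\sum_(x <- p :: l) x.2 * (x.1.2 == c)%:R).
  by rewrite bigE; apply: eq_bigr => i _; rewrite set_valE /= mxE.
exact: etrans (c4 (fun x => (x == c)%:R)) (sumB _).
Qed.

End pair.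
End nerve_points.

Lemma continuous_compose (X Y Z : topologicalType) (f : X -> Y) (g : Y -> Z) :
  continuous f -> continuous g -> continuous (fun x => g (f x)).
Proof. by move=> cf cg x; apply: continuous_comp; [exact: cf|exact: cg]. Qed.

Lemma continuous_pair (X Y Z : topologicalType) (f : X -> Y) (g : X -> Z) :
  continuous f -> continuous g -> continuous (fun x => (f x, g x)).
Proof. by move=> cf cg x; exact: (cvg_pair (cf x) (cg x)). Qed.

(* Delta R T is T with the final topology with respect to all continuous maps
   [0, 1] -> T, i.e. the coreflection of T into Delta-generated spaces.  It does
   not change the topology of a space that is already Delta-generated, such as a
   disk, a sphere or the realization of a simplicial set.  The argument R is
   phantom: it only selects the topology. *)
Definition Delta (R : realType) (T : topologicalType) : Type := T.

Section Top.
Variable R : realType.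

Definition I01 : topologicalType := set_type (`[0, 1]%classic : set R).

Lemma I01_subproof (x : R) : 0 <= x <= 1 -> x \in (`[0, 1]%classic : set R).
Proof. by move=> h; apply/mem_set; rewrite /= in_itv. Qed.

Definition I01_zero : I01 := SigSub (I01_subproof (introT andP (conj (lexx 0) ler01))).
Definition I01_one : I01 := SigSub (I01_subproof (introT andP (conj ler01 (lexx 1)))).

Definition Delta_open (T : topologicalType) (U : set T) :=
  forall phi : I01 -> T, continuous phi -> open (phi @^-1` U).

Definition Delta_generated (T : topologicalType) :=
  forall U : set T, Delta_open U -> open U.

Definition Delta_Hausdorff (T : topologicalType) :=
  forall phi : I01 -> T, continuous phi -> closed (range phi).

HB.instance Definition _ (T : topologicalType) := Choice.on (Delta R T).

Section Delta_topology.
Variable T : topologicalType.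
Lemma Delta_openT : Delta_open [set: T].
Proof. by move=> phi _; rewrite preimage_setT; exact: openT. Qed.
Lemma Delta_openI : setI_closed (@Delta_open T).
Proof.
by move=> A B hA hB phi c; rewrite preimage_setI; apply: openI; [exact: hA|exact: hB].
Qed.
Lemma Delta_open_bigU (I : Type) (f : I -> set T) :
  (forall i, Delta_open (f i)) -> Delta_open (\bigcup_i f i).
Proof.
move=> hf phi c; rewrite preimage_bigcup; apply: bigcup_open => i _; exact: hf.
Qed.
HB.instance Definition _ := @isOpenTopological.Build (Delta R T)
  (@Delta_open T) Delta_openT Delta_openI Delta_open_bigU.

Lemma open_DeltaE (U : set (Delta R T)) : open U = @Delta_open T U.
Proof. by []. Qed.
End Delta_topology.

Lemma open_Delta (T : topologicalType) (U : set T) :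
  open U -> open (U : set (Delta R T)).
Proof. by rewrite open_DeltaE => oU phi /continuousP; exact. Qed.

Lemma Delta_id_continuous (T : topologicalType) :
  continuous (id : Delta R T -> T).
Proof. by apply/continuousP => U; exact: open_Delta. Qed.

Lemma path_Delta (T : topologicalType) (phi : I01 -> T) :
  continuous phi -> continuous (phi : I01 -> Delta R T).
Proof. by move=> c; apply/continuousP => U; rewrite open_DeltaE; exact. Qed.

Lemma Delta_path (T : topologicalType) (phi : I01 -> Delta R T) :
  continuous phi -> continuous (phi : I01 -> T).
Proof. by move=> /continuousP c; apply/continuousP => U /open_Delta; exact: c. Qed.

Lemma Delta_generatedP (T : topologicalType) : Delta_generated (Delta R T).
Proof. by move=> U hU; rewrite open_DeltaE => phi /path_Delta; exact: hU. Qed.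

Lemma Delta_continuous (S T : topologicalType) (f : S -> T) :
  (forall phi : I01 -> S, continuous phi -> continuous (f \o phi)) ->
  continuous (f : Delta R S -> Delta R T).
Proof.
move=> h; apply/continuousP => U; rewrite !open_DeltaE => oU phi /h c; exact: (oU _ c).
Qed.

Lemma Delta_map_continuous (S T : topologicalType) (f : S -> T) :
  continuous f -> continuous (f : Delta R S -> Delta R T).
Proof.
by move=> c; apply: Delta_continuous => phi cp s; apply: continuous_comp; [exact: cp|exact: c].
Qed.

Lemma set_type_compact (T : topologicalType) (A : set T) :
  compact A -> compact [set: set_type A].
Proof.
move=> cA F FF _.
have [|x [Ax clx]] := cA (set_val @ F) _.
  apply: (@filterS _ F _ setT); last exact: filterT.
  by move=> z _; exact: set_valP.
exists (SigSub (mem_set Ax)); split => // B U FB.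
rewrite nbhsE => -[V [[W oW WV] Vx] VU].
have [||_ [[b Bb <-] Wb]] := clx (set_val @` B) W.
- by apply: (@filterS _ F _ B) => // b Bb; exists b.
- by apply: open_nbhs_nbhs; split => //; move: Vx; rewrite -WV.
by exists b; split => //; apply: VU; rewrite -WV.
Qed.

Lemma I01_compact : compact [set: I01].
Proof. by apply: set_type_compact; exact: segment_compact. Qed.

Lemma simplex_compact n : compact [set: simplex R n].
Proof.
apply: set_type_compact.
apply: (@subclosed_compact _ _
  [set v : 'rV[R]_n.+1 | forall i, `[0, 1]%classic (v ord0 i)]).
- have -> : std_simplex R n =
     (\bigcap_(i in [set: 'I_n.+1]) (fun v : 'rV[R]_n.+1 => v ord0 i) @^-1` [set x | 0 <= x])
     `&` (fun v : 'rV[R]_n.+1 => \sum_i v ord0 i) @^-1` [set x | x = 1].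
    apply/seteqP; split=> v /= [h1 h2]; split => // i; [move=> _|]; exact: h1.
  apply: closedI.
    apply: closed_bigI => i _; apply: preimage_closed; last exact: closed_ge.
    by move=> v _; exact: coord_continuous.
  apply: preimage_closed; last exact: closed_eq.
  move=> v _; apply: continuous_big => [|i _]; first exact: add_continuous.
  exact: coord_continuous.
- exact: (@rV_compact R n.+1 (fun=> `[0, 1]%classic) (fun=> @segment_compact R 0 1)).
move=> v [v0 v1] i; rewrite /= in_itv /= v0 -v1 (bigD1 i) //= lerDl.
by apply: sumr_ge0.
Qed.

Lemma real_separated (T : topologicalType) :
  (forall x y : T, (forall f : T -> R, continuous f -> f x = f y) -> x = y) ->
  hausdorff_space T.
Proof.
move=> h p q pq; apply: h => f cf; apply: Rhausdorff => A B fA fB.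
by have [z [Az Bz]] := pq _ _ (cf _ _ fA) (cf _ _ fB); exists (f z).
Qed.

Lemma Delta_Hausdorff_of (T : topologicalType) :
  hausdorff_space T -> Delta_Hausdorff (Delta R T).
Proof.
move=> hT phi /Delta_path c.
have : closed (range phi : set T).
  apply: compact_closed => //; apply: continuous_compact I01_compact.
  exact: continuous_subspaceT.
rewrite -[X in closed X -> _]setCK => /closed_openC; rewrite setCK.
by move=> /open_Delta o; rewrite -[X in closed X]setCK; exact: open_closedC.
Qed.

Section nerve_top.
Context {d : Order.disp_t} {C : porderType d}.

Lemma nerve_hausdorff : hausdorff_space (realization R (nerve C)).
Proof.
apply: real_separated => x y h; apply: below_inj => c.
by apply: h; exact: rexpect_continuous.
Qed.

Lemma bary_le al c (z : realization R (nerve C)) :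
  (forall x, 0 <= al x) -> al c * bary z c <= rexpect al z.
Proof.
move=> al0; have [n [s [t ->]]] := rpointP z.
rewrite /bary !rexpectE mulr_sumr; apply: ler_sum => i _.
have t0 := (set_valP t).1 i.
rewrite mulrCA; apply: ler_wpM2l => //.
by case: eqP => [->|]; rewrite ?mulr1 ?mulr0.
Qed.

Lemma compact_support (X : topologicalType)
    (phi : X -> realization R (nerve C)) :
  compact [set: X] -> continuous phi ->
  finite_set [set c | exists x, 0 < bary (phi x) c].
Proof.
move=> cX cphi; apply: contrapT => /infiniteP/card_leP[g].
pose u n : [set: nat] := SigSub (mem_set (I : [set: nat] n)).
pose f n : C := set_val (g (u n)).
have fI : injective f.
  by move=> a b /val_inj/inj-/(_ (mem_set I) (mem_set I))/(congr1 val).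
have fV n : exists x, 0 < bary (phi x) (f n) by exact: (set_valP (g (u n))).
pose x n := sval (cid (fV n)).
have xP n : 0 < bary (phi (x n)) (f n) by rewrite /x; case: cid.
pose al c : R := 
  if pselect (exists n, f n = c) is left e
   then let n := sval (cid e) in n%:R / bary (phi (x n)) (f n) else 0.
have al0 c : 0 <= al c.
  rewrite /al; case: pselect => //= e.
  by rewrite divr_ge0 // ltW.
have alE n : al (f n) = n%:R / bary (phi (x n)) (f n).
  rewrite /al; case: pselect => [e|[]]; last by exists n.
  by case: cid => m /= /fI ->.
have : compact (range (rexpect al \o phi)).
  apply: continuous_compact cX; apply: continuous_subspaceT => y.
  apply: continuous_comp; [exact: cphi|exact: rexpect_continuous].
move=> /compact_bounded[M [_ MP]].
have [n nM] : exists n : nat, M + 1 < n%:R.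
  by exists (Num.truncn (M + 1)).+1; exact: truncnS_gt.
have M1 : M < M + 1 by rewrite ltrDl.
have := MP _ M1 _ (ex_intro2 _ _ (x n) I erefl); rewrite /= leNgt => /negP; apply.
apply: lt_le_trans nM _; apply: le_trans (ler_norm _).
by apply: le_trans (bary_le (f n) _ al0); rewrite alE divfK // gt_eqF.
Qed.

End nerve_top.

Section pair.
Context {d d' : Order.disp_t} {A : porderType d} {B : porderType d'}.

(* The inverse of the bijection (|pr1|, |pr2|) : |N (A x B)| -> |N A| x |N B|. *)
Definition rpair (x : realization R (nerve A)) (y : realization R (nerve B)) :
  realization R (nerve (A *p B)) := sval (cid (rpair_surj x y)).

Lemma rpairP x y : rfst (rpair x y) = x /\ rsnd (rpair x y) = y.
Proof. by rewrite /rpair; case: cid. Qed.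

Lemma rpair_eq x y z : rfst z = x -> rsnd z = y -> rpair x y = z.
Proof. by have [h1 h2] := rpairP x y => *; apply: rpair_inj; rewrite ?h1 ?h2. Qed.

Lemma rpair_path_continuous (phi : I01 -> realization R (nerve A))
    (psi : I01 -> realization R (nerve B)) :
  continuous phi -> continuous psi -> continuous (fun s => rpair (phi s) (psi s)).
Proof.
move=> cphi cpsi.
have /finite_seqP[FA FAE] := compact_support I01_compact cphi.
have /finite_seqP[FB FBE] := compact_support I01_compact cpsi.
pose F := [seq ((a, b) : A *p B) | a <- FA, b <- FB].
have FP s c : 0 < bary (rpair (phi s) (psi s)) c -> c \in F.
  have [h1 h2] := rpairP (phi s) (psi s) => h; case: c h => a b h.
  have a1 : 0 < bary (phi s) a.
    rewrite -h1 /bary rexpect_map; apply: lt_le_trans h _.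
    rewrite /bary; have [n [r [t ->]]] := rpointP (rpair (phi s) (psi s)).
    rewrite !rexpectE; apply: ler_sum => i _; apply: ler_wpM2l.
      exact: (set_valP t).1.
    by rewrite /=; case: eqP => [->|]; rewrite ?eqxx ?ler0n.
  have b1 : 0 < bary (psi s) b.
    rewrite -h2 /bary rexpect_map; apply: lt_le_trans h _.
    rewrite /bary; have [n [r [t ->]]] := rpointP (rpair (phi s) (psi s)).
    rewrite !rexpectE; apply: ler_sum => i _; apply: ler_wpM2l.
      exact: (set_valP t).1.
    by rewrite /=; case: eqP => [->|]; rewrite ?eqxx ?ler0n.
  apply/allpairsP; exists (a, b); split => //=.
    have : [set c | exists x, 0 < bary (phi x) c] a by exists s.
    by rewrite FAE.
  have : [set c | exists x, 0 < bary (psi x) c] b by exists s.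
  by rewrite FBE.
apply/continuous_closedP => K cK.
pose J := {m : 'I_(size F) & {ffun 'I_m.+1 -> 'I_(size F)}}.
pose E (j : J) := [set s | exists (r : mono 'I_(tag j).+1 (A *p B)) t,
  [/\ (forall i, r i = tnth (in_tuple F) (tagged j i)),
      K (rpoint (K := nerve (A *p B)) r t),
      phi s = rfst (rpoint (K := nerve (A *p B)) r t) &
      psi s = rsnd (rpoint (K := nerve (A *p B)) r t)]].
suff -> : (fun s => rpair (phi s) (psi s)) @^-1` K = \bigcup_(j in setT) E j.
  apply: closed_bigcup => [|j _]; first exact: finite_finset.
  have [[r rE]|nr] := pselect (exists r : mono 'I_(tag j).+1 (A *p B),
      forall i, r i = tnth (in_tuple F) (tagged j i)); last first.
    rewrite (_ : E j = set0); first exact: closed0.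
    by apply/seteqP; split => // s [r [t [h _ _ _]]]; apply: nr; exists r.
  pose rp : simplex R (tag j) -> realization R (nerve (A *p B)) :=
    rpoint (K := nerve (A *p B)) r.
  pose g t : realization R (nerve A) * realization R (nerve B) :=
    (rfst (rp t), rsnd (rp t)).
  have crp : continuous rp by exact: rpoint_continuous.
  have cg : continuous g.
    by apply: continuous_pair;
      exact: (continuous_compose crp (@realization_map_continuous _ _ _ _)).
  have -> : E j = (fun s => (phi s, psi s)) @^-1` (g @` (rp @^-1` K)).
    apply/seteqP; split => s /=.
      move=> [r' [t [r'E Kt h1 h2]]].
      have e : r' = r by apply: mono_eq => i; rewrite r'E rE.
      by exists t; rewrite ?e /g /rp ?h1 ?h2 -?e.
    by move=> [t Kt [h1 h2]]; exists r, t.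
  apply: preimage_closed; last first.
    apply: (@compact_closed (realization R (nerve A) * realization R (nerve B))%type).
      apply: real_separated => -[x y] [x' y'] h; congr pair.
        apply: below_inj => c; apply: (h (rexpect (below R c) \o fst)) => z.
        by apply: continuous_comp; [exact: cvg_fst|exact: rexpect_continuous].
      apply: below_inj => c; apply: (h (rexpect (below R c) \o snd)) => z.
      by apply: continuous_comp; [exact: cvg_snd|exact: rexpect_continuous].
    apply: continuous_compact; first exact: continuous_subspaceT.
    apply: subclosed_compact (@simplex_compact _) _ => //.
    by apply: preimage_closed => //; move=> x _; exact: crp.
  by move=> s _; exact: continuous_pair.
apply/seteqP; split => s /=; last first.
  by move=> [j _ [r [t [_ Kt h1 h2]]]]; rewrite (rpair_eq (esym h1) (esym h2)).
move=> Ks; have [n [r [t [zE rI t0]]]] := rpoint_nf (rpair (phi s) (psi s)).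
have rF i : r i \in F by apply: (FP s); rewrite zE bary_gt0.
have nF : (n < size F)%N.
  rewrite -[n.+1]card_ord -(size_codom r); apply: uniq_leq_size.
    by rewrite codomE map_inj_uniq ?enum_uniq.
  by move=> _ /codomP[i ->].
have iF i : (index (r i) F < size F)%N by rewrite index_mem.
exists (existT _ (Ordinal nF) [ffun i => Ordinal (iF i)]) => //.
have [h1 h2] := rpairP (phi s) (psi s).
exists r, t; rewrite -zE; split => // i.
by rewrite ffunE (tnth_nth (r i)) /= nth_index.
Qed.

End pair.
End Top.

Section pair_natural.
Variable R : realType.

Definition nerve_realization_map d d' (A : porderType d) (B : porderType d') (f : mono A B) :
  realization R (nerve A) -> realization R (nerve B) := realization_map (nerve_map f).

Lemma nmap_comp d d' d'' (A : porderType d) (B : porderType d') (C : porderType d'')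
    (g : mono B C) (f : mono A B) z : nerve_realization_map g (nerve_realization_map f z) = nerve_realization_map (mono_comp g f) z.
Proof.
have [n [x [t ->]]] := rpointP z; rewrite /nerve_realization_map !realization_mapE.
by congr (rpoint _ t); exact: mono_eq.
Qed.

Lemma nmap_id d (A : porderType d) z : nerve_realization_map (mono_id A) z = z.
Proof.
have [n [x [t ->]]] := rpointP z; rewrite /nerve_realization_map realization_mapE.
by congr (rpoint _ t); exact: mono_eq.
Qed.

Lemma nmap_eq d d' (A : porderType d) (B : porderType d') (f g : mono A B) z :
  f =1 g -> nerve_realization_map f z = nerve_realization_map g z.
Proof. by move=> /mono_eq ->. Qed.

Context {d1 d2 d3 e1 e2 : Order.disp_t}.
Context {A : porderType d1} {B : porderType d2} {C : porderType d3}.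
Context {A' : porderType e1} {B' : porderType e2}.

Definition mono_prod (f : mono A A') (g : mono B B') : mono (A *p B) (A' *p B').
Proof.
exists (fun p : A *p B => (f p.1, g p.2) : A' *p B') => -[a b] [a' b'].
by move=> /andP[/= aa bb]; apply/andP; split; exact: monoP.
Defined.

Lemma nmap_pair (f : mono A A') (g : mono B B') x y :
  nerve_realization_map (mono_prod f g) (rpair x y) = rpair (nerve_realization_map f x) (nerve_realization_map g y).
Proof.
have [h1 h2] := rpairP x y; apply/esym/rpair_eq.
  by rewrite -{2}h1 /rfst -!/(nerve_realization_map _) !nmap_comp; exact: nmap_eq.
by rewrite -{2}h2 /rsnd -!/(nerve_realization_map _) !nmap_comp; exact: nmap_eq.
Qed.

Definition mono_assoc : mono (A *p (B *p C)) ((A *p B) *p C).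
Proof.
exists (fun p : A *p (B *p C) => ((p.1, p.2.1) : A *p B, p.2.2) : (A *p B) *p C).
move=> [a [b c]] [a' [b' c']] /andP[/= aa /andP[/= bb cc]].
by apply/andP; split=> //; apply/andP.
Defined.

Lemma nmap_assoc x y z :
  nerve_realization_map mono_assoc (rpair x (rpair y z)) = rpair (rpair x y) z.
Proof.
have [h1 h2] := rpairP x (rpair y z); have [h3 h4] := rpairP y z.
have h5 : rfst (rsnd (rpair x (rpair y z))) = y by rewrite h2.
have h6 : rsnd (rsnd (rpair x (rpair y z))) = z by rewrite h2.
apply/esym/rpair_eq.
  apply/esym/rpair_eq.
    by rewrite -[RHS]h1 /rfst -!/(nerve_realization_map _) !nmap_comp; exact: nmap_eq.
  by rewrite -[RHS]h5 /rfst /rsnd -!/(nerve_realization_map _) !nmap_comp; exact: nmap_eq.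
by rewrite -[RHS]h6 /rsnd -!/(nerve_realization_map _) !nmap_comp; exact: nmap_eq.
Qed.
End pair_natural.


(* A strict chain x = x_0 < x_1 < ... < x_k = y with k >= 1 is encoded by
   [:: x_1; ...; x_k].  With both endpoints fixed, refinement is subseq, and
   concatenation of chains is ++. *)
Section chains.
Context {d : Order.disp_t} {P : porderType d}.

Definition is_chain (x y : P) (s : seq P) :=
  [&& path <%O x s, s != [::] & last x s == y].

Record chain (x y : P) := Chain { chain_tail :> seq P; chainP : is_chain x y chain_tail }.

HB.instance Definition _ x y := [isSub for @chain_tail x y].
HB.instance Definition _ x y := [Choice of chain x y by <:].

Definition chain_le (x y : P) (s t : chain x y) := subseq s t.

Lemma chain_le_refl x y : reflexive (@chain_le x y).
Proof. by move=> s; exact: subseq_refl. Qed.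
Lemma chain_le_anti x y : antisymmetric (@chain_le x y).
Proof.
move=> s t /andP[st ts]; apply/val_inj/eqP.
by have := size_subseq_leqif st; case=> _ <-; rewrite eqn_leq !size_subseq.
Qed.
Lemma chain_le_trans x y : transitive (@chain_le x y).
Proof. by move=> s t u; exact: subseq_trans. Qed.

Fact chain_display : Order.disp_t. Proof. exact: Order.Disp tt tt. Qed.
HB.instance Definition _ x y := Order.Le_isPOrder.Build chain_display (chain x y)
  (@chain_le_refl x y) (@chain_le_anti x y) (@chain_le_trans x y).

Lemma chain_lt (x y : P) : chain x y -> (x < y)%O.
Proof.
case=> s /and3P[p s0 /eqP <-]; move: p.
rewrite lt_path_sortedE => /andP[/allP h _]; apply: h.
by case: (s) s0 => //= a l _; exact: mem_last.
Qed.

Lemma chain_cat_subproof (x y z : P) (s : chain x y) (t : chain y z) :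
  is_chain x z (s ++ t).
Proof.
have /and3P[ps s0 /eqP ls] := chainP s; have /and3P[pt t0 lt] := chainP t.
by rewrite /is_chain cat_path ps ls pt last_cat ls lt andbT; case: (chain_tail s) s0.
Qed.

Lemma chain_cat_mono_subproof (x y z : P) :
  {homo (fun p : chain x y *p chain y z =>
           Chain (chain_cat_subproof p.1 p.2)) : p q / (p <= q)%O}.
Proof. by move=> [s t] [s' t'] /andP[ss tt]; exact: cat_subseq. Qed.

Definition chain_cat (x y z : P) : mono (chain x y *p chain y z) (chain x z) :=
  Mono (@chain_cat_mono_subproof x y z).
End chains.

Section chain_map.
Context {d d' : Order.disp_t} {P : porderType d} {Q : porderType d'}.
Variables (f : P -> Q) (fP : {homo f : x y / (x < y)%O}).

Lemma chain_map_subproof (x y : P) (s : chain x y) : is_chain (f x) (f y) (map f s).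
Proof.
have /and3P[ps s0 /eqP ls] := chainP s; apply/and3P; split.
- exact: (homo_path fP).
- by case: (chain_tail s) s0.
- by rewrite last_map ls.
Qed.

Lemma chain_map_mono_subproof (x y : P) :
  {homo (fun s : chain x y => Chain (chain_map_subproof s)) : s t / (s <= t)%O}.
Proof. by move=> s t; exact: map_subseq. Qed.

Definition chain_map (x y : P) : mono (chain x y) (chain (f x) (f y)) :=
  Mono (@chain_map_mono_subproof x y).
End chain_map.

Inductive Top_choice := DeltaGeneratedSpaces | DeltaHausdorffSpaces.

Section Flow.
Variables (R : realType) (k : Top_choice).

Definition in_Top (T : topologicalType) :=
  Delta_generated R T /\ (k = DeltaHausdorffSpaces -> Delta_Hausdorff R T).

Record Top := MkTop { Top_space :> topologicalType; Top_in : in_Top Top_space }.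

Lemma to_Top_subproof (T : topologicalType) : hausdorff_space T -> in_Top (Delta R T).
Proof.
by move=> hT; split=> [|_]; [exact: Delta_generatedP|exact: Delta_Hausdorff_of].
Qed.

Definition to_Top (T : topologicalType) (hT : hausdorff_space T) : Top :=
  MkTop (to_Top_subproof hT).

(* A product in Top is the Delta-ification of the product topology. *)
Record flow := Flow {
  state :> Type;
  exec : state -> state -> Top;
  concat : forall u v w, exec u v -> exec v w -> exec u w;
  concat_continuous : forall u v w, continuous
    (fun p : Delta R (exec u v * exec v w)%type => concat p.1 p.2 : exec u w);
  concatA : forall u v w z (a : exec u v) (b : exec v w) (c : exec w z),
    concat a (concat b c) = concat (concat a b) c }.

Record flow_map (X Y : flow) := FlowMap {
  map_state :> X -> Y;
  map_exec : forall u v, exec u v -> exec (map_state u) (map_state v);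
  map_exec_continuous : forall u v, continuous (@map_exec u v);
  map_concat : forall u v w (a : exec u v) (b : exec v w),
    map_exec (concat a b) = concat (map_exec a) (map_exec b) }.

(* By extensionality and proof irrelevance, Leibniz equality of flow maps is
   equality of the underlying functions. *)
Definition flow_id (X : flow) : flow_map X X.
Proof.
by exists id (fun u v a => a) => // u v a; exact: cvg_id.
Defined.

Definition flow_comp (X Y Z : flow) (g : flow_map Y Z) (f : flow_map X Y) :
  flow_map X Z.
Proof.
exists (fun x => g (f x)) (fun u v a => map_exec g (map_exec f a)).
- move=> u v; apply: continuous_compose; exact: map_exec_continuous.
- by move=> u v w a b; rewrite !map_concat.
Defined.

Lemma continuous_from_void (S T : topologicalType) (f : S -> T) :
  (S -> False) -> continuous f.
Proof. by move=> S0 x; have := S0 x. Qed.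

Lemma continuous_to_subsingleton (S T : topologicalType) (f : S -> T) :
  (forall y y' : T, y = y') -> continuous f.
Proof.
move=> h x A /nbhs_singleton Ax; rewrite /= nbhs_simpl /=.
by apply: filterS filterT => y _; rewrite /= (h (f y) (f x)).
Qed.

Lemma void_hausdorff : hausdorff_space (discrete_topology void).
Proof. exact: discrete_hausdorff. Qed.

Definition Top_void : Top := to_Top void_hausdorff.

Lemma Top_void_false : Top_void -> False. Proof. by case. Qed.

Definition set_flow (S : Type) : flow.
Proof.
apply: (@Flow S (fun _ _ => Top_void) (fun _ _ _ a _ => False_rect _ (Top_void_false a))).
- by move=> u v w; apply: continuous_from_void => -[].
- by move=> u v w z [].
Defined.

Definition set_flow_map (S : Type) (X : flow) (f : S -> X) :
  flow_map (set_flow S) X.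
Proof.
apply: (@FlowMap (set_flow S) X f (fun _ _ a => False_rect _ (Top_void_false a))).
- by move=> u v; apply: continuous_from_void => -[].
- by move=> u v w [].
Defined.

(* The states 0 and 1 are false and true. *)
Definition Glob_exec (Z : Top) (u v : bool) : Top :=
  match u, v with false, true => Z | _, _ => Top_void end.

Lemma Glob_exec_false Z u v w : Glob_exec Z u v -> Glob_exec Z v w -> False.
Proof. by case: u v w => [] [] [] // []. Qed.

Definition Glob (Z : Top) : flow.
Proof.
apply: (@Flow bool (Glob_exec Z)
  (fun _ _ _ a b => False_rect _ (Glob_exec_false a b))).
- by move=> u v w; apply: continuous_from_void => -[a b]; exact: Glob_exec_false a b.
- by move=> u v w z a b; case: (Glob_exec_false a b).
Defined.

Definition Glob_map_exec (Y Z : Top) (f : Y -> Z) u v :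
    Glob_exec Y u v -> Glob_exec Z u v :=
  match u, v with false, true => f | _, _ => id end.

Definition Glob_map (Y Z : Top) (f : Y -> Z) (cf : continuous f) :
  flow_map (Glob Y) (Glob Z).
Proof.
apply: (@FlowMap (Glob Y) (Glob Z) id (Glob_map_exec f)).
- by move=> [] [] //; apply: continuous_from_void => -[].
- by move=> u v w a b; case: (Glob_exec_false a b).
Defined.

Section generators.
Variable n : nat.

Definition disk_set : set 'rV[R]_n := [set x | \sum_i x ord0 i ^+ 2 <= 1].
Definition sphere_set : set 'rV[R]_n := [set x | \sum_i x ord0 i ^+ 2 = 1].
Definition disk : topologicalType := set_type disk_set.
Definition sphere : topologicalType := set_type sphere_set.
Definition disk_boundary : set disk := [set x | sphere_set (set_val x)].

Lemma set_type_rV_hausdorff (A : set 'rV[R]_n) : hausdorff_space (set_type A).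
Proof.
apply: (@real_separated R) => x y h; apply/val_inj/rowP => i.
apply: (h (fun z => set_val z ord0 i)).
apply: (@continuous_compose _ _ _ (set_val : set_type A -> 'rV[R]_n)
  (fun v : 'rV[R]_n => v ord0 i)).
  exact: initial_continuous.
exact: coord_continuous.
Qed.

Definition Top_disk : Top := to_Top (@set_type_rV_hausdorff disk_set).
Definition Top_sphere : Top := to_Top (@set_type_rV_hausdorff sphere_set).

Lemma sphere_disk_subproof (x : sphere) : set_val x \in disk_set.
Proof. by apply/mem_set; rewrite /disk_set /= (set_valP x). Qed.

Definition sphere_disk (x : Top_sphere) : Top_disk := SigSub (sphere_disk_subproof x).

Lemma sphere_disk_continuous : continuous sphere_disk.
Proof.
apply: (@Delta_map_continuous R sphere disk) => /=.
apply/continuousP => _ [V oV <-].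
rewrite (_ : _ @^-1` _ = set_val @^-1` V); first by exists V.
by apply/seteqP; split.
Qed.
End generators.

Inductive generating_cofibration : forall A B : flow, flow_map A B -> Prop :=
| gen_globe n : generating_cofibration (Glob_map (@sphere_disk_continuous n))
| gen_C : generating_cofibration
    (@set_flow_map void (set_flow unit) (fun x => match x with end))
| gen_R : generating_cofibration
    (@set_flow_map bool (set_flow unit) (fun=> tt)).

Definition is_pushout (A B X Y : flow) (i : flow_map A B) (a : flow_map A X)
    (b : flow_map B Y) (j : flow_map X Y) :=
  flow_comp b i = flow_comp j a /\
  forall (Z : flow) (f : flow_map B Z) (g : flow_map X Z),
    flow_comp f i = flow_comp g a ->
    exists! h : flow_map Y Z, flow_comp h b = f /\ flow_comp h j = g.

Definition is_iso (X Y : flow) (f : flow_map X Y) :=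
  exists g : flow_map Y X, flow_comp g f = flow_id X /\ flow_comp f g = flow_id Y.

Record diagram d (W : porderType d) := Diagram {
  dobj :> W -> flow;
  dmap : forall v w : W, (v <= w)%O -> flow_map (dobj v) (dobj w);
  dmap_id : forall w (h : (w <= w)%O), dmap h = flow_id (dobj w);
  dmap_comp : forall u v w (h : (u <= v)%O) (h' : (v <= w)%O) (h'' : (u <= w)%O),
    dmap h'' = flow_comp (dmap h') (dmap h) }.

Section colimit.
Context {d : Order.disp_t} {W : porderType d}.
Variables (D : diagram W) (A : W -> Prop).

Definition is_cocone (Y : flow) (c : forall w, A w -> flow_map (D w) Y) :=
  forall v w (h : (v <= w)%O) (Av : A v) (Aw : A w),
    flow_comp (c w Aw) (dmap D h) = c v Av.

Definition is_colimit (Y : flow) (c : forall w, A w -> flow_map (D w) Y) :=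
  is_cocone c /\
  forall (Z : flow) (g : forall w, A w -> flow_map (D w) Z), is_cocone g ->
    exists! h : flow_map Y Z, forall w (Aw : A w), flow_comp h (c w Aw) = g w Aw.
End colimit.

(* For a well-order W, [covers v w] says that w is the successor of v. *)
Definition covers d (W : porderType d) (v w : W) :=
  (v < w)%O /\ forall u : W, (u < w)%O -> (u <= v)%O.

(* W is a nonzero ordinal and D a colimit-preserving W-sequence; f is
   D 0 -> colim D, precomposed with an isomorphism so that its source need not be
   literally D 0. *)
Definition transfinite_composition (S : forall X Y, flow_map X Y -> Prop)
    (X Y : flow) (f : flow_map X Y) :=
  exists (d : Order.disp_t) (W : orderType d) (bot : W) (D : diagram W)
      (i : flow_map X (D bot)) (c : forall w, True -> flow_map (D w) Y),
    [/\ well_founded (fun v w : W => (v < w)%O) /\ (forall w, (bot <= w)%O),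
        forall v w (h : covers v w), S _ _ (dmap D (ltW h.1)),
        forall w, w <> bot -> (forall v, ~ covers v w) ->
          is_colimit (A := fun v => (v < w)%O) (fun v (h : (v < w)%O) => dmap D (ltW h)),
        is_colimit c &
        is_iso i /\ f = flow_comp (c bot I) i].

Definition pushout_of_generator (X Y : flow) (j : flow_map X Y) :=
  exists (A B : flow) (i : flow_map A B) (a : flow_map A X) (b : flow_map B Y),
    generating_cofibration i /\ is_pushout i a b j.

Definition relative_cell_complex (X Y : flow) (f : flow_map X Y) :=
  transfinite_composition pushout_of_generator f.

Definition is_retract (A B X Y : flow) (f : flow_map A B) (g : flow_map X Y) :=
  exists (i : flow_map A X) (r : flow_map X A) (j : flow_map B Y) (s : flow_map Y B),
    [/\ flow_comp r i = flow_id A, flow_comp s j = flow_id B,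
        flow_comp g i = flow_comp j f & flow_comp f r = flow_comp s g].

Definition q_cofibration (X Y : flow) (f : flow_map X Y) :=
  exists (X' Y' : flow) (g : flow_map X' Y'),
    relative_cell_complex g /\ is_retract f g.

Definition q_cofibrant (X : flow) :=
  q_cofibration (@set_flow_map void X (fun x => match x with end)).

Section homotopy.
Implicit Types X Y T : topologicalType.

Definition joined X (x y : X) :=
  exists g : I01 R -> X, [/\ continuous g, g (I01_zero R) = x & g (I01_one R) = y].

Definition homotopic_rel T X (A : set T) (f g : T -> X) :=
  exists H : T * I01 R -> X, [/\ continuous H,
    forall t, H (t, I01_zero R) = f t, forall t, H (t, I01_one R) = g t &
    forall t s, A t -> H (t, s) = f t].

Definition spheroid n X (x : X) (a : disk n -> X) :=
  continuous a /\ forall t, disk_boundary t -> a t = x.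

(* pi_n (X, x) is the set of homotopy classes, relative to the boundary, of maps
   (D^n, S^(n-1)) -> (X, x); pi_0 is the set of path components. *)
Definition weak_homotopy_equivalence X Y (f : X -> Y) :=
  [/\ continuous f,
      forall x x', joined (f x) (f x') -> joined x x',
      forall y, exists x, joined (f x) y &
      forall n (x : X), (0 < n)%N ->
        (forall a b : disk n -> X, spheroid x a -> spheroid x b ->
           homotopic_rel (@disk_boundary n) (f \o a) (f \o b) ->
           homotopic_rel (@disk_boundary n) a b) /\
        (forall c : disk n -> Y, spheroid (f x) c ->
           exists2 a, spheroid x a & homotopic_rel (@disk_boundary n) (f \o a) c)].

Definition Serre_fibration X Y (f : X -> Y) :=
  continuous f /\
  forall n (g : disk n -> X) (H : disk n * I01 R -> Y),
    continuous g -> continuous H -> (forall z, H (z, I01_zero R) = f (g z)) ->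
    exists G : disk n * I01 R -> X, [/\ continuous G,
      forall z, G (z, I01_zero R) = g z & forall p, f (G p) = H p].
End homotopy.

Definition weak_equivalence (X Y : flow) (f : flow_map X Y) :=
  bijective f /\ forall u v, weak_homotopy_equivalence (@map_exec X Y f u v).

Definition q_fibration (X Y : flow) (f : flow_map X Y) :=
  forall u v, Serre_fibration (@map_exec X Y f u v).

Definition trivial_q_fibration (X Y : flow) (f : flow_map X Y) :=
  q_fibration f /\ weak_equivalence f.

Section posets.
Context {d : Order.disp_t} (P : porderType d).

Definition poset_exec (x y : P) : Top :=
  to_Top (@discrete_hausdorff (discrete_topology {_ : unit | (x < y)%O})).

Lemma poset_exec_eq x y (a b : poset_exec x y) : a = b.
Proof. by apply: val_inj; case: (val a) (val b) => -[]. Qed.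

Definition poset_flow : flow.
Proof.
apply: (@Flow P poset_exec
  (fun u v w a b => exist _ tt (lt_trans (svalP a) (svalP b)))).
- by move=> u v w; apply: continuous_to_subsingleton; exact: poset_exec_eq.
- by move=> u v w z a b c; exact: poset_exec_eq.
Defined.

Definition Ch_exec (x y : P) : Top := to_Top (@nerve_hausdorff R _ (chain x y)).

Definition Ch_concat (x y z : P) (a : Ch_exec x y) (b : Ch_exec y z) : Ch_exec x z :=
  realization_map (nerve_map (chain_cat x y z)) (rpair a b).

Lemma Ch_concat_continuous (x y z : P) : continuous
  (fun p : Delta R (Ch_exec x y * Ch_exec y z)%type => Ch_concat p.1 p.2).
Proof.
apply: (@Delta_continuous R _ (realization R (nerve (chain x z)))
  (fun p : (Ch_exec x y * Ch_exec y z)%type => Ch_concat p.1 p.2)) => phi cphi.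
apply: (@continuous_compose _ _ _
  (fun s => rpair ((phi s).1 : realization R (nerve (chain x y))) (phi s).2)).
  apply: rpair_path_continuous; apply: Delta_path.
    by apply: (continuous_compose cphi) => p; exact: cvg_fst.
  by apply: (continuous_compose cphi) => p; exact: cvg_snd.
exact: realization_map_continuous.
Qed.

Lemma Ch_concatA (x y z t : P) (a : Ch_exec x y) (b : Ch_exec y z) (c : Ch_exec z t) :
  Ch_concat a (Ch_concat b c) = Ch_concat (Ch_concat a b) c.
Proof.
rewrite /Ch_concat -!/(nerve_realization_map _ _).
have e s : nerve_realization_map (mono_id _) s = s by move=> *; exact: nmap_id.
rewrite -{1}[a]e -[in RHS](e _ _ _ c) -!nmap_pair -nmap_assoc !nmap_comp.
by apply: nmap_eq => p; apply: val_inj; rewrite /= catA.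
Qed.

Definition Ch : flow := Flow Ch_concat_continuous Ch_concatA.

Lemma Ch_exec_lt (x y : P) (a : Ch_exec x y) : (x < y)%O.
Proof. by have [n [s _]] := rpointP a; exact: chain_lt (s ord0). Qed.

Definition augmentation_exec (x y : P) (a : Ch_exec x y) : poset_exec x y :=
  exist _ tt (Ch_exec_lt a).

Definition augmentation : flow_map Ch poset_flow.
Proof.
apply: (@FlowMap Ch poset_flow id augmentation_exec).
- by move=> u v; apply: continuous_to_subsingleton; exact: poset_exec_eq.
- by move=> u v w a b; exact: poset_exec_eq.
Defined.

End posets.

Section Ch_map.
Context {d d' : Order.disp_t} {P : porderType d} {Q : porderType d'}.
Variables (f : P -> Q) (fP : {homo f : x y / (x < y)%O}).

Definition Ch_map_exec (x y : P) (a : Ch_exec x y) : Ch_exec (f x) (f y) :=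
  realization_map (nerve_map (chain_map fP x y)) a.

Definition Ch_map : flow_map (Ch P) (Ch Q).
Proof.
apply: (@FlowMap (Ch P) (Ch Q) f Ch_map_exec).
- move=> u v; apply: (@Delta_map_continuous R (realization R _) (realization R _)).
  exact: realization_map_continuous.
- move=> u v w a b; rewrite /= /Ch_concat /Ch_map_exec -!/(nerve_realization_map _ _).
  rewrite -nmap_pair !nmap_comp; apply: nmap_eq => p.
  by apply: val_inj; rewrite /= map_cat.
Defined.
End Ch_map.
End Flow.

(* Main.v *)
Require Import Defs.
From HB Require Import structures.
From mathcomp Require Import all_boot all_order all_algebra finmap ring lra zify.
From mathcomp Require Import all_classical reals topology normedtype realfun.
From mathcomp Require wochoice.

(** Write E x y for |N C_Q(x, y)|, the execution paths of Ch(Q) from x to y.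

    The augmentation.  C_Q(x, y) has a least element, the one-step chain, so
    every nonempty E x y is a cone and contracts to its apex
    ([contract_continuous]).  The homotopy groups are relative to the boundary,
    so the contraction is combined with a radial stretching of the disk
    ([spheroid_homotopic]).  Lifting along a map to a point is trivial.

    The cells.  A point of E x y has a support: the finite set of chains with a
    positive barycentric coordinate, totally ordered by refinement.  It is a
    concatenation at p exactly when p lies on all the chains of its support, that
    is, on the least one.  Concatenation is injective and two factorizations at
    different vertices have a common refinement ([concat_inj],
    [concat_levi_lt]), so that Ch(Q) without its topology is the free
    semicategory on the points whose least chain has one step ([ind]).  These
    points form the open simplices of N C_Q(x, y) whose first vertex is the
    one-step chain.  Each of them is attached along a sphere: its faces that keep
    the first vertex are smaller such simplices, and the points of the face
    opposite to the first vertex are concatenations of points of smaller such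
    simplices.

    Accordingly a set B of states and cells generates a subflow ([subflow]); it is
    asked to generate the boundaries of its cells ([closed_items]).  A map out of
    this subflow is determined by its values on states and on indecomposable
    points; these values extend multiplicatively by freeness ([free_extension]),
    and continuity has to be checked only on simplices that begin with a one-step chain, because every
    simplex is a concatenation of such ones ([ext_continuous]).  From this follow
    the three universal properties: adding one state is a pushout of C
    ([state_pushout]), adding one cell is a pushout of Glob(S^(n-1)) -> Glob(D^n)
    ([cell_pushout]), and the subflow of a directed union is the colimit
    ([sub_colimit]).

    The cell complex.  For P included in Q, the image of Ch(P) is the subflow
    generated by the states and cells of P ([image_in_iso]).  The remaining
    states and cells are well-ordered, states first and then cells by dimension,
    and added one at a time ([sub_relative_cell_complex]).  The case without any
    state or cell at the start gives cofibrancy of Ch(Q). *)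

Set Implicit Arguments.
Unset Strict Implicit.
Unset Printing Implicit Defensive.
Import Order.TTheory GRing.Theory Num.Theory numFieldNormedType.Exports.
Local Open Scope classical_set_scope.
Local Open Scope ring_scope.

(** * Convex subsets of normed spaces are Delta-generated *)

Section convex_Delta_generated.
Context {R : realType} {V : normedModType R}.

(** Height of a zigzag that vanishes at the integers and equals 1 halfway between two of
    them. *)
Definition tent (s : R) : R := 2 * Num.min (s - (Num.truncn s)%:R) (1 - (s - (Num.truncn s)%:R)).

Lemma tent_bound (s : R) : 0 <= s -> 0 <= tent s <= 1.
Proof.
move=> s0; rewrite /tent; have /andP[h1 h2] := Num.Theory.truncn_itv s0.
set f := s - _; have f0 : 0 <= f by rewrite subr_ge0.
have f1 : f <= 1 by rewrite -natr1 in h2; rewrite /f; lra.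
by case: (leP f (1 - f)) => h; lra.
Qed.

Lemma tent_le (s : R) m : 0 <= s -> tent s <= 2 * `|s - m%:R|.
Proof.
move=> s0; rewrite /tent; have /andP[h1 h2] := Num.Theory.truncn_itv s0.
rewrite ler_pM2l //; have [mk|km] := leqP m (Num.truncn s).
  have mk' : (m%:R <= (Num.truncn s)%:R :> R) by rewrite ler_nat.
  by rewrite ge_min ger0_norm; lra.
have km' : ((Num.truncn s).+1%:R <= m%:R :> R) by rewrite ler_nat.
rewrite -natr1 in h2 km'; rewrite ge_min ler0_norm; lra.
Qed.

(** The product is Lipschitz although its second factor jumps at the integers, because
    the tent vanishes there. *)
Lemma tent_lip (d : nat -> V) (s s' : R) : (forall n, `|d n| <= 1) ->
  0 <= s -> s <= s' ->
  `|tent s *: d (Num.truncn s) - tent s' *: d (Num.truncn s')| <= 2 * (s' - s).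
Proof.
move=> d1 s0 ss'; have s'0 := le_trans s0 ss'.
have [e|ne] := eqVneq (Num.truncn s) (Num.truncn s').
  rewrite e -scalerBl normrZ.
  apply: (@le_trans _ _ (`|tent s - tent s'| * 1)); first exact: ler_wpM2l.
  rewrite mulr1 /tent e -mulrBr normrM ger0_norm // ler_pM2l //.
  set a := (_)%:R; rewrite ler_norml.
  case: (leP (s - a) (1 - (s - a))) => ?; case: (leP (s' - a) (1 - (s' - a))) => ?;
   apply/andP; split; lra.
have lt : (Num.truncn s < Num.truncn s')%N.
  by rewrite ltn_neqAle ne; apply: Num.Theory.le_truncn.
apply: (le_trans (ler_normB _ _)); rewrite [X in X + _ <= _]normrZ [X in _ + X <= _]normrZ.
have /andP[t0 _] := tent_bound s0; have /andP[t'0 _] := tent_bound s'0.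
rewrite (ger0_norm t0) (ger0_norm t'0).
apply: (@le_trans _ _ (tent s + tent s')).
  by apply: lerD; rewrite -[leRHS]mulr1; exact: ler_wpM2l.
have := tent_le (Num.truncn s') s'0; have := tent_le (Num.truncn s') s0.
have /andP[_ h2] := Num.Theory.truncn_itv s0; have /andP[h3 _] := Num.Theory.truncn_itv s'0.
have lt' : ((Num.truncn s).+1%:R <= (Num.truncn s')%:R :> R) by rewrite ler_nat.
rewrite [X in _ <= 2 * X]ler0_norm; last lra.
rewrite ger0_norm; lra.
Qed.

(** A path that starts at x and, as its parameter decreases to 0, visits the points x +
    d n one after the other, returning to x between two visits. *)
Lemma zigzag_continuous (x : V) (d : nat -> V) :
  (forall n, `|d n| <= n.+1%:R^-1) ->
  continuous (fun t : I01 R =>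
    x + tent (Num.norm (set_val t)^-1) *: d (Num.truncn (Num.norm (set_val t)^-1))).
Proof.
move=> hd; have d1 n : `|d n| <= 1.
  by apply: (le_trans (hd n)); rewrite invf_le1 ?ler1n // ltr0n.
pose psi (s : R) := tent (Num.norm s) *: d (Num.truncn (Num.norm s)).
have cpsi : continuous psi.
  move=> s; apply/cvgrPdist_lt => e e0; near=> s'.
  have h : `|psi s - psi s'| <= 2 * `|s - s'|.
    have [le|/ltW le] := leP `|s| `|s'|.
      apply: (le_trans (tent_lip d1 _ le)) => //; rewrite ler_pM2l //.
      by rewrite distrC; exact: lerB_dist.
    rewrite distrC; apply: (le_trans (tent_lip d1 _ le)) => //; rewrite ler_pM2l //.
    exact: lerB_dist.
  apply: le_lt_trans h _; rewrite mulrC -ltr_pdivlMr //.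
  near: s'; apply: cvgr_dist_lt => //; exact: divr_gt0.
pose f (t : R) := x + psi t^-1.
have cf : continuous f.
  move=> t; have [->|t0] := eqVneq t 0; last first.
    apply: cvgD; first exact: cvg_cst.
    by apply: continuous_comp; [exact: inv_continuous|exact: cpsi].
  have psi0 : psi 0 = 0.
    by rewrite /psi normr0 /tent Num.Theory.truncn0 !subr0 min_l ?ler01 ?mulr0 ?scale0r.
  rewrite /continuous_at /f invr0 psi0 addr0.
  apply/cvgrPdist_lt => e e0; clear t; near=> t.
  rewrite opprD addrA subrr add0r normrN.
  apply: (@le_lt_trans _ _ `|t|).
    have [->|t0] := eqVneq t 0; first by rewrite invr0 psi0 normr0.
    have /andP[b0 b1] := tent_bound (normr_ge0 t^-1).
    rewrite /psi normrZ ger0_norm //.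
    apply: (le_trans (ler_wpM2r (normr_ge0 _) b1)); rewrite mul1r.
    apply: (le_trans (hd _)).
    rewrite -[leRHS]invrK -normfV lef_pV2 ?posrE ?ltr0n ?normr_gt0 ?invr_eq0 //.
    exact/ltW/Num.Theory.truncnS_gt.
  by rewrite -[t]subr0 distrC; near: t; exact: cvgr_dist_lt.
by apply: (@continuous_compose _ _ _ (set_val : I01 R -> R) f) => //; exact: initial_continuous.
Unshelve. all: by end_near.
Qed.

(** Let U be open along paths.  If a point x of U had points y n outside U arbitrarily
    close to it, a path that starts at x and passes through the points y n at
    arbitrarily small times would have a preimage of U that is not a neighbourhood of 0. *)
Lemma convex_Delta_generated (A : set V) :
  (forall x y t, A x -> A y -> 0 <= t <= 1 -> A (x + t *: (y - x))) ->
  Delta_generated R (set_type A).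
Proof.
move=> cA U hU; rewrite openE => x Ux; apply: contrapT => nU.
have /choice[y yP] n : exists y : set_type A,
    `|set_val y - set_val x| <= n.+1%:R^-1 /\ ~ U y.
  apply: contrapT => /forallNP ny; apply: nU.
  exists (set_val @^-1` (ball (set_val x) n.+1%:R^-1)).
  split.
  - by eexists; last reflexivity; exact: ball_open.
  - by apply: ballxx; rewrite invr_gt0 ltr0n.
  - move=> y /=; rewrite -ball_normE /= distrC => /ltW hy.
    by apply: contrapT => nUy; exact: (ny y).
pose d n := set_val (y n) - set_val x.
have : continuous (fun t : I01 R =>
    set_val x + tent (Num.norm (set_val t)^-1) *: d (Num.truncn (Num.norm (set_val t)^-1))).
  by apply: zigzag_continuous => n; have [] := yP n.
set phi := (fun t => _) => cphi.
have phiA t : phi t \in A.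
  apply/mem_set; rewrite /phi; apply: cA; [exact: set_valP|exact: set_valP|].
  exact: tent_bound.
pose phi' (t : I01 R) : set_type A := SigSub (phiA t).
have cphi' : continuous phi'.
  apply/continuousP => _ [W oW <-].
  by move/continuousP: cphi => /(_ _ oW).
have e0 : phi' (I01_zero R) = x.
  apply: val_inj; rewrite /= /phi /= invr0 normr0 /tent Num.Theory.truncn0 !subr0.
  by rewrite min_l ?ler01 // mulr0 scale0r addr0.
have [W oW WE] := hU _ cphi'.
have : W 0.
  have : (phi' @^-1` U) (I01_zero R) by rewrite /= e0.
  by rewrite -WE.
move: oW; rewrite openE => /[apply] /nbhs_ballP[e /= e_gt0 eW].
(* At the inverse of a half-integer the tent equals 1, so that the path is at one of
   the points y n; the half-integer is chosen above e^-1 to make the time smaller than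
   e. *)
pose n := Num.truncn e^-1; pose t : R := (n.+1%:R + 2^-1)^-1.
have nh0 : 0 < n.+1%:R + 2^-1 :> R by rewrite addr_gt0 ?ltr0n ?invr_gt0 //.
have t_gt0 : 0 < t by rewrite invr_gt0.
have t1 : 0 <= t <= 1.
  rewrite (ltW t_gt0) /= invf_le1 // -natr1; have : 0 <= n%:R :> R by [].
  by lra.
have te : t < e.
  rewrite -[ltRHS]invrK ltf_pV2 ?posrE ?invr_gt0 //.
  apply: (lt_trans (Num.Theory.truncnS_gt _)); rewrite -/n ltrDl invr_gt0; lra.
have : (phi' @^-1` U) (SigSub (I01_subproof t1)).
  rewrite -WE; apply: eW; rewrite -ball_normE /= sub0r normrN gtr0_norm //.
suff e1 : phi' (SigSub (I01_subproof t1)) = y n.+1 by rewrite /= e1; have [] := yP n.+1.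
apply: val_inj; rewrite /= /phi /= invrK.
have nE : Num.truncn (n.+1%:R + 2^-1 : R) = n.+1.
  apply: Num.Theory.truncn_def; apply/andP; split; last rewrite -[ltRHS]natr1; lra.
rewrite ger0_norm ?nE; last by rewrite -[X in 0 <= X]invrK invr_ge0 ltW.
rewrite /tent nE [n.+1%:R + _]addrC addrK min_l; last lra.
by rewrite mulfV ?pnatr_eq0 // scale1r /d addrC subrK.
Qed.
End convex_Delta_generated.

(** * The disk is homeomorphic to the simplex *)

Lemma set_type_continuous (S T : topologicalType) (A : set T) (f : S -> T)
    (fA : forall x, f x \in A) :
  continuous f -> continuous (fun x => SigSub (fA x) : set_type A).
Proof. by move=> c; apply/continuousP => _ [V oV <-]; move/continuousP: c => /(_ _ oV). Qed.

Lemma row_continuous (T S : topologicalType) n (f : T -> 'rV[S]_n) :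
  (forall i, continuous (fun x => f x ord0 i)) -> continuous f.
Proof.
move=> h x A [P nP sP]; rewrite /= nbhs_simpl /=.
have : \forall y \near x, forall i, P ord0 i (f y ord0 i).
  by apply: filter_forall => i; apply: h; exact: nP.
by apply: filterS => y hy; apply: sP => i j; rewrite ord1.
Qed.

Section disk_simplex.
Variables (R : realType) (n : nat).
Implicit Types v : 'rV[R]_n.

Definition enorm (v : 'rV[R]_n) : R := Num.sqrt (\sum_i v ord0 i ^+ 2).

Lemma enorm_ge0 v : 0 <= enorm v.
Proof. exact: sqrtr_ge0. Qed.

Lemma enorm_sq v : enorm v ^+ 2 = \sum_i v ord0 i ^+ 2.
Proof. by rewrite sqr_sqrtr // sumr_ge0 // => i _; exact: sqr_ge0. Qed.

Lemma enormZ a v : 0 <= a -> enorm (a *: v) = a * enorm v.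
Proof.
move=> a0; rewrite /enorm; under eq_bigr do rewrite mxE exprMn.
by rewrite -mulr_sumr sqrtrM ?sqr_ge0 // sqrtr_sqr ger0_norm.
Qed.

Lemma enorm_eq0 v : enorm v = 0 -> v = 0.
Proof.
move=> v0; have /eqP := enorm_sq v; rewrite v0 expr0n /= eq_sym psumr_eq0.
  by move=> /allP h; apply/rowP => i; have := h i (mem_index_enum i); rewrite /= sqrf_eq0 mxE => /eqP.
by move=> i _; exact: sqr_ge0.
Qed.

Lemma enorm0 : enorm 0 = 0.
Proof. by rewrite -[0 : 'rV__](scale0r 0) enormZ ?mul0r. Qed.

Lemma enorm_le1 v : (enorm v <= 1) = (\sum_i v ord0 i ^+ 2 <= 1).
Proof. by rewrite -enorm_sq expr_le1 // enorm_ge0. Qed.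

Lemma enorm_eq1 v : \sum_i v ord0 i ^+ 2 = 1 <-> enorm v = 1.
Proof.
by rewrite -enorm_sq; split=> [/eqP|->]; rewrite ?expr1n // sqrp_eq1 ?enorm_ge0 // => /eqP.
Qed.

Lemma enorm_continuous : continuous enorm.
Proof.
apply: (@continuous_compose _ _ _ (fun v : 'rV[R]_n => \sum_i v ord0 i ^+ 2)); last exact: sqrt_continuous.
apply: continuous_big => [|i _]; first exact: add_continuous.
apply: (@continuous_compose _ _ _ (fun v : 'rV[R]_n => v ord0 i) (fun x => x ^+ 2)).
  exact: coord_continuous.
exact: exprn_continuous.
Qed.

(** Coordinates of the simplex directions: the hyperplane of vectors of R^(n+1) with sum
    0 is parametrized by the last n coordinates. *)
Definition lift_sum0 (v : 'rV[R]_n) (i : 'I_n.+1) : R :=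
  if unlift ord0 i is Some j then v ord0 j else - \sum_j v ord0 j.

Lemma lift_sum0_lift v j : lift_sum0 v (lift ord0 j) = v ord0 j.
Proof. by rewrite /lift_sum0 liftK. Qed.

Lemma lift_sum0_sum v : \sum_i lift_sum0 v i = 0.
Proof.
rewrite big_ord_recl (eq_bigr _ (fun j _ => lift_sum0_lift v j)).
by rewrite /lift_sum0 unlift_none addNr.
Qed.

Lemma lift_sum0K (w : 'I_n.+1 -> R) : \sum_i w i = 0 ->
  lift_sum0 (\row_j w (lift ord0 j)) =1 w.
Proof.
rewrite big_ord_recl => /eqP; rewrite addr_eq0 => /eqP h i; rewrite /lift_sum0.
case: unliftP => [j ->|->]; first by rewrite mxE.
by rewrite h; congr (- _); apply: eq_bigr => j _; rewrite mxE.
Qed.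

Lemma lift_sum0Z a v i : lift_sum0 (a *: v) i = a * lift_sum0 v i.
Proof.
rewrite /lift_sum0; case: unlift => [j|]; first by rewrite mxE.
by rewrite mulrN mulr_sumr; under eq_bigr do rewrite mxE.
Qed.

Lemma lift_sum0_continuous i : continuous (lift_sum0^~ i).
Proof.
rewrite /lift_sum0; case: unlift => [j|]; first exact: coord_continuous.
move=> v; apply: continuousN; apply: continuous_big => [|j _]; first exact: add_continuous.
exact: coord_continuous.
Qed.

(** The gauge of the simplex centred at its barycentre, up to the factor n + 1. *)
Definition gauge v : R := \big[Num.max/0]_i - lift_sum0 v i.

Lemma gauge_ge0 v : 0 <= gauge v.
Proof. exact: bigmax_ge_id. Qed.

Lemma gauge_ge v i : - lift_sum0 v i <= gauge v.
Proof. exact: le_bigmax. Qed.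

Lemma gauge_attained v : exists i, gauge v = - lift_sum0 v i.
Proof.
apply: contrapT => /forallNP h.
have {}h i : - lift_sum0 v i < gauge v.
  by rewrite lt_neqAle gauge_ge andbT; apply/eqP => e; exact: (h i).
have := gauge_ge0 v; rewrite le_eqVlt => /orP[/eqP g0|g0]; last first.
  have : gauge v < gauge v by apply: bigmax_lt.
  by rewrite ltxx.
have : 0 < \sum_i lift_sum0 v i.
  have {}h i : 0 < lift_sum0 v i by have := h i; rewrite -g0 oppr_lt0.
  by rewrite big_ord_recl ltr_wpDr ?sumr_ge0 // => i _; exact: ltW.
by rewrite lift_sum0_sum ltxx.
Qed.

Lemma gaugeZ a v : 0 <= a -> gauge (a *: v) = a * gauge v.
Proof.
move=> a0; have [i iE] := gauge_attained v; have [j jE] := gauge_attained (a *: v).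
apply/le_anti/andP; split.
  rewrite jE lift_sum0Z -mulrN; apply: ler_wpM2l => //; exact: gauge_ge.
by rewrite iE mulrN -lift_sum0Z gauge_ge.
Qed.

(** The gauge bounds the negative coordinates by definition, and the positive ones
    because the sum is 0. *)
Lemma lift_sum0_le v i : `|lift_sum0 v i| <= n.+1%:R * gauge v.
Proof.
have g0 := gauge_ge0 v; rewrite ler_norml; apply/andP; split.
  rewrite lerNl; apply: (le_trans (gauge_ge v i)).
  by rewrite ler_peMl // ler1n.
have := lift_sum0_sum v; rewrite (bigD1 i) //= => /eqP; rewrite addr_eq0 => /eqP ->.
rewrite -sumrN; apply: (@le_trans _ _ (\sum_(j | j != i) gauge v)).
  by apply: ler_sum => j _; exact: gauge_ge.
rewrite sumr_const -[leLHS]mulr_natl; apply: ler_wpM2r => //.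
by rewrite ler_nat -[leqRHS]card_ord max_card.
Qed.

Lemma gauge_eq0 v : gauge v = 0 -> v = 0.
Proof.
move=> g0; apply/rowP => j; rewrite mxE.
by have := lift_sum0_le v (lift ord0 j); rewrite g0 mulr0 normr_le0 lift_sum0_lift => /eqP.
Qed.

Lemma gauge_continuous : continuous gauge.
Proof.
apply: continuous_big => [|i _]; first exact: max_continuous.
move=> v; apply: continuousN; exact: lift_sum0_continuous.
Qed.

(** The radial map that sends the sphere of radius r to the boundary of the simplex
    shrunk by r towards its barycentre; at v = 0 the division by 0 does no harm, since
    the last factor vanishes. *)
Definition radial v (i : 'I_n.+1) : R :=
  n.+1%:R^-1 * (1 + enorm v / gauge v * lift_sum0 v i).

Lemma radial_ge v i : (1 - enorm v) / n.+1%:R <= radial v i.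
Proof.
rewrite mulrC; apply: ler_wpM2l; first by rewrite invr_ge0.
rewrite lerD2l lerNl -mulrN -mulrA -[leRHS]mulr1; apply: ler_wpM2l; first exact: enorm_ge0.
have := gauge_ge0 v; rewrite le_eqVlt => /orP[/eqP g0|g0].
  by rewrite -g0 invr0 mul0r.
by rewrite mulrC ler_pdivrMr // mul1r gauge_ge.
Qed.

Lemma radial_attained v : exists i, radial v i = (1 - enorm v) / n.+1%:R.
Proof.
have [i iE] := gauge_attained v; exists i; rewrite /radial [RHS]mulrC; congr (_ * (_ + _)).
have [g0|g0] := eqVneq (gauge v) 0.
  by rewrite g0 invr0 mulr0 mul0r (gauge_eq0 g0) enorm0 oppr0.
by rewrite -[lift_sum0 v i]opprK -iE mulrN mulfVK.
Qed.

Lemma radial_sum v : \sum_i radial v i = 1.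
Proof.
rewrite -mulr_sumr big_split /= -mulr_sumr lift_sum0_sum mulr0 addr0.
by rewrite sumr_const card_ord -[1 *+ _]/(_%:R) mulVf // pnatr_eq0.
Qed.

(** Away from 0 this is a composition of continuous maps; at 0 the factor enorm tends to
    0 and the remaining quotient is bounded by n + 1. *)
Lemma radial_continuous i : continuous (radial^~ i).
Proof.
suff h (v : 'rV[R]_n) : {for v, continuous (radial^~ i)} by move=> v; exact: h.
rewrite /radial.
apply: (@continuousM R 'rV[R]_n (fun=> _) (fun v => 1 + enorm v / gauge v * lift_sum0 v i) v).
  exact: cst_continuous.
apply: (@continuousD R R 'rV[R]_n (fun=> 1) (fun v => enorm v / gauge v * lift_sum0 v i) v).
  exact: cst_continuous.
have [v0|v0] := pselect (v = 0); last first.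
  apply: (@continuousM R 'rV[R]_n (fun v => enorm v / gauge v) (lift_sum0^~ i) v);
    last exact: lift_sum0_continuous.
  apply: (@continuousM R 'rV[R]_n enorm (fun v => (gauge v)^-1) v).
    exact: enorm_continuous.
  apply: (@continuousV R 'rV[R]_n gauge v); last exact: gauge_continuous.
  by apply/eqP => /gauge_eq0.
rewrite v0 /prop_for /continuous_at enorm0 !mul0r.
have c0 : (fun v => n.+1%:R * enorm v) @ nbhs (0 : 'rV[R]_n) --> (0 : R).
  have /= h := @continuousM R 'rV[R]_n (fun=> n.+1%:R) enorm 0 _ (@enorm_continuous 0).
  by rewrite -[X in _ --> X](mulr0 n.+1%:R) -enorm0; refine (h _); exact: cst_continuous.
apply: (@squeeze_cvgr _ (nbhs (0 : 'rV[R]_n)) _ R (fun v => - (n.+1%:R * enorm v)) (fun v => n.+1%:R * enorm v)).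
- near=> u; rewrite -ler_norml mulrAC normrM normfV (ger0_norm (gauge_ge0 _)) normrM.
  rewrite (ger0_norm (enorm_ge0 _)) -mulrA mulrC; apply: ler_wpM2r; first exact: enorm_ge0.
  have := gauge_ge0 u; rewrite le_eqVlt => /orP[/eqP g0|g0].
    by rewrite -g0 invr0 mulr0.
  by rewrite ler_pdivrMr // lift_sum0_le.
- by rewrite -[X in _ --> X]oppr0; exact: cvgN.
- exact: c0.
Unshelve. all: by end_near.
Qed.

(** The least coordinate of the image determines the norm, and the direction of the
    image determines the direction. *)
Lemma radial_inj u v : radial u =1 radial v -> u = v.
Proof.
move=> h.
have nE : enorm u = enorm v.
  have [i iE] := radial_attained u; have [j jE] := radial_attained v.
  have n0 : 0 < n.+1%:R^-1 :> R by rewrite invr_gt0 ltr0n.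
  have := radial_ge u j; rewrite h jE ler_pM2r // => h1.
  have := radial_ge v i; rewrite -h iE ler_pM2r // => h2.
  by apply/le_anti; lra.
have [u0|u0] := eqVneq (enorm u) 0.
  by rewrite (enorm_eq0 u0); rewrite u0 in nE; rewrite (enorm_eq0 (esym nE)).
have uv : u = (gauge u / gauge v) *: v.
  apply/rowP => j; rewrite mxE -!lift_sum0_lift.
  have := h (lift ord0 j); rewrite /radial -nE => /mulfI.
  rewrite invr_eq0 pnatr_eq0 => /(_ isT) /addrI; rewrite -!mulrA => /(mulfI u0) e.
  rewrite -e mulrA divff ?mul1r //.
  by apply: contra_neq u0 => /gauge_eq0 ->; exact: enorm0.
have : enorm u = (gauge u / gauge v) * enorm v.
  by rewrite {1}uv enormZ // divr_ge0 // gauge_ge0.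
rewrite -nE -[LHS]mul1r => /(mulIf u0) e.
by rewrite uv -e scale1r.
Qed.

(** The preimage is the direction t - barycentre rescaled to the norm (n + 1) gauge,
    which is the factor by which the simplex has to be shrunk for t to lie on its
    boundary. *)
Lemma radial_surj (t : 'I_n.+1 -> R) : (forall i, 0 <= t i) -> \sum_i t i = 1 ->
  exists2 v, enorm v <= 1 & radial v =1 t.
Proof.
move=> t0 t1; pose w i := t i - n.+1%:R^-1.
have n0 : n.+1%:R != 0 :> R by rewrite pnatr_eq0.
have w0 : \sum_i w i = 0.
  by rewrite sumrB t1 sumr_const card_ord -[n.+1%:R^-1 *+ _]mulr_natl mulfV // subrr.
pose u : 'rV[R]_n := \row_j w (lift ord0 j); have uE := lift_sum0K w0.
pose r := n.+1%:R * gauge u.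
have r1 : r <= 1.
  have [i iE] := gauge_attained u; rewrite /r iE uE /w opprB mulrBr mulfV //.
  by rewrite lerBlDr lerDl mulr_ge0.
have r0 : 0 <= r by rewrite mulr_ge0 // gauge_ge0.
have [u0|u0] := eqVneq (enorm u) 0.
  exists 0; first by rewrite enorm0.
  move=> i; rewrite /radial enorm0 !mul0r addr0 mulr1.
  have := uE i; rewrite -/u (enorm_eq0 u0) -(scale0r 0) lift_sum0Z mul0r /w.
  by move/esym/eqP; rewrite subr_eq0 => /eqP.
have g0 : gauge u != 0 by apply: contra_neq u0 => /gauge_eq0 ->; exact: enorm0.
have ge0 := enorm_ge0 u.
exists ((r / enorm u) *: u).
  by rewrite enormZ ?divr_ge0 // mulfVK.
move=> i; rewrite /radial enormZ ?divr_ge0 // gaugeZ ?divr_ge0 // lift_sum0Z uE.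
rewrite mulfVK //.
have -> : t i = w i + n.+1%:R^-1 by rewrite /w subrK.
have rn0 : r != 0 by rewrite mulf_neq0.
rewrite mulrDr mulr1 addrC; congr (_ + _).
rewrite /r in rn0 *.
by field; rewrite g0 u0 addrC natr1 n0.
Qed.

Lemma disk_compact : compact [set: disk R n].
Proof.
apply: set_type_compact.
apply: (@subclosed_compact _ _
  [set v : 'rV[R]_n | forall i, `[-1, 1]%classic (v ord0 i)]).
- have -> : @disk_set R n = enorm @^-1` [set x | x <= 1].
    by apply/seteqP; split=> v /=; rewrite enorm_le1.
  by apply: preimage_closed; [move=> v _; exact: enorm_continuous|exact: closed_le].
- exact: (@rV_compact R n (fun=> `[-1, 1]%classic) (fun=> @segment_compact R (-1) 1)).
move=> v; rewrite /disk_set /= => v1 i; rewrite in_itv /= -ler_norml.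
rewrite -(@expr_le1 _ 2) // real_normK ?num_real //; apply: le_trans v1.
by rewrite (bigD1 i) //= lerDl; apply: sumr_ge0 => j _; exact: sqr_ge0.
Qed.

Lemma radial_subproof (v : disk R n) : (\row_i radial (set_val v) i) \in std_simplex R n.
Proof.
have v1 : enorm (set_val v) <= 1 by rewrite enorm_le1; exact: (set_valP v).
apply/mem_set; split=> [i|]; last by under eq_bigr do rewrite mxE; exact: radial_sum.
rewrite mxE; apply: le_trans (radial_ge _ i).
by rewrite divr_ge0 // subr_ge0.
Qed.

Lemma simplex_hausdorff : hausdorff_space (simplex R n).
Proof.
apply: (@real_separated R) => x y h; apply/val_inj/rowP => i.
apply: (h (fun z => set_val z ord0 i)).
apply: (@continuous_compose _ _ _ (set_val : simplex R n -> 'rV[R]_n.+1)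
  (fun v : 'rV[R]_n.+1 => v ord0 i)); first exact: initial_continuous.
exact: coord_continuous.
Qed.

(** The inverse is continuous because the disk is compact and the simplex is Hausdorff. *)
Lemma disk_simplex_homeomorphism :
  exists (f : disk R n -> simplex R n) (g : simplex R n -> disk R n),
    [/\ continuous f, continuous g, cancel f g, cancel g f &
      forall u : disk R n, disk_boundary u <-> exists i, set_val (f u) ord0 i = 0].
Proof.
pose f (v : disk R n) : simplex R n := SigSub (radial_subproof v).
have fE (v : disk R n) i : set_val (f v) ord0 i = radial (set_val v) i by rewrite [LHS]mxE.
have cf : continuous f.
  apply: (@set_type_continuous (disk R n) 'rV[R]_n.+1); apply: row_continuous => i.
  under eq_fun do rewrite mxE.
  apply: (@continuous_compose _ _ _ (set_val : disk R n -> 'rV[R]_n) (radial^~ i)).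
    exact: initial_continuous.
  exact: radial_continuous.
have finj : injective f.
  move=> u v uv; apply: val_inj; apply: radial_inj => i.
  by rewrite -!fE uv.
have fsurj t : exists v : disk R n, f v = t.
  have [t0 t1] := set_valP t; have [v v1 vE] := radial_surj t0 t1.
  have vD : v \in @disk_set R n by apply/mem_set; rewrite /disk_set /= -enorm_le1.
  by exists (SigSub vD); apply/val_inj/rowP => i; rewrite /= mxE vE.
pose g t := sval (cid (fsurj t)).
have gK : cancel g f by move=> t; rewrite /g; case: cid.
have fK : cancel f g by move=> v; apply: finj; rewrite gK.
exists f, g; split => //.
  apply/continuous_closedP => K cK.
  have -> : g @^-1` K = f @` K.
    apply/seteqP; split=> [t /= Kt|_ [v Kv <-]]; first by exists (g t).
    by rewrite /= fK.
  apply: compact_closed; first exact: simplex_hausdorff.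
  apply: continuous_compact; first exact: continuous_subspaceT.
  exact: (subclosed_compact cK disk_compact).
move=> v; rewrite /disk_boundary /= /sphere_set /=; rewrite enorm_eq1; split => [v1|[i]].
  by have [i iE] := radial_attained (set_val v); exists i; rewrite fE iE v1 subrr mul0r.
rewrite fE => i0; apply/le_anti/andP; split.
  by rewrite enorm_le1; exact: (set_valP v).
have := radial_ge (set_val v) i; rewrite i0 pmulr_lle0 ?invr_gt0 ?ltr0n //.
by rewrite subr_le0.
Qed.

End disk_simplex.

(** * Continuity of maps defined through the simplices of a nerve *)

Lemma simplex_Delta_generated (R : realType) n : Delta_generated R (simplex R n).
Proof.
apply: (@convex_Delta_generated R 'rV[R]_n.+1) => x y t [x0 x1] [y0 y1] /andP[t0 t1].
split=> [i|]; rewrite ?mxE.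
  rewrite mulrBr addrCA -[X in X - _]mul1r -mulrBl.
  by rewrite addr_ge0 // mulr_ge0 // subr_ge0.
under eq_bigr do rewrite !mxE.
by rewrite big_split /= x1 -mulr_sumr sumrB x1 y1 subrr mulr0 addr0.
Qed.

Lemma simplex_interior (R : realType) n : exists t : simplex R n, forall i, 0 < set_val t ord0 i.
Proof.
have tP : (\row_i (n.+1%:R^-1)) \in std_simplex R n.
  apply/mem_set; split=> [i|]; first by rewrite mxE invr_ge0.
  by under eq_bigr do rewrite mxE; rewrite sumr_const card_ord -[_ *+ _]mulr_natl mulfV // pnatr_eq0.
by exists (SigSub tP) => i; rewrite set_valE /= mxE invr_gt0 ltr0n.
Qed.

(** This is the universal property of the Delta-generated coreflection; it turns
    continuity into a space into continuity into an object of Top. *)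
Lemma Delta_generated_continuous (R : realType) (S T : topologicalType) (f : S -> T) :
  Delta_generated R S -> continuous f -> continuous (f : S -> Delta R T).
Proof.
move=> dS cf; apply/continuousP => U; rewrite open_DeltaE => oU.
by apply: dS => phi cphi; exact: (oU _ (continuous_compose cphi cf)).
Qed.

Lemma realization_Delta_continuous (R : realType) (K : sset) :
  continuous (id : realization R K -> Delta R (realization R K)).
Proof.
apply: rcontinuous => n x; apply: Delta_generated_continuous.
  exact: simplex_Delta_generated.
exact: rpoint_continuous.
Qed.

Lemma hausdorff_pair (X Y : topologicalType) :
  hausdorff_space X -> hausdorff_space Y -> hausdorff_space (X * Y)%type.
Proof.
move=> hX hY [x y] [x' y'] h; congr pair.
  apply: hX => A B nA nB.
  have nA' : nbhs (x, y) (fst @^-1` A) by exact: (cvg_fst nA).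
  have nB' : nbhs (x', y') (fst @^-1` B) by exact: (cvg_fst nB).
  by have [[z w] [/= Az Bz]] := h _ _ nA' nB'; exists z.
apply: hY => A B nA nB.
have nA' : nbhs (x, y) (snd @^-1` A) by exact: (cvg_snd nA).
have nB' : nbhs (x', y') (snd @^-1` B) by exact: (cvg_snd nB).
by have [[z w] [/= Az Bz]] := h _ _ nA' nB'; exists w.
Qed.

Lemma continuous_glue (X T : topologicalType) (A B : set X) (f1 f2 f : X -> T) :
  closed A -> closed B -> A `|` B = setT -> continuous f1 -> continuous f2 ->
  (forall x, A x -> f x = f1 x) -> (forall x, B x -> f x = f2 x) -> continuous f.
Proof.
move=> cA cB AB c1 c2 e1 e2; apply/continuous_closedP => K cK.
have -> : f @^-1` K = (A `&` f1 @^-1` K) `|` (B `&` f2 @^-1` K).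
  apply/seteqP; split=> x /=; last by case=> -[h]; rewrite ?(e1 x h) ?(e2 x h).
  have : (A `|` B) x by rewrite AB.
  by move=> [h|h] Kx; [left; rewrite /= -e1|right; rewrite /= -e2].
apply: closedU; apply: closedI => //.
  by move/continuous_closedP: c1; apply.
by move/continuous_closedP: c2; apply.
Qed.

(** A compact X meets only finitely many open simplices, so that f is continuous as soon
    as it is on the closed preimage of each closed simplex s.  Since the closed simplex
    is compact and the nerve Hausdorff, it is enough that f factors there through a
    continuous function of the coordinates; the extra dependence of g on x serves for
    homotopies. *)
Lemma continuous_on_simplices (R : realType) d (C : porderType d) (X T : topologicalType)
    (phi : X -> realization R (nerve C)) (f : X -> T) :
  compact [set: X] -> hausdorff_space X -> continuous phi ->
  (forall n (s : mono 'I_n.+1 C), injective s ->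
     (exists x (t : simplex R n),
        (forall i, 0 < set_val t ord0 i) /\ phi x = rpoint (K := nerve C) s t) ->
     exists g : simplex R n * X -> T, continuous g /\
       forall t x, phi x = rpoint (K := nerve C) s t -> f x = g (t, x)) ->
  continuous f.
Proof.
move=> cX hX cphi hg; have /finite_seqP[F FE] := compact_support cX cphi.
apply/continuous_closedP => K cK.
(* The relevant simplices, listed by their vertices, which all belong to the finite
   list F. *)
pose J := {m : 'I_(size F) & {ffun 'I_m.+1 -> 'I_(size F)}}.
pose P (j : J) (r : mono 'I_(tag j).+1 C) := [/\ injective r,
   forall i, r i = tnth (in_tuple F) (tagged j i) &
   exists x (t : simplex R (tag j)),
     (forall i, 0 < set_val t ord0 i) /\ phi x = rpoint (K := nerve C) r t].
pose E (j : J) := [set x | exists2 r : mono 'I_(tag j).+1 C, P j r &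
  exists2 t, phi x = rpoint (K := nerve C) r t & K (f x)].
suff -> : f @^-1` K = \bigcup_(j in setT) E j.
  apply: closed_bigcup => [|j _]; first exact: finite_finset.
  have [[r Pr]|nr] := pselect (exists r, P j r); last first.
    rewrite (_ : E j = set0); first exact: closed0.
    by apply/seteqP; split => // x [r Pr]; case: nr; exists r.
  have [rI rE rhit] := Pr; have [g [cg gE]] := hg _ r rI rhit.
  (* E j is the preimage, under x |-> (phi x, x), of the image of a compact set. *)
  pose q (tx : simplex R (tag j) * X) : realization R (nerve C) * X :=
    (rpoint (K := nerve C) r tx.1, tx.2).
  have cq : continuous q.
    apply: continuous_pair; last by move=> ?; exact: cvg_snd.
    apply: (@continuous_compose _ _ _ fst (rpoint (K := nerve C) r)).
      by move=> ?; exact: cvg_fst.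
    exact: rpoint_continuous.
  have -> : E j = (fun x => (phi x, x)) @^-1` (q @` (g @^-1` K)).
    apply/seteqP; split => x /=.
      move=> [r' [_ r'E _] [t h Kf]].
      have e : r' = r by apply: mono_eq => i; rewrite r'E rE.
      by rewrite e in h; exists (t, x); rewrite /= -?gE // /q /= h.
    move=> [[t x'] Kg [h1 h2]]; rewrite -h2; exists r => //; exists t => //.
      by rewrite h1 h2.
    by rewrite (gE t) // h1 h2.
  apply: preimage_closed; last first.
    apply: compact_closed.
      by apply: hausdorff_pair => //; exact: nerve_hausdorff.
    apply: continuous_compact; first exact: continuous_subspaceT.
    apply: (@subclosed_compact _ _ [set: _]) => //.
      by apply: preimage_closed => // z _; exact: cg.
    rewrite -setXTT; apply: compact_setX => //; exact: simplex_compact.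
  by move=> x _; apply: continuous_pair => // ?; exact: cvg_id.
apply/seteqP; split => x /=; last by move=> [j _ [r _ [t _]]].
move=> Kx; have [n [r [t [zE rI t0]]]] := rpoint_nf (phi x).
have rF i : r i \in F.
  have : [set c | exists x, 0 < bary (phi x) c] (r i) by exists x; rewrite zE; exact: bary_gt0.
  by rewrite FE.
have nF : (n < size F)%N.
  rewrite -[n.+1]card_ord -(size_codom r); apply: uniq_leq_size.
    by rewrite codomE map_inj_uniq ?enum_uniq.
  by move=> _ /codomP[i ->].
have iF i : (index (r i) F < size F)%N by rewrite index_mem.
exists (existT _ (Ordinal nF) [ffun i => Ordinal (iF i)]) => //.
exists r; last by exists t.
split => //; last by exists x, t.
by move=> i; rewrite ffunE (tnth_nth (r i)) /= nth_index.
Qed.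

Section contraction.
Context {R : realType} {d : Order.disp_t} {C : porderType d}.
Variables (m : C) (m_min : forall c, (m <= c)%O).

(** The join of the minimum m with a simplex s; s may already start with m, which makes
    the cone degenerate. *)
Definition cone_fun n (s : 'I_n.+1 -> C) (i : 'I_n.+2) : C :=
  if unlift ord0 i is Some j then s j else m.

Lemma cone_fun_mono n (s : mono 'I_n.+1 C) : {homo cone_fun s : i j / (i <= j)%O}.
Proof.
move=> i j; rewrite /cone_fun; case: unliftP => [i' ->|-> //].
case: unliftP => [j' -> h|->]; last by [].
by apply: monoP; move: h; rewrite !leEord /= /bump !leq0n !add1n ltnS.
Qed.

Definition cone n (s : mono 'I_n.+1 C) : mono 'I_n.+2 C := Mono (cone_fun_mono s).

Definition cone_weight n (u : I01 R) (t : simplex R n) (i : 'I_n.+2) : R :=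
  if unlift ord0 i is Some j then (1 - set_val u) * set_val t ord0 j else set_val u.

Lemma I01P (u : I01 R) : 0 <= set_val u <= 1.
Proof. by have := set_valP u; rewrite /= in_itv. Qed.

Lemma cone_weight_sum n u (t : simplex R n) (al : C -> R) (s : 'I_n.+1 -> C) :
  \sum_i cone_weight u t i * al (cone_fun s i) =
  set_val u * al m + (1 - set_val u) * \sum_i set_val t ord0 i * al (s i).
Proof.
rewrite big_ord_recl /cone_weight /cone_fun !unlift_none; congr (_ + _).
by rewrite mulr_sumr; apply: eq_bigr => i _; rewrite !liftK mulrA.
Qed.

Lemma cone_point_subproof n (u : I01 R) (t : simplex R n) :
  (\row_i cone_weight u t i) \in std_simplex R n.+1.
Proof.
have /andP[u0 u1] := I01P u; have [t0 t1] := set_valP t.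
apply/mem_set; split=> [i|].
  rewrite mxE /cone_weight; case: unlift => [j|//].
  by rewrite mulr_ge0 ?subr_ge0 //; exact: t0.
have := cone_weight_sum u t (fun=> 1) (fun=> m); rewrite mulr1.
under eq_bigr do rewrite mulr1; under [X in _ + _ * X]eq_bigr do rewrite mulr1.
rewrite t1 mulr1 addrC subrK => <-; apply: eq_bigr => i _; by rewrite mxE.
Qed.

Definition cone_point n (u : I01 R) (t : simplex R n) : simplex R n.+1 :=
  SigSub (cone_point_subproof u t).

(** In barycentric coordinates the contraction is the straight line from z to the vertex
    m. *)
Lemma contract_subproof (u : I01 R) (z : realization R (nerve C)) :
  exists z' : realization R (nerve C), forall al,
    rexpect al z' = set_val u * al m + (1 - set_val u) * rexpect al z.
Proof.
have [n [s [t ->]]] := rpointP z.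
exists (rpoint (K := nerve C) (cone s) (cone_point u t)) => al.
rewrite !rexpectE -cone_weight_sum; apply: eq_bigr => i _.
by rewrite set_valE /= mxE.
Qed.

Definition contract u z := sval (cid (contract_subproof u z)).

Lemma contractE u z al :
  rexpect al (contract u z) = set_val u * al m + (1 - set_val u) * rexpect al z.
Proof. by rewrite /contract; case: cid. Qed.

Lemma contract_rpoint u n (s : mono 'I_n.+1 C) t :
  contract u (rpoint (K := nerve C) s t) = rpoint (K := nerve C) (cone s) (cone_point u t).
Proof.
apply: bary_inj => c; rewrite /bary contractE !rexpectE -(cone_weight_sum _ _ (fun x => (x == c)%:R)).
by apply: eq_bigr => i _; rewrite [set_val (cone_point _ _)]/= mxE.
Qed.

Lemma contract0 z : contract (I01_zero R) z = z.
Proof. by apply: bary_inj => c; rewrite /bary contractE mul0r add0r subr0 mul1r. Qed.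

Lemma contract1 z z' : contract (I01_one R) z = contract (I01_one R) z'.
Proof. by apply: bary_inj => c; rewrite /bary !contractE subrr !mul0r. Qed.

Lemma contract_continuous (X : topologicalType) (phi : X -> realization R (nerve C))
    (u : X -> I01 R) : compact [set: X] -> hausdorff_space X ->
  continuous phi -> continuous u -> continuous (fun x => contract (u x) (phi x)).
Proof.
move=> cX hX cphi cu; apply: (continuous_on_simplices cX hX cphi) => n s _ _.
exists (fun tx => rpoint (K := nerve C) (cone s) (cone_point (u tx.2) tx.1)).
split; last by move=> t x ->; rewrite contract_rpoint.
apply: (@continuous_compose _ _ _ (fun tx => cone_point (u tx.2) tx.1)
  (rpoint (K := nerve C) (cone s))); last exact: rpoint_continuous.
apply: (@set_type_continuous (simplex R n * X)%type 'rV[R]_n.+2).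
apply: row_continuous => i.
have cu' : continuous (fun tx : simplex R n * X => set_val (u tx.2) : R).
  apply: (@continuous_compose _ _ _ (fun tx => u tx.2) (set_val : I01 R -> R)).
    by apply: continuous_compose cu => ?; exact: cvg_snd.
  exact: initial_continuous.
under eq_fun do rewrite mxE; rewrite /cone_weight; case: unlift => [j|//].
move=> tx; apply: (@continuousM R (simplex R n * X)%type
   (fun tx => 1 - set_val (u tx.2)) (fun tx => set_val tx.1 ord0 j) tx).
  apply: (@continuousB R R (simplex R n * X)%type (fun=> 1) (fun tx => set_val (u tx.2)) tx).
    exact: cst_continuous.
  exact: cu'.
apply: (@continuous_compose (simplex R n * X)%type _ _ fst (fun t => set_val t ord0 j)).
  by move=> ?; exact: cvg_fst.
apply: (@continuous_compose _ _ _ (set_val : simplex R n -> 'rV[R]_n.+1)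
  (fun v : 'rV[R]_n.+1 => v ord0 j)); first exact: initial_continuous.
exact: coord_continuous.
Qed.

End contraction.

(** * The augmentation *)

Section null_homotopy.
Context {R : realType} {d : Order.disp_t} {C : porderType d}.
Variables (m : C) (m_min : forall c, (m <= c)%O) (n : nat).
Notation NC := (realization R (nerve C)).
Notation D := (disk R n).
Notation cyl := (disk R n * I01 R)%type.

Let nrm (p : cyl) : R := enorm (set_val p.1).
Let ht (p : cyl) : R := set_val p.2.

Let nrm_continuous : continuous nrm.
Proof.
apply: (@continuous_compose cyl D _ fst (fun v => enorm (set_val v))); first by move=> ?; exact: cvg_fst.
apply: (@continuous_compose D 'rV[R]_n _ set_val (@enorm R n)); first exact: initial_continuous.
exact: enorm_continuous.
Qed.

Let ht_continuous : continuous ht.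
Proof.
apply: (@continuous_compose cyl (I01 R) _ snd set_val); first by move=> ?; exact: cvg_snd.
exact: initial_continuous.
Qed.

Let scaled_norm p := (1 + ht p) * nrm p.

Let scaled_continuous : continuous scaled_norm.
Proof.
move=> p; apply: (@continuousM R cyl (fun p => 1 + ht p) nrm p); last exact: nrm_continuous.
apply: (@continuousD R R cyl (fun=> 1) ht p); first exact: cst_continuous.
exact: ht_continuous.
Qed.

Let ht_ge0 p : 0 <= ht p. Proof. by have /andP[] := I01P p.2. Qed.
Let ht_le1 p : ht p <= 1. Proof. by have /andP[] := I01P p.2. Qed.
Let nrm_le1 p : nrm p <= 1.
Proof. by rewrite enorm_le1; exact: (set_valP p.1). Qed.
Let nrm_ge0 p : 0 <= nrm p. Proof. exact: enorm_ge0. Qed.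

(** At height h the disk is stretched by the factor 1 + h and what would leave it is
    pushed back to the boundary. *)
Definition stretch_fun (p : cyl) : 'rV[R]_n :=
  ((1 + ht p) / Num.max 1 (scaled_norm p)) *: set_val p.1.

Let max_gt0 p : 0 < Num.max 1 (scaled_norm p).
Proof. by rewrite lt_max ltr01. Qed.

Lemma enorm_stretch p : enorm (stretch_fun p) = scaled_norm p / Num.max 1 (scaled_norm p).
Proof.
rewrite enormZ; first by rewrite mulrAC.
by rewrite divr_ge0 ?addr_ge0 // ltW.
Qed.

Lemma stretch_subproof p : stretch_fun p \in @disk_set R n.
Proof.
apply/mem_set; rewrite /disk_set /= -enorm_le1 enorm_stretch ler_pdivrMr // mul1r.
by rewrite le_max lexx orbT.
Qed.

Definition stretch (p : cyl) : D := SigSub (stretch_subproof p).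

Lemma stretch_continuous : continuous stretch.
Proof.
apply: (@set_type_continuous cyl 'rV[R]_n); apply: row_continuous => i.
under eq_fun do rewrite mxE.
move=> p; apply: (@continuousM R cyl (fun p => (1 + ht p) / Num.max 1 (scaled_norm p))
  (fun p => set_val p.1 ord0 i) p); last first.
  apply: (@continuous_compose cyl D _ fst (fun v => set_val v ord0 i)).
    by move=> ?; exact: cvg_fst.
  apply: (@continuous_compose D 'rV[R]_n _ set_val (fun v => v ord0 i)).
    exact: initial_continuous.
  exact: coord_continuous.
apply: (@continuousM R cyl (fun p => 1 + ht p) (fun p => (Num.max 1 (scaled_norm p))^-1) p).
  apply: (@continuousD R R cyl (fun=> 1) ht p); first exact: cst_continuous.
  exact: ht_continuous.
apply: (@continuousV R cyl (fun p => Num.max 1 (scaled_norm p)) p).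
  by rewrite gt_eqF.
apply: (@continuous_compose cyl (R * R)%type _ (fun p => (1, scaled_norm p)) (fun z => Num.max z.1 z.2)).
  by apply: continuous_pair => // ?; exact: cvg_cst.
exact: max_continuous.
Qed.

(** How far to contract: at height h fully to depth h on the part of the disk that is
    stretched over the whole disk, and decreasingly towards the boundary, so that the
    boundary is never moved. *)
Definition depth_fun (p : cyl) : R := Num.min (ht p) ((1 - nrm p) * (1 + ht p)).

Lemma depth_subproof p : depth_fun p \in (`[0, 1]%classic : set R).
Proof.
apply: I01_subproof; rewrite /depth_fun le_min ge_min ht_le1 ht_ge0 /= andbT.
by rewrite mulr_ge0 ?subr_ge0 // addr_ge0.
Qed.

Definition depth (p : cyl) : I01 R := SigSub (depth_subproof p).

Lemma depth_continuous : continuous depth.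
Proof.
apply: (@set_type_continuous cyl R).
apply: (@continuous_compose cyl (R * R)%type _ (fun p => (ht p, (1 - nrm p) * (1 + ht p))) (fun z => Num.min z.1 z.2)); last exact: min_continuous.
apply: continuous_pair => // p.
apply: (@continuousM R cyl (fun p => 1 - nrm p) (fun p => 1 + ht p) p).
  apply: (@continuousB R R cyl (fun=> 1) nrm p); first exact: cst_continuous.
  exact: nrm_continuous.
apply: (@continuousD R R cyl (fun=> 1) ht p); first exact: cst_continuous.
exact: ht_continuous.
Qed.

Lemma cyl_compact : compact [set: cyl].
Proof. rewrite -setXTT; apply: compact_setX; [exact: disk_compact|exact: I01_compact]. Qed.

Lemma cyl_hausdorff : hausdorff_space cyl.
Proof.
apply: hausdorff_pair; first exact: set_type_rV_hausdorff.
apply: (@real_separated R) => x y h; apply: val_inj.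
by apply: (h set_val); exact: initial_continuous.
Qed.

Definition squeeze (a : D -> NC) (p : cyl) : NC := contract m_min (depth p) (a (stretch p)).

Lemma squeeze_continuous a : continuous a -> continuous (squeeze a).
Proof.
move=> ca; have := contract_continuous (m_min := m_min) cyl_compact cyl_hausdorff
  (continuous_compose stretch_continuous ca) depth_continuous.
exact.
Qed.

Lemma squeeze0 a v : squeeze a (v, I01_zero R) = a v.
Proof.
have h0 : ht (v, I01_zero R) = 0 by [].
rewrite /squeeze (_ : depth _ = I01_zero R) ?contract0; last first.
  apply: val_inj; rewrite /= /depth_fun h0 min_l // addr0 mulr1 subr_ge0.
  exact: nrm_le1.
congr a; apply: val_inj; rewrite /= /stretch_fun /scaled_norm h0 addr0 !mul1r max_l.
  by rewrite invr1 scale1r.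
exact: nrm_le1.
Qed.

Lemma squeeze_boundary a x v u : spheroid x a -> disk_boundary v -> squeeze a (v, u) = x.
Proof.
move=> [_ ax] vb; have v1 : nrm (v, u) = 1 by apply/enorm_eq1.
rewrite /squeeze (_ : depth _ = I01_zero R) ?contract0; last first.
  by apply: val_inj; rewrite /= /depth_fun v1 subrr mul0r min_r.
apply: ax; apply/enorm_eq1; rewrite enorm_stretch /scaled_norm v1 mulr1.
by rewrite max_r ?mulfV // ?lerDl // gt_eqF // ltr_wpDr.
Qed.

(** At height 1 the values no longer depend on a: on the inner part they are the apex,
    and on the outer part a is evaluated at boundary points. *)
Lemma squeeze1 a b x v : spheroid x a -> spheroid x b ->
  squeeze a (v, I01_one R) = squeeze b (v, I01_one R).
Proof.
move=> [_ ax] [_ bx]; set p := (v, I01_one R); have h1 : ht p = 1 by [].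
have [le|/ltW ge] := leP (scaled_norm p) 1.
  rewrite /squeeze (_ : depth _ = I01_one R); first exact: contract1.
  apply: val_inj; rewrite /= /depth_fun h1 min_l //.
  by move: le; rewrite /scaled_norm h1; lra.
suff h : disk_boundary (stretch p) by rewrite /squeeze ax ?bx.
apply/enorm_eq1; rewrite enorm_stretch max_r // mulfV // gt_eqF //.
exact: lt_le_trans ge.
Qed.

(** Runs from 0 up to 1 and back to 0. *)
Definition fold_fun (u : I01 R) : R := 1 - `|2 * set_val u - 1|.
Lemma fold_subproof u : fold_fun u \in (`[0, 1]%classic : set R).
Proof.
have /andP[u0 u1] := I01P u; apply: I01_subproof; rewrite /fold_fun.
rewrite lerBlDr lerDl normr_ge0 andbT subr_ge0 ler_norml; lra.
Qed.
Definition fold (u : I01 R) : I01 R := SigSub (fold_subproof u).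

Lemma fold_continuous : continuous fold.
Proof.
apply: (@set_type_continuous (I01 R) R) => u.
apply: (@continuousB R R (I01 R) (fun=> 1) (fun u => `|2 * set_val u - 1|) u).
  exact: cst_continuous.
apply: (@continuous_compose (I01 R) R _ (fun u => 2 * set_val u - 1) Num.norm); last exact: norm_continuous.
move=> u'; apply: (@continuousB R R (I01 R) (fun u => 2 * set_val u) (fun=> 1) u'); last exact: cst_continuous.
apply: (@continuousM R (I01 R) (fun=> 2) (fun u => set_val u) u'); first exact: cst_continuous.
exact: initial_continuous.
Qed.

Lemma fold0 : fold (I01_zero R) = I01_zero R.
Proof. by apply: val_inj; rewrite /= /fold_fun mulr0 sub0r normrN normr1 subrr. Qed.

Lemma fold1 : fold (I01_one R) = I01_zero R.
Proof. by apply: val_inj; rewrite /= /fold_fun mulr1 (_ : 2 - 1 = 1) ?normr1 ?subrr //; lra. Qed.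

(** Squeeze a and then undo the squeezing of b; the two halves match by [squeeze1]. *)
Lemma spheroid_homotopic (x : NC) (a b : D -> NC) : spheroid x a -> spheroid x b ->
  homotopic_rel R (@disk_boundary R n) a b.
Proof.
move=> ax bx; pose H (p : cyl) :=
  if set_val p.2 <= 2^-1 then squeeze a (p.1, fold p.2) else squeeze b (p.1, fold p.2).
have cf e : spheroid x e -> continuous (fun p : cyl => squeeze e (p.1, fold p.2)).
  move=> [ce _]; apply: (@continuous_compose cyl cyl _ (fun p => (p.1, fold p.2))); last exact: squeeze_continuous.
  apply: continuous_pair; first by move=> ?; exact: cvg_fst.
  by apply: continuous_compose fold_continuous => ?; exact: cvg_snd.
exists H; split.
- apply: (@continuous_glue cyl NC (ht @^-1` [set y | y <= 2^-1]) (ht @^-1` [set y | 2^-1 <= y])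
    _ _ H _ _ _ (cf a ax) (cf b bx)).
  + by apply: preimage_closed; [move=> ? _; exact: ht_continuous|exact: closed_le].
  + by apply: preimage_closed; [move=> ? _; exact: ht_continuous|exact: closed_ge].
  + by apply/seteqP; split => // p _ /=; apply/orP; exact: le_total.
  + by move=> p /= h; rewrite /H -/(ht p) h.
  move=> p /= h; rewrite /H -/(ht p); case: ifP => // h'.
  have e : ht p = 2^-1 by apply/le_anti; rewrite h h'.
  rewrite (_ : fold p.2 = I01_one R); first exact: squeeze1 ax bx.
  by apply: val_inj; rewrite /= /fold_fun -/(ht p) e mulfV ?pnatr_eq0 // subrr normr0 subr0.
- by move=> t; rewrite /H /= invr_ge0 ler0n fold0 squeeze0.
- move=> t; rewrite /H /= fold1 ifF ?squeeze0 //; apply/negbTE.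
  have h1 : set_val (I01_one R) = 1 :> R by [].
  rewrite -ltNge h1; lra.
- move=> t s tb; rewrite /H; have := ax.2 t tb => ->.
  by case: ifP => _; [exact: squeeze_boundary ax tb|exact: squeeze_boundary bx tb].
Qed.

End null_homotopy.

Section augmentation.
Variables (R : realType) (k : Top_choice) (d : Order.disp_t) (P : porderType d).

Lemma edge_subproof (x y : P) : (x < y)%O -> is_chain x y [:: y].
Proof. by move=> xy; rewrite /is_chain /= xy eqxx. Qed.

Definition edge (x y : P) (h : (x < y)%O) : chain x y := Chain (edge_subproof h).

Lemma edge_le (x y : P) (h : (x < y)%O) (c : chain x y) : (edge h <= c)%O.
Proof.
change (is_true (subseq [:: y] c)); rewrite sub1seq; have /and3P[_] := chainP c.
by case: (chain_tail c) => //= a l _ /eqP <-; exact: mem_last.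
Qed.

(** The target of each map of path spaces is a point, so that lifting is trivial and a
    weak equivalence means that all spheroids are homotopic. *)
Lemma augmentation_trivial_q_fibration : trivial_q_fibration (augmentation R k P).
Proof.
split=> [u v|].
  split; first exact: map_exec_continuous.
  move=> n g H cg cH Hg; exists (fun p => g p.1); split => //.
    by apply: continuous_compose cg => ?; exact: cvg_fst.
  by move=> p; exact: poset_exec_eq.
split=> [|u v]; first by exists id.
have cD : continuous (id : Ch_exec R k u v -> realization R (nerve (chain u v))).
  exact: Delta_id_continuous.
have hom n x (a b : disk R n -> Ch_exec R k u v) : spheroid x a -> spheroid x b ->
    homotopic_rel R (@disk_boundary R n) a b.
  move=> [ca ax] [cb bx]; have uv := Ch_exec_lt x.
  have [||H [cH H0 H1 Hb]] := @spheroid_homotopic R _ _ _ (edge_le uv) n x a b.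
  - by split=> //; exact: continuous_compose ca cD.
  - by split=> //; exact: continuous_compose cb cD.
  exists H; split => //; exact: (continuous_compose cH (@realization_Delta_continuous _ _)).
have cst n (x : Ch_exec R k u v) : spheroid x (fun _ : disk R n => x).
  by split=> [|//]; exact: cst_continuous.
split.
- exact: map_exec_continuous.
- move=> x x' _.
  (* A path is a homotopy between maps from the point D^0; its boundary sphere is
     empty, so that every map is a spheroid at any point. *)
  have d0 : 0 \in @disk_set R 0 by apply/mem_set; rewrite /disk_set /= big_ord0.
  have nb (v0 : disk R 0) : ~ disk_boundary v0.
    by rewrite /disk_boundary /sphere_set /= big_ord0 => /esym/eqP; rewrite oner_eq0.
  have [||H [cH H0 H1 _]] := @hom 0%N x (fun=> x) (fun=> x').
  - exact: cst.
  - by split=> [|t /nb//]; exact: cst_continuous.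
  exists (fun s => H (SigSub d0, s)); split => //.
  apply: (@continuous_compose _ _ _ (fun s => (SigSub d0 : disk R 0, s)) H) => //.
  by apply: continuous_pair; [exact: cst_continuous|move=> ?; exact: cvg_id].
- move=> y; have uv : (u < v)%O := svalP y.
  pose s : mono 'I_1 (chain u v) := @Mono _ _ _ _ (fun=> edge uv) (fun _ _ _ => lexx _).
  have t1 : (\row_(i < 1) 1) \in std_simplex R 0.
    by apply/mem_set; split=> [i|]; rewrite ?big_ord1 mxE.
  exists (rpoint (K := nerve (chain u v)) s (SigSub t1 : simplex R 0)).
  exists (fun=> y); split => //; last exact: poset_exec_eq.
  exact: cst_continuous.
- move=> n x _; split=> [a b ax bx _|c [cc cx]]; first exact: hom ax bx.
  exists (fun=> x); first exact: cst.
  exists (fun p => c p.1); split => //; last by move=> *; exact: poset_exec_eq.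
    by apply: continuous_compose cc => ?; exact: cvg_fst.
  by move=> t; exact: poset_exec_eq.
Qed.

End augmentation.

(** * Supports and factorizations of paths *)

Section support.
Context {R : realType}.

(** The vertices of the open simplex that contains z. *)
Definition supp {d} {C : porderType d} (z : realization R (nerve C)) : set C :=
  [set c | 0 < bary z c].

Section one.
Context {d : Order.disp_t} {C : porderType d}.
Implicit Types z : realization R (nerve C).

Lemma supp_rpoint n (s : mono 'I_n.+1 C) (t : simplex R n) :
  (forall i, 0 < set_val t ord0 i) -> supp (rpoint (K := nerve C) s t) = range s.
Proof.
move=> t0; apply/seteqP; split=> [c /bary_gt0_mem[i <-]|_ [i _ <-]]; first by exists i.
exact: bary_gt0.
Qed.

Lemma supp_rpoint_sub n (s : mono 'I_n.+1 C) (t : simplex R n) :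
  supp (rpoint (K := nerve C) s t) `<=` range s.
Proof. by move=> c /bary_gt0_mem[i <-]; exists i. Qed.

Lemma supp_finite z : finite_set (supp z).
Proof.
have [n [s [t [-> _ t0]]]] := rpoint_nf z; rewrite supp_rpoint //.
by apply: finite_image; exact: finite_finset.
Qed.

Lemma supp_least z : exists c, supp z c /\ forall c', supp z c' -> (c <= c')%O.
Proof.
have [n [s [t [-> _ t0]]]] := rpoint_nf z; rewrite supp_rpoint //.
exists (s ord0); split; first by exists ord0.
by move=> _ [i _ <-]; apply: monoP; exact: leq0n.
Qed.

Definition least z : C := sval (cid (supp_least z)).

Lemma least_supp z : supp z (least z).
Proof. by rewrite /least; case: cid => c []. Qed.

Lemma least_le z c : supp z c -> (least z <= c)%O.
Proof. by rewrite /least; case: cid => c' /= [_]; apply. Qed.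

Lemma leastE z c : supp z c -> (forall c', supp z c' -> (c <= c')%O) -> least z = c.
Proof.
by move=> zc h; apply/le_anti; rewrite least_le //=; apply: h; exact: least_supp.
Qed.

(** One more than the dimension of the open simplex that contains z. *)
Definition scard z : nat := #|` fset_set (supp z)|.

Lemma scard_ltn z z' : supp z' `<=` supp z -> supp z' <> supp z -> (scard z' < scard z)%N.
Proof.
move=> sub ne; apply: fproper_ltn_card; rewrite fproperEneq andbC.
have -> /= : (fset_set (supp z') `<=` fset_set (supp z))%fset.
  by rewrite -fset_set_sub //; exact: supp_finite.
by apply/eqP => /fset_set_inj h; apply: ne; apply: h; exact: supp_finite.
Qed.

End one.

Section map.
Context {d d' : Order.disp_t} {A : porderType d} {B : porderType d'} (f : mono A B).
Implicit Types z : realization R (nerve A).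

Lemma supp_map z : supp (nerve_realization_map f z) = f @` supp z.
Proof.
have [n [s [t [-> _ t0]]]] := rpoint_nf z.
rewrite /nerve_realization_map realization_mapE !supp_rpoint //.
by rewrite image_comp.
Qed.

Lemma scard_map z : (scard (nerve_realization_map f z) <= scard z)%N.
Proof.
by rewrite /scard supp_map fset_set_image ?leq_imfset_card //; exact: supp_finite.
Qed.

Lemma scard_map_inj z : injective f -> scard (nerve_realization_map f z) = scard z.
Proof.
move=> fI; apply/(fcard_eq (supp_finite _) (supp_finite _)); rewrite supp_map.
by apply: inj_card_eq => ? ? _ _ /fI.
Qed.

Lemma bary_map z c : injective f -> bary (nerve_realization_map f z) (f c) = bary z c.
Proof.
move=> fI; rewrite /bary rexpect_map; congr rexpect; apply/funext => x /=.
by rewrite (inj_eq fI).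
Qed.

Lemma nmap_inj : injective f -> injective (@nerve_realization_map R _ _ _ _ f).
Proof. by move=> fI z z' e; apply: bary_inj => c; rewrite -!bary_map // e. Qed.

(** An order embedding identifies N A with a subcomplex of N B, and a point lies in a
    subcomplex as soon as its support does. *)
Lemma nmap_lift (z : realization R (nerve B)) :
  (forall a a', (f a <= f a')%O -> (a <= a')%O) -> supp z `<=` range f ->
  exists z', nerve_realization_map f z' = z.
Proof.
move=> fe; have [n [s [t [-> sI t0]]]] := rpoint_nf z; rewrite supp_rpoint // => h.
have /choice[r rE] i : exists a, f a = s i.
  by have [a _ <-] := h (s i) (ex_intro2 _ _ i I erefl); exists a.
have rM : {homo r : i j / (i <= j)%O} by move=> i j ij; apply: fe; rewrite !rE; exact: monoP.
exists (rpoint (K := nerve A) (Mono rM) t).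
rewrite /nerve_realization_map realization_mapE; congr (rpoint _ _).
by apply: mono_eq => i; rewrite /= rE.
Qed.

End map.


End support.

Section chain_cat.
Context {d : Order.disp_t} {Q : porderType d}.
Implicit Types x y z : Q.

Lemma lt_path_last (q : Q) p : path <%O q p -> (q <= last q p)%O.
Proof.
rewrite lt_path_sortedE => /andP[/allP h _].
by have := mem_last q p; rewrite inE => /orP[/eqP ->|/h/ltW].
Qed.

Lemma chain_le_last x y (c : chain x y) q : q \in (c : seq Q) -> (q <= y)%O.
Proof.
move=> qc; have /and3P[+ _ /eqP] := chainP c; move: qc => /splitPr[p1 p2].
rewrite cat_path /= last_cat /= => /and3P[_ _ h] <-; exact: lt_path_last.
Qed.

Lemma chain_head_lt x y (c : chain x y) q : q \in (c : seq Q) -> (x < q)%O.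
Proof.
have /and3P[p _ _] := chainP c.
by move: p; rewrite lt_path_sortedE => /andP[/allP h _]; exact: h.
Qed.

Lemma chain_last_mem x y (c : chain x y) : y \in (c : seq Q).
Proof.
have /and3P[_] := chainP c.
by case: (chain_tail c) => //= a l _ /eqP <-; exact: mem_last.
Qed.

Lemma chain_split x y z (c : chain x z) : y \in (c : seq Q) -> y != z ->
  exists (s : chain x y) (t : chain y z), c = chain_cat x y z (s, t).
Proof.
case: c => c cP /= yc yz; case: (path.splitPr yc) cP => p1 p2 cP.
have /and3P[+ _ +] := cP; rewrite cat_path /= last_cat /= => /and3P[h1 h2 h3] lz.
have sP : is_chain x y (rcons p1 y).
  by rewrite /is_chain rcons_path h1 h2 last_rcons eqxx -size_eq0 size_rcons.
have tP : is_chain y z p2.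
  rewrite /is_chain h3 lz andbT /=; case: p2 lz {cP h3} => //= yz'.
  by rewrite yz' in yz.
by exists (Chain sP), (Chain tP); apply: val_inj; rewrite /= cat_rcons.
Qed.

(** Splitting at y is recovered by comparing with y, which makes concatenation of chains
    an order embedding. *)
Lemma chain_cat_filter x y z (s : chain x y) (t : chain y z) :
  [seq q <- s ++ t | (q <= y)%O] = s /\ [seq q <- s ++ t | ~~ (q <= y)%O] = t.
Proof.
have hs q : q \in (s : seq Q) -> (q <= y)%O by exact: chain_le_last.
have ht q : q \in (t : seq Q) -> (q <= y)%O = false.
  by move=> /chain_head_lt h; apply/negbTE; rewrite lt_geF.
split; rewrite filter_cat.
  rewrite (_ : [seq q <- t | _] = [::]) ?cats0.
    by apply/all_filterP/allP.
  by apply/eqP; rewrite -[_ == _]negbK -has_filter -all_predC; apply/allP => q /ht /= ->.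
rewrite (_ : [seq q <- s | _] = [::]) ?cat0s.
  by apply/all_filterP/allP => q /ht ->.
by apply/eqP; rewrite -[_ == _]negbK -has_filter -all_predC; apply/allP => q /hs /= ->.
Qed.

Lemma subseq_filter_homo (T : eqType) (a : pred T) s t :
  subseq s t -> subseq [seq x <- s | a x] [seq x <- t | a x].
Proof.
move=> st; rewrite subseq_filter filter_all /=.
exact: subseq_trans (filter_subseq _ _) st.
Qed.

Lemma chain_cat_le x y z (p q : chain x y *p chain y z) :
  (chain_cat x y z p <= chain_cat x y z q)%O -> (p <= q)%O.
Proof.
case: p q => [s t] [s' t'] h.
have [h1 h2] := chain_cat_filter s t; have [h1' h2'] := chain_cat_filter s' t'.
apply/andP; split.
  by have := subseq_filter_homo (fun q => q <= y)%O h; rewrite /= h1 h1'.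
by have := subseq_filter_homo (fun q => ~~ (q <= y)%O) h; rewrite /= h2 h2'.
Qed.

Lemma chain_cat_inj x y z : injective (chain_cat x y z).
Proof. by move=> p q e; apply/le_anti; rewrite !chain_cat_le // e. Qed.

Lemma chain_cat_mem x y z (s : chain x y) (t : chain y z) :
  y \in (chain_cat x y z (s, t) : seq Q).
Proof. by rewrite mem_cat chain_last_mem. Qed.

End chain_cat.

Section concat.
Context {R : realType} {k : Top_choice} {d : Order.disp_t} {Q : porderType d}.
Implicit Types x y z : Q.
Local Notation E := (Ch_exec R k).
Local Notation "a ** b" := (Ch_concat a b) (at level 40, left associativity).

(** The support of a concatenation is a staircase inside the product of the supports: it
    need not contain every pair, but it projects onto both factors. *)
Lemma supp_concat x y z (a : E x y) (b : E y z) :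
  [/\ forall c, supp (a ** b) c -> exists s t, [/\ supp a s, supp b t & c = chain_cat x y z (s, t)],
      forall s, supp a s -> exists2 t, supp b t & supp (a ** b) (chain_cat x y z (s, t)) &
      forall t, supp b t -> exists2 s, supp a s & supp (a ** b) (chain_cat x y z (s, t))].
Proof.
have [h1 h2] := rpairP (a : realization R (nerve (chain x y))) (b : realization R (nerve (chain y z))).
have sa : fst @` supp (rpair a b) = supp a by rewrite -(supp_map (mono_fst _ _)) -{2}h1.
have sb : snd @` supp (rpair a b) = supp b by rewrite -(supp_map (mono_snd _ _)) -{2}h2.
have sab : supp (a ** b) = chain_cat x y z @` supp (rpair a b) by rewrite -supp_map.
rewrite sab -sa -sb; split.
- by move=> _ [[s t] st <-]; exists s, t; split=> //; exists (s, t).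
- by move=> _ [[s t] st <-]; exists t; exists (s, t).
- by move=> _ [[s t] st <-]; exists s; exists (s, t).
Qed.

(** Concatenation of chains is injective, hence so is its realization, and a point over
    a product of posets is determined by its projections. *)
Lemma concat_inj x y z (a a' : E x y) (b b' : E y z) :
  a ** b = a' ** b' -> a = a' /\ b = b'.
Proof.
move=> /(nmap_inj (@chain_cat_inj _ _ x y z)) e.
have [h1 h2] := rpairP (a : realization R (nerve (chain x y))) (b : realization R (nerve (chain y z))).
have [h1' h2'] := rpairP (a' : realization R (nerve (chain x y))) (b' : realization R (nerve (chain y z))).
by split; [rewrite -h1 -h1' e|rewrite -h2 -h2' e].
Qed.

(** All the chains of the support lie in the image of the order embedding given by
    concatenation at y. *)
Lemma concat_split x y z (w : E x z) : y != z ->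
  (forall c, supp w c -> y \in (c : seq Q)) -> exists (a : E x y) (b : E y z), w = a ** b.
Proof.
move=> yz h; have [|v ve] := @nmap_lift R _ _ _ _ (chain_cat x y z) w (@chain_cat_le _ _ x y z).
  by move=> c /h/chain_split/(_ yz)[s [t ->]]; exists (s, t).
exists (rfst v), (rsnd v); rewrite -ve /Ch_concat; congr (nerve_realization_map _ _).
exact/esym/rpair_eq.
Qed.

Lemma concat_supp_mem x y z (a : E x y) (b : E y z) c : supp (a ** b) c -> y \in (c : seq Q).
Proof. have [h _ _] := supp_concat a b; move=> /h[s [t [_ _ ->]]]; exact: chain_cat_mem. Qed.

Lemma concat_mid_neq x y z (a : E x y) (b : E y z) : y != z.
Proof. by rewrite lt_eqF //; exact: Ch_exec_lt b. Qed.

(** The vertex p lies on every chain of the support, hence, being below p', on every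
    chain of the support of a'; so a' splits at p, and the rest is associativity and
    injectivity. *)
Lemma concat_levi_lt x p p' z (a : E x p) (b : E p z) (a' : E x p') (b' : E p' z) :
  a ** b = a' ** b' -> (p < p')%O -> exists e : E p p', a' = a ** e /\ b = e ** b'.
Proof.
move=> e pp'; have [_ h _] := supp_concat a' b'.
have [||a0 [e0 a'E]] := @concat_split x p p' a'.
- by rewrite lt_eqF.
- move=> s /h[t _]; rewrite -e => /concat_supp_mem; rewrite /= mem_cat.
  by case/orP => [//|/chain_head_lt /(lt_trans pp')]; rewrite ltxx.
exists e0; move: e; rewrite a'E.
have -> : a0 ** e0 ** b' = a0 ** (e0 ** b') by rewrite Ch_concatA.
by move=> /concat_inj[<- <-].
Qed.

Lemma concat_levi x p p' z (a : E x p) (b : E p z) (a' : E x p') (b' : E p' z) :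
  a ** b = a' ** b' -> [\/ p = p', (p < p')%O | (p' < p)%O].
Proof.
move=> e; have /= pc := concat_supp_mem (least_supp (a ** b)).
have := least_supp (a ** b); rewrite {1}e => /concat_supp_mem p'c.
move: pc p'c; set c := least _ => pc p'c.
have [->|ne] := eqVneq p p'; first exact: Or31.
have [s [t cE]] := chain_split pc (concat_mid_neq a b).
rewrite cE /= mem_cat in p'c; case/orP: p'c => [/chain_le_last h|/chain_head_lt h].
  by apply: Or33; rewrite lt_neqAle eq_sym ne.
exact: Or32.
Qed.

(** The number of steps of the least chain, which is the number of indecomposable
    factors. *)
Definition len x y (a : E x y) : nat := size (least a).

Lemma len_gt0 x y (a : E x y) : (0 < len a)%N.
Proof. by rewrite lt0n size_eq0; have /and3P[] := chainP (least a). Qed.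

Lemma least_concat x y z (a : E x y) (b : E y z) :
  least (a ** b) = chain_cat x y z (least a, least b).
Proof.
have [h1 h2 h3] := supp_concat a b.
have [s [t [sa tb e]]] := h1 _ (least_supp (a ** b)).
have h c : supp (a ** b) c -> (chain_cat x y z (s, t) <= c)%O by rewrite -e; exact: least_le.
rewrite e (@leastE _ _ _ (a : realization R (nerve (chain x y))) s) //.
  rewrite (@leastE _ _ _ (b : realization R (nerve (chain y z))) t) // => t' /h3[s' _ /h].
  by move=> /chain_cat_le/andP[].
by move=> s' /h2[t' _ /h]; move=> /chain_cat_le/andP[].
Qed.

Lemma len_concat x y z (a : E x y) (b : E y z) : len (a ** b) = (len a + len b)%N.
Proof. by rewrite /len least_concat /= size_cat. Qed.

(** The indecomposable paths: those whose support contains the one-step chain. *)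
Definition ind x y (a : E x y) := len a = 1%N.

(** The first vertex of the least chain lies on all the chains of the support. *)
Lemma ind_or_concat x y (a : E x y) :
  ind a \/ exists p (b : E x p) (c : E p y), a = b ** c.
Proof.
have /and3P[] := chainP (least a); rewrite /ind /len.
case e : (chain_tail (least a)) => [//|p [|q l]] /= ph _ pl; [by left|right].
have yp : p != y.
  rewrite lt_eqF // -(eqP pl); case/and3P: ph => _ pq /lt_path_last h.
  exact: lt_le_trans h.
have [|b [c ->]] := @concat_split x p y a yp; last by exists p, b, c.
move=> c /least_le h; apply: (mem_subseq h); by rewrite /= e inE eqxx.
Qed.

Lemma ind_nconcat x p y (a : E x p) (b : E p y) : ~ ind (a ** b).
Proof.
by rewrite /ind len_concat => e; have := len_gt0 a; have := len_gt0 b; lia.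
Qed.

Lemma scard_concat x p y (a : E x p) (b : E p y) :
  (scard a <= scard (a ** b))%N /\ (scard b <= scard (a ** b))%N.
Proof.
have [h1 h2] := rpairP (a : realization R (nerve (chain x p))) (b : realization R (nerve (chain p y))).
rewrite [X in (_ <= X)%N /\ _](scard_map_inj _ (@chain_cat_inj _ _ x p y)).
rewrite [X in _ /\ (_ <= X)%N](scard_map_inj _ (@chain_cat_inj _ _ x p y)).
by split; [rewrite -{1}h1|rewrite -{1}h2]; exact: scard_map.
Qed.

Lemma ind_rpoint (x y : Q) n (s : mono 'I_n.+1 (chain x y)) (t : simplex R n) :
  (forall i, 0 < set_val t ord0 i) ->
  ind (rpoint (K := nerve (chain x y)) s t : E x y) <-> s ord0 = [:: y] :> seq Q.
Proof.
move=> t0; have sz := supp_rpoint s t0.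
have lE : least (rpoint (K := nerve (chain x y)) s t) = s ord0.
  apply: leastE; rewrite sz; first by exists ord0.
  by move=> _ [i _ <-]; apply: monoP; exact: leq0n.
rewrite /ind /len lE; split=> [/eqP|->//]; have /and3P[_ _] := chainP (s ord0).
by case: (chain_tail (s ord0)) => [//|p [|//]] /= /eqP ->.
Qed.

End concat.

(** * Subflows generated by states and cells *)

Section arrows.
Context {R : realType} {k : Top_choice}.
Implicit Types X Y Z : flow R k.

(** An arrow together with its ends, so that arrows between ends that are only provably
    equal can be compared. *)
Definition arrow Z := {p : Z * Z & exec p.1 p.2}.
Definition arr {Z} {u v : Z} (a : exec u v) : arrow Z :=
  existT (fun p : Z * Z => exec p.1 p.2) (u, v) a.

Lemma arr_inj Z (u v : Z) : injective (@arr Z u v).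
Proof.
move=> a b e; have := projT2_eq e.
by rewrite (Prop_irrelevance (projT1_eq e) erefl).
Qed.

Lemma arr_ends Z (u v u' v' : Z) (a : exec u v) (b : exec u' v') :
  arr a = arr b -> u = u' /\ v = v'.
Proof. by move=> /(congr1 (@projT1 _ _))[]. Qed.

Lemma arr_concat Z (u v w u' v' w' : Z) (a : exec u v) (b : exec v w)
    (a' : exec u' v') (b' : exec v' w') :
  arr a = arr a' -> arr b = arr b' -> arr (concat a b) = arr (concat a' b').
Proof.
move=> ea eb; have [eu ev] := arr_ends ea; have [_ ew] := arr_ends eb; subst.
by rewrite (arr_inj ea) (arr_inj eb).
Qed.

Lemma arr_cast Z (u v u' v' : Z) (a : exec u v) : u = u' -> v = v' ->
  exists a' : exec u' v', arr a' = arr a.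
Proof. by move=> <- <-; exists a. Qed.

(** Transport of continuity along equalities of ends. *)
Lemma arr_continuous (T : topologicalType) Z (u v u' v' : Z) (f : T -> exec u v)
    (f' : T -> exec u' v') : u = u' -> v = v' -> (forall t, arr (f t) = arr (f' t)) ->
  continuous f' -> continuous f.
Proof.
move=> eu ev; subst => e; suff -> : f = f' by [].
by apply/funext => t; exact/arr_inj/e.
Qed.

Lemma flow_map_ext X Y (f g : flow_map X Y) : (forall u, f u = g u) ->
  (forall u v (a : exec u v), arr (map_exec f a) = arr (map_exec g a)) -> f = g.
Proof.
case: f g => f0 f fc fm [g0 g gc gm] /= /funext e; subst g0 => h.
have e : f = g.
  apply: functional_extensionality_dep => u; apply: functional_extensionality_dep => v.
  by apply/funext => a; exact/arr_inj/h.
by subst g; congr FlowMap; exact: Prop_irrelevance.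
Qed.

End arrows.

Lemma simplex_map_continuous (R : realType) m n (f : mono 'I_m.+1 'I_n.+1) :
  continuous (@simplex_map R m n f).
Proof.
apply: (@set_type_continuous (simplex R m) 'rV[R]_n.+1); apply: row_continuous => j.
under eq_fun do rewrite mxE.
apply: continuous_big => [|i _]; first exact: add_continuous.
apply: (@continuous_compose _ _ _ (set_val : simplex R m -> 'rV[R]_m.+1)
  (fun v : 'rV[R]_m.+1 => v ord0 i)); first exact: initial_continuous.
exact: coord_continuous.
Qed.

Section subflow.
Context {R : realType} {k : Top_choice} {d : Order.disp_t} {Q : porderType d}.
Local Notation E := (Ch_exec R k).
Local Notation "a ** b" := (Ch_concat a b) (at level 40, left associativity).

(** A state, or a candidate for a cell.  A cell is named by the vertex set of its
    simplex rather than by a parametrization, so that the cell of an indecomposable path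
    is simply its support. *)
Definition preitem := (Q + {xy : Q * Q & set (chain xy.1 xy.2)})%type.
Definition cell x y (c : set (chain x y)) : preitem :=
  inr (existT (fun xy : Q * Q => set (chain xy.1 xy.2)) (x, y) c).

(** The paths of the subsemicategory generated by the open cells in B whose ends are
    states in B. *)
Inductive gen (B : set preitem) x y (z : E x y) : Prop :=
| gen_atom : ind z -> B (cell (supp z)) -> B (inl x) -> B (inl y) -> gen B z
| gen_comp p (a : E x p) (b : E p y) : gen B a -> gen B b -> z = a ** b -> gen B z.

Lemma gen_states B x y (z : E x y) : gen B z -> B (inl x) /\ B (inl y).
Proof. by elim=> {x y z} // x y z p a b _ [? _] _ [_ ?]. Qed.

Lemma gen_sub B B' x y (z : E x y) : B `<=` B' -> gen B z -> gen B' z.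
Proof.
move=> BB'; elim=> {x y z} [x y z iz Bz Bx By|x y z p a b _ ha _ hb e].
  by apply: gen_atom => //; exact: BB'.
exact: gen_comp ha hb e.
Qed.

(** Both factorizations of a path have a common refinement, and the factors of the
    refinement are shorter. *)
Lemma gen_inv B x p y (a : E x p) (b : E p y) : gen B (a ** b) -> gen B a /\ gen B b.
Proof.
have [n] := ubnP (len (a ** b)); elim: n x p y a b => // n IH x p y a b ln g.
case: g (erefl (a ** b)) => [/ind_nconcat //|p' a' b' ga' gb' e _].
move: ln; rewrite e len_concat => ln.
have la' := len_gt0 a'; have lb' := len_gt0 b'.
case: (concat_levi e) => [pp'|pp'|pp'].
- by subst p'; have [-> ->] := concat_inj e.
- have [c [a'E bE]] := concat_levi_lt e pp'.
  have [ga gc] : gen B a /\ gen B c by apply: IH; rewrite -a'E //; lia.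
  by split => //; apply: gen_comp gc gb' bE.
have [c [aE b'E]] := concat_levi_lt (esym e) pp'.
have [gc gb] : gen B c /\ gen B b by apply: IH; rewrite -b'E //; lia.
by split => //; apply: gen_comp ga' gc aE.
Qed.

Lemma gen_ind_inv B x y (z : E x y) : ind z -> gen B z -> B (cell (supp z)).
Proof. by move=> iz g; case: g iz => // p a b _ _ -> /ind_nconcat. Qed.

(** The boundary of every cell of B is generated by B. *)
Definition closed_items (B : set preitem) := forall x y (z z' : E x y),
  ind z -> gen B z -> supp z' `<=` supp z -> gen B z'.

(** Closedness passes from cells to all generated paths because a face of a
    concatenation is a concatenation of faces. *)
Lemma gen_closed B x y (z z' : E x y) : closed_items B -> gen B z ->
  supp z' `<=` supp z -> gen B z'.
Proof.
move=> cB g; elim: g z' => {x y z} [x y z iz Bz Bx By|x y z p a b _ ha _ hb e] z' sz'.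
  by apply: cB sz' => //; exact: gen_atom.
have [|c /sz'|a' [b' z'E]] := @concat_split R k _ _ x p y z'.
- exact: concat_mid_neq a b.
- by rewrite e; exact: concat_supp_mem.
have [h1 _ _] := supp_concat a b; have [_ h2 h3] := supp_concat a' b'.
apply: (@gen_comp B _ _ _ _ a' b') => //.
  apply: ha => s /h2[t _]; rewrite -z'E => /sz'; rewrite e => /h1[s1 [t1 [sa _]]].
  by move=> /chain_cat_inj[->].
apply: hb => t /h3[s _]; rewrite -z'E => /sz'; rewrite e => /h1[s1 [t1 [_ tb]]].
by move=> /chain_cat_inj[_ ->].
Qed.

Variable B : set preitem.

Record substate := Substate { pt :> Q; ptP : B (inl pt) }.

Lemma pt_inj : injective pt.
Proof. by move=> [q Bq] [q' Bq'] /= e; subst q'; congr Substate; exact: Prop_irrelevance. Qed.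

Implicit Types u v w : substate.

Definition subset_exec u v : set (realization R (nerve (chain u v))) :=
  [set z | gen B (z : E u v)].
Arguments subset_exec : clear implicits.

Lemma subset_exec_hausdorff u v : hausdorff_space (set_type (subset_exec u v)).
Proof.
apply: (@real_separated R) => x y h; apply/val_inj; apply: below_inj => c.
apply: (h (fun z => rexpect (below R c) (set_val z))).
apply: (@continuous_compose _ _ _ (set_val : set_type (subset_exec u v) -> _) (rexpect (below R c))).
  exact: initial_continuous.
exact: rexpect_continuous.
Qed.

(** The Delta-generated topology induced by the realization.  For a closed B it is also
    the weak topology of the subcomplex, by [continuous_on_simplices]. *)
Definition subexec u v : Top R k := @to_Top R k _ (@subset_exec_hausdorff u v).

Definition subpath u v (z : E u v) (h : gen B z) : subexec u v :=
  SigSub (mem_set h : z \in subset_exec u v).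

Lemma subexecP u v (a : subexec u v) : gen B (set_val a : E _ _).
Proof. exact: (set_valP a). Qed.

Lemma subexec_eq u v (a b : subexec u v) : set_val a = set_val b -> a = b.
Proof. exact: val_inj. Qed.

Lemma sub_concat_subproof u v w (a : subexec u v) (b : subexec v w) :
  gen B ((set_val a : E _ _) ** (set_val b : E _ _)).
Proof. by apply: gen_comp (erefl _); exact: subexecP. Qed.

Definition sub_concat u v w (a : subexec u v) (b : subexec v w) : subexec u w :=
  subpath (sub_concat_subproof a b).

Lemma sub_concat_continuous u v w : continuous
  (fun p : Delta R (subexec u v * subexec v w)%type => sub_concat p.1 p.2).
Proof.
apply: (@Delta_continuous R _ (set_type (subset_exec u w))
  (fun p : (subexec u v * subexec v w)%type => sub_concat p.1 p.2)) => phi cphi.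
apply: (@set_type_continuous (I01 R) _ (subset_exec u w)
  (fun s => Ch_concat (set_val (phi s).1 : E _ _) (set_val (phi s).2 : E _ _))).
have c1 : continuous (fun s => set_val (phi s).1 : realization R (nerve (chain u v))).
  apply: (@continuous_compose _ (set_type (subset_exec u v)) _ (fun s => (phi s).1) set_val); last exact: initial_continuous.
  by apply: Delta_path; apply: (continuous_compose cphi) => p; exact: cvg_fst.
have c2 : continuous (fun s => set_val (phi s).2 : realization R (nerve (chain v w))).
  apply: (@continuous_compose _ (set_type (subset_exec v w)) _ (fun s => (phi s).2) set_val); last exact: initial_continuous.
  by apply: Delta_path; apply: (continuous_compose cphi) => p; exact: cvg_snd.
apply: (@continuous_compose _ _ _ (fun s => rpair (set_val (phi s).1) (set_val (phi s).2))).
  exact: rpair_path_continuous c1 c2.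
exact: realization_map_continuous.
Qed.

Lemma sub_concatA u v w x (a : subexec u v) (b : subexec v w) (c : subexec w x) :
  sub_concat a (sub_concat b c) = sub_concat (sub_concat a b) c.
Proof. by apply: subexec_eq; exact: Ch_concatA. Qed.

Definition subflow : flow R k := Flow sub_concat_continuous sub_concatA.

End subflow.
Arguments subset_exec R k {d Q} B u v.
Arguments subexec R k {d Q} B u v.
Arguments subflow R k {d Q} B.
Arguments gen R k {d Q} B [x y] z.
Arguments closed_items R k {d Q} B.

(** * Maps out of a subflow *)

Section extension.
Context {R : realType} {k : Top_choice} {d : Order.disp_t} {Q : porderType d}.
Local Notation E := (Ch_exec R k).
Local Notation "a ** b" := (Ch_concat a b) (at level 40, left associativity).
Implicit Types B : set (@preitem d Q).
Local Notation Sub := (subflow R k).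
Local Notation subexec := (subexec R k).
Local Notation gen := (gen R k).

Definition path_arr x y (z : E x y) : arrow (Ch R k Q) := @arr R k (Ch R k Q) x y z.

Lemma path_arr_inj x y : injective (@path_arr x y).
Proof. by move=> z z' e; exact: (@arr_inj R k (Ch R k Q) x y z z' e). Qed.

Lemma sub_arr_eq B (u v u' v' : substate B) (a : subexec B u v) (b : subexec B u' v') :
  path_arr (set_val a : E _ _) = path_arr (set_val b : E _ _) ->
  @arr R k (Sub B) u v a = @arr R k (Sub B) u' v' b.
Proof.
move=> e; have [/pt_inj eu /pt_inj ev] := arr_ends e; subst.
by congr arr; apply: subexec_eq; exact: path_arr_inj e.
Qed.

Definition substate_incl B B' (h : B `<=` B') (u : substate B) : substate B' :=
  Substate (h _ (ptP u)).

Definition subexec_incl B B' (h : B `<=` B') (u v : substate B) (a : subexec B u v) :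
  subexec B' (substate_incl h u) (substate_incl h v) :=
  subpath (u := substate_incl h u) (v := substate_incl h v) (gen_sub h (subexecP a)).

Lemma subexec_incl_continuous B B' (h : B `<=` B') (u v : substate B) :
  continuous (@subexec_incl B B' h u v).
Proof.
apply: (@Delta_map_continuous R (set_type (subset_exec R k B u v))
  (set_type (subset_exec R k B' (substate_incl h u) (substate_incl h v)))).
apply: (@set_type_continuous (set_type (subset_exec R k B u v)) _
  (subset_exec R k B' (substate_incl h u) (substate_incl h v))).
exact: initial_continuous.
Qed.

Definition sub_incl B B' (h : B `<=` B') : flow_map (Sub B) (Sub B').
Proof.
apply: (@FlowMap R k (Sub B) (Sub B') (substate_incl h) (@subexec_incl B B' h)).
- exact: subexec_incl_continuous.
- by move=> u v w a b; apply: subexec_eq.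
Defined.

Lemma sub_incl_id B (h : B `<=` B) : sub_incl h = flow_id (Sub B).
Proof.
apply: flow_map_ext => [u|u v a] /=; first exact: pt_inj.
exact: sub_arr_eq.
Qed.

Lemma sub_incl_comp B B' B'' (h : B `<=` B') (h' : B' `<=` B'') (h'' : B `<=` B'') :
  sub_incl h'' = flow_comp (sub_incl h') (sub_incl h).
Proof.
apply: flow_map_ext => [u|u v a] /=; first exact: pt_inj.
exact: sub_arr_eq.
Qed.

Section free.
Variables (B : set (@preitem d Q)) (Z : flow R k) (h0 : substate B -> Z).
Implicit Types u v : substate B.
Variable Theta : forall u v, E u v -> exec (h0 u) (h0 v) -> Prop.
Hypothesis Theta_fun : forall u v (z : E u v) w w', ind z -> gen B z ->
  Theta z w -> Theta z w' -> w = w'.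
Hypothesis Theta_total : forall u v (z : E u v), ind z -> gen B z -> exists w, Theta z w.

(** The multiplicative closure of the values Theta prescribed on indecomposable paths,
    as a relation: it is single-valued by freeness. *)
Inductive ext u v (z : E u v) (w : exec (h0 u) (h0 v)) : Prop :=
| ext_atom : ind z -> Theta z w -> ext z w
| ext_comp (p : substate B) (a : E u p) (b : E p v) wa wb :
    ext a wa -> ext b wb -> z = a ** b -> w = concat wa wb -> ext z w.

Lemma ext_total u v (z : E u v) : gen B z -> exists w, ext z w.
Proof.
have gg x y (z' : E x y) : gen B z' -> forall (Bx : B (inl x)) (By : B (inl y)),
    exists w, @ext (Substate Bx) (Substate By) z' w.
  elim=> {x y z'} [x y z' iz Bz Bx By Bx' By'|x y z' p a b ga ha gb hb e Bx By].
    have [w hw] := @Theta_total (Substate Bx') (Substate By') z' iz (gen_atom iz Bz Bx By).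
    by exists w; exact: ext_atom.
  have [_ Bp] := gen_states ga; have [wa ea] := ha Bx Bp; have [wb eb] := hb Bp By.
  by exists (concat wa wb); exact: (ext_comp ea eb).
by case: u v z => [x Bx] [y By] z g; exact: (gg _ _ _ g Bx By).
Qed.

(** Two factorizations of z give the same value: at different vertices they have a
    common refinement, the values of the longer factors agree by induction with those
    computed from the refinement, and composition in Z is associative. *)
Lemma ext_fun u v (z : E u v) w w' : gen B z -> ext z w -> ext z w' -> w = w'.
Proof.
have [n] := ubnP (len z); elim: n u v z w w' => // n IH u v z w w' + gz e e'.
case: e => [iz th|p a b wa wb ea eb zE ->].
  move=> _; case: e' => [_|p a b wa wb _ _ e]; first exact: Theta_fun.
  by case: (@ind_nconcat R k _ _ _ _ _ a b); rewrite -e.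
case: e' => [iz|p' a' b' wa' wb' ea' eb' zE' ->].
  by case: (@ind_nconcat R k _ _ _ _ _ a b); rewrite -zE.
move=> ln; have [ga gb] : gen B a /\ gen B b by apply: gen_inv; rewrite -zE.
have [ga' gb'] : gen B a' /\ gen B b' by apply: gen_inv; rewrite -zE'.
have [sa sb] : (len a < n)%N /\ (len b < n)%N.
  by move: ln; rewrite zE len_concat; have := len_gt0 a; have := len_gt0 b; lia.
have [sa' sb'] : (len a' < n)%N /\ (len b' < n)%N.
  by move: ln; rewrite zE' len_concat; have := len_gt0 a'; have := len_gt0 b'; lia.
rewrite zE in zE'; case: (concat_levi zE') => [/pt_inj pp'|pp'|pp'].
- subst p'; have [eaa ebb] := concat_inj zE'; subst a' b'.
  by have -> := IH _ _ a _ _ sa ga ea ea'; have -> := IH _ _ b _ _ sb gb eb eb'.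
- have [c [aE bE]] := concat_levi_lt zE' pp'.
  have [_ gc] : gen B a /\ gen B c by apply: gen_inv; rewrite -aE.
  have [wc ec] := ext_total gc.
  have -> := IH _ _ b _ _ sb gb eb (ext_comp ec eb' bE erefl).
  have -> := IH _ _ a' _ _ sa' ga' ea' (ext_comp ea ec aE erefl).
  exact: concatA.
have [c [aE bE]] := concat_levi_lt (esym zE') pp'.
have [_ gc] : gen B a' /\ gen B c by apply: gen_inv; rewrite -aE.
have [wc ec] := ext_total gc.
have -> := IH _ _ a _ _ sa ga ea (ext_comp ea' ec aE erefl).
have -> := IH _ _ b' _ _ sb' gb' eb' (ext_comp ec eb bE erefl).
exact/esym/concatA.
Qed.

Lemma free_extension : exists h : forall u v, subexec B u v -> exec (h0 u) (h0 v),
  (forall u v (a : subexec B u v), ind (set_val a : E _ _) -> Theta (set_val a) (h _ _ a)) /\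
  forall u v w (a : subexec B u v) (b : subexec B v w),
    h _ _ (sub_concat a b) = concat (h _ _ a) (h _ _ b).
Proof.
pose h u v (a : subexec B u v) := sval (cid (ext_total (subexecP a))).
have hP u v (a : subexec B u v) : ext (set_val a : E _ _) (h _ _ a).
  by rewrite /h; case: cid.
exists h; split=> [u v a ia|u v w a b].
  case: (hP _ _ a) => // p b c wa wb _ _ e _.
  by case: (@ind_nconcat R k _ _ _ _ _ b c); rewrite -e.
apply: (@ext_fun _ _ (set_val (sub_concat a b) : E _ _)) (hP _ _ _) _.
  exact: subexecP.
exact: (ext_comp (hP _ _ a) (hP _ _ b)).
Qed.
End free.

Section continuity.
Variables (B : set (@preitem d Q)) (Z : flow R k) (h0 : substate B -> Z).
Implicit Types u v : substate B.
Variable h : forall u v, subexec B u v -> exec (h0 u) (h0 v).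
Hypothesis B_closed : closed_items R k B.
Hypothesis h_concat : forall u v w (a : subexec B u v) (b : subexec B v w),
  h (sub_concat a b) = concat (h a) (h b).
Hypothesis h_cell : forall u v n (s : mono 'I_n.+1 (chain u v))
  (hs : forall t : simplex R n, gen B (rpoint (K := nerve (chain u v)) s t : E u v)),
  (s ord0 = [:: (v : Q)] :> seq Q) -> continuous (fun t => h (subpath (hs t))).

Lemma rpoint_concat (x p y : Q) n (s : mono 'I_n.+1 (chain x p)) (s' : mono 'I_n.+1 (chain p y))
    (r : mono 'I_n.+1 (chain x y)) (t : simplex R n) :
  (forall i, r i = chain_cat x p y (s i, s' i)) ->
  rpoint (K := nerve (chain x y)) r t =
  (rpoint (K := nerve (chain x p)) s t : E x p) ** (rpoint (K := nerve (chain p y)) s' t : E p y).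
Proof.
move=> rE; have pM : {homo (fun i => (s i, s' i) : chain x p *p chain p y) : i j / (i <= j)%O}.
  by move=> i j ij; apply/andP; split; exact: monoP.
have -> : r = mono_comp (chain_cat x p y) (Mono pM) by apply: mono_eq => i; exact: rE.
rewrite -[LHS](realization_mapE (nerve_map (chain_cat x p y))) /Ch_concat; congr realization_map.
apply/esym/rpair_eq; rewrite /rfst /rsnd realization_mapE;
  by congr (rpoint _ t); exact: mono_eq.
Qed.

(** The first vertex of the chain r 0 lies on every chain r i. *)
Lemma simplex_split (x y : Q) n (r : mono 'I_n.+1 (chain x y)) :
  r ord0 = [:: y] :> seq Q \/
  exists p (s : mono 'I_n.+1 (chain x p)) (s' : mono 'I_n.+1 (chain p y)),
    forall i, r i = chain_cat x p y (s i, s' i).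
Proof.
have /and3P[] := chainP (r ord0).
case e : (chain_tail (r ord0)) => [//|p [|q l]] /= ph _ pl; [by left; rewrite (eqP pl)|right].
have yp : p != y.
  rewrite lt_eqF // -(eqP pl); case/and3P: ph => _ pq /lt_path_last.
  exact: lt_le_trans.
have pr i : p \in (r i : seq Q).
  have h' : (r ord0 <= r i)%O by apply: monoP; exact: leq0n.
  by apply: (mem_subseq h'); rewrite /= e inE eqxx.
have /choice[s sE] i : exists st : chain x p *p chain p y, r i = chain_cat x p y st.
  by have [s [t ->]] := chain_split (pr i) yp; exists (s, t).
have sM : {homo s : i j / (i <= j)%O}.
  by move=> i j ij; apply: chain_cat_le; rewrite -!sE; exact: monoP.
exists p, (mono_comp (mono_fst _ _) (Mono sM)), (mono_comp (mono_snd _ _) (Mono sM)) => i.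
by rewrite sE /=; case: (s i).
Qed.

(** Splitting the simplex along the vertices of its least chain expresses h on it as a
    composite of values of h on simplices that begin with a one-step chain. *)
Lemma ext_simplex_continuous u v n (s : mono 'I_n.+1 (chain u v))
  (hs : forall t : simplex R n, gen B (rpoint (K := nerve (chain u v)) s t : E u v)) :
  continuous (fun t => h (subpath (hs t))).
Proof.
have [m] := ubnP (size (s ord0)); elim: m u v s hs => // m IH u v s hs lm.
case: (simplex_split s) => [|[p [s1 [s2 sE]]]]; first exact: h_cell.
have gs t : gen B (rpoint (K := nerve (chain u p)) s1 t : E u p) /\
    gen B (rpoint (K := nerve (chain p v)) s2 t : E p v).
  by apply: gen_inv; rewrite -(rpoint_concat _ sE).
have [t0 _] := simplex_interior R n.
have Bp : B (inl p) := (gen_states (gs t0).1).2.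
have c1 := IH u (Substate Bp) s1 (fun t => (gs t).1); have c2 := IH (Substate Bp) v s2 (fun t => (gs t).2).
have l0 x y (c : chain x y) : (0 < size c)%N by rewrite lt0n size_eq0; have /and3P[] := chainP c.
have ls : size (s ord0) = (size (s1 ord0) + size (s2 ord0))%N by rewrite sE /= size_cat.
rewrite ltnS ls in lm.
have {}c1 : continuous (fun t => h (subpath (u := u) (v := Substate Bp) (gs t).1)).
  by apply: c1; apply: leq_trans lm; rewrite -addn1 leq_add2l l0.
have {}c2 : continuous (fun t => h (subpath (u := Substate Bp) (v := v) (gs t).2)).
  by apply: c2; apply: leq_trans lm; rewrite -add1n leq_add2r l0.
have -> : (fun t => h (subpath (hs t))) =
    (fun t => concat (h (subpath (u := u) (v := Substate Bp) (gs t).1))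
                     (h (subpath (u := Substate Bp) (v := v) (gs t).2))).
  apply/funext => t; rewrite -h_concat; congr h; apply: subexec_eq.
  exact: (rpoint_concat _ sE).
have cp := Delta_generated_continuous (@simplex_Delta_generated R n) (continuous_pair c1 c2).
exact: (continuous_compose cp (@concat_continuous R k Z _ _ _)).
Qed.

(** Continuity on a Delta-generated space is tested on paths, and a path is compact,
    hence meets finitely many simplices. *)
Lemma ext_continuous u v : continuous (@h u v).
Proof.
apply/continuousP => U oU; rewrite open_DeltaE => phi cphi.
suff /continuousP : continuous (@h u v \o phi) by apply.
have cval : continuous (fun i => set_val (phi i) : realization R (nerve (chain u v))).
  apply: (@continuous_compose _ (set_type (subset_exec R k B u v)) _ phi set_val) => //.
  exact: initial_continuous.
apply: (continuous_on_simplices (@I01_compact R) _ cval).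
  apply: (@real_separated R) => x y hxy; apply: val_inj.
  by apply: (hxy set_val); exact: initial_continuous.
move=> n s _ [i [t0 [t0_gt0 iE]]].
have hs t : gen B (rpoint (K := nerve (chain u v)) s t : E u v).
  apply: (@gen_closed R k _ _ B u v (set_val (phi i) : E u v)) => //; first exact: subexecP.
  rewrite iE (supp_rpoint _ t0_gt0); exact: supp_rpoint_sub.
exists (fun tx => h (subpath (hs tx.1))); split.
  apply: (@continuous_compose (simplex R n * I01 R)%type _ _ fst (fun t => h (subpath (hs t)))).
    by move=> ?; exact: cvg_fst.
  exact: ext_simplex_continuous.
by move=> t x e /=; congr h; apply: subexec_eq; rewrite e.
Qed.

Definition ext_map : flow_map (Sub B) Z :=
  @FlowMap R k (Sub B) Z h0 h ext_continuous h_concat.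

End continuity.

Lemma ext_agree B B' (i : B `<=` B') (Z : flow R k) (h0 : substate B' -> Z)
    (h : forall u v, subexec B' u v -> exec (h0 u) (h0 v))
    (h_concat : forall u v w (a : subexec B' u v) (b : subexec B' v w),
      h _ _ (sub_concat a b) = concat (h _ _ a) (h _ _ b))
    (g : flow_map (Sub B) Z) :
  (forall u v (a : subexec B u v), ind (set_val a : E _ _) ->
    arr (h _ _ (subexec_incl i a)) = arr (map_exec g a)) ->
  forall u v (a : subexec B u v), arr (h _ _ (subexec_incl i a)) = arr (map_exec g a).
Proof.
move=> hi; have gg x y (z : E x y) : gen B z -> forall (Bx : B (inl x)) (By : B (inl y))
    (gz : gen B z), let a := subpath (u := Substate Bx) (v := Substate By) gz in
    arr (h _ _ (subexec_incl i a)) = arr (map_exec g a).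
  elim=> {x y z} [x y z iz _ _ _ Bx By gz|x y z p a b ga ha gb hb e Bx By gz] /=.
    exact: hi.
  have [_ Bp] := gen_states ga.
  have aE : subpath (u := Substate Bx) (v := Substate By) gz =
      sub_concat (subpath (u := Substate Bx) (v := Substate Bp) ga)
                 (subpath (u := Substate Bp) (v := Substate By) gb).
    exact: subexec_eq.
  have -> : subexec_incl i (subpath (u := Substate Bx) (v := Substate By) gz) =
      sub_concat (subexec_incl i (subpath (u := Substate Bx) (v := Substate Bp) ga))
                 (subexec_incl i (subpath (u := Substate Bp) (v := Substate By) gb)).
    exact: subexec_eq.
  by rewrite aE h_concat (map_concat g); apply: arr_concat.
move=> [x Bx] [y By] a; have := gg x y _ (subexecP a) Bx By (subexecP a).
rewrite (_ : subpath _ = a) //; exact: subexec_eq.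
Qed.

Lemma sub_map_unique B (Z : flow R k) (f g : flow_map (Sub B) Z) :
  (forall u, f u = g u) ->
  (forall u v (a : subexec B u v), ind (set_val a : E _ _) ->
    arr (map_exec f a) = arr (map_exec g a)) -> f = g.
Proof.
move=> fg0 fg; apply: flow_map_ext => // u v a.
have fc u' v' w' (a' : subexec B u' v') (b' : subexec B v' w') :
  map_exec f (sub_concat a' b') = concat (map_exec f a') (map_exec f b') by exact: (map_concat f).
have i : B `<=` B by [].
have e u' v' (b : subexec B u' v') : @arr R k (Sub B) _ _ (subexec_incl i b) = @arr R k (Sub B) _ _ b.
  exact: sub_arr_eq.
have E1 u' v' (b : subexec B u' v') : arr (map_exec f (subexec_incl i b)) = arr (map_exec f b).
  have := e _ _ b; move: (subexec_incl i b) => c; move: (substate_incl i u') (substate_incl i v') c.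
  by move=> u1 v1 c h; have [h1 h2] := arr_ends h; subst; rewrite (arr_inj h).
rewrite -E1; apply: (@ext_agree B B i Z f (fun u v => @map_exec R k (Sub B) Z f u v) fc g) => u' v' b ib; rewrite E1; exact: fg.
Qed.

End extension.

(** * Gluing and directed unions *)

Lemma arr_map (R : realType) (k : Top_choice) (X Z : flow R k) (f : flow_map X Z)
    (u v u' v' : X) (a : exec u v) (a' : exec u' v') :
  arr a = arr a' -> arr (map_exec f a) = arr (map_exec f a').
Proof. by move=> e; have [eu ev] := arr_ends e; subst; rewrite (arr_inj e). Qed.

Lemma flow_map_eq_arr (R : realType) (k : Top_choice) (X Z : flow R k) (f g : flow_map X Z)
    (u v : X) (a : exec u v) : f = g -> arr (map_exec f a) = arr (map_exec g a).
Proof. by move=> ->. Qed.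

Lemma flow_map_eq_state (R : realType) (k : Top_choice) (X Z : flow R k) (f g : flow_map X Z)
    (u : X) : f = g -> f u = g u.
Proof. by move=> ->. Qed.

Section gluing.
Context {R : realType} {k : Top_choice} {d : Order.disp_t} {Q : porderType d}.
Local Notation E := (Ch_exec R k).
Implicit Types B : set (@preitem d Q).
Local Notation Sub := (subflow R k).
Local Notation subexec := (subexec R k).
Local Notation gen := (gen R k).
Local Notation path_arr := (@path_arr R k d Q _ _).
Local Notation free_arr B := (@arr R k (Sub B) _ _).

Lemma arr_subexec B (Z : flow R k) (h0 : substate B -> Z)
    (h : forall u v, subexec B u v -> exec (h0 u) (h0 v)) u v u' v'
    (a : subexec B u v) (a' : subexec B u' v') :
  path_arr (set_val a : E _ _) = path_arr (set_val a' : E _ _) ->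
  arr (h _ _ a) = arr (h _ _ a').
Proof.
move=> /sub_arr_eq e; have [eu ev] := arr_ends e; subst.
by rewrite (arr_inj e).
Qed.

Lemma subpath_rpoint_continuous B (u v : substate B) n (s : mono 'I_n.+1 (chain u v))
  (hs : forall t : simplex R n, gen B (rpoint (K := nerve (chain u v)) s t : E u v)) :
  continuous (fun t => subpath (hs t)).
Proof.
apply: (@Delta_generated_continuous R (simplex R n) (set_type (subset_exec R k B u v)) (fun t => subpath (hs t))).
  exact: simplex_Delta_generated.
apply: (@set_type_continuous (simplex R n) _ (subset_exec R k B u v)).
exact: rpoint_continuous.
Qed.

(** The values of the g i on indecomposable paths are coherent, and each cell lies in
    some Bf i, where the extension coincides with the continuous map g i. *)
Lemma glue_maps (I : Type) (Bf : I -> set preitem) B (sub : forall i, Bf i `<=` B)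
    (Z : flow R k) (h0 : substate B -> Z) (g : forall i, flow_map (Sub (Bf i)) Z) :
  closed_items R k B -> (forall i, closed_items R k (Bf i)) ->
  (forall x y (z : E x y), ind z -> gen B z -> exists i, gen (Bf i) z) ->
  (forall i (u : substate (Bf i)), h0 (substate_incl (sub i) u) = g i u) ->
  (forall i j (u v : substate (Bf i)) (u' v' : substate (Bf j))
     (a : subexec (Bf i) u v) (a' : subexec (Bf j) u' v'),
     path_arr (set_val a : E _ _) = path_arr (set_val a' : E _ _) ->
     arr (map_exec (g i) a) = arr (map_exec (g j) a')) ->
  exists f : flow_map (Sub B) Z, (forall u, f u = h0 u) /\
    forall i, flow_comp f (sub_incl (sub i)) = g i.
Proof.
move=> cB cBf cover hg compat.
(* Stated with arrows because the ends of w and those of the value of g i are only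
   provably equal. *)
pose Theta (u v : substate B) (z : E u v) (w : exec (h0 u) (h0 v)) :=
  exists i (u' v' : substate (Bf i)) (a : subexec (Bf i) u' v'),
    path_arr (set_val a : E _ _) = path_arr z /\ arr w = arr (map_exec (g i) a).
have [|u v z iz gz|h [h_atom h_concat]] := @free_extension R k d Q B Z h0 Theta.
- move=> u v z w w' _ _ [i [u1 [v1 [a [e1 e2]]]]] [j [u2 [v2 [b [e3 e4]]]]].
  by apply: arr_inj; rewrite e2 e4; apply: compat; rewrite e1 e3.
- have [i gi] := cover _ _ _ iz gz; have [Bu Bv] := gen_states gi.
  pose a := subpath (u := Substate Bu) (v := Substate Bv) gi.
  have eu : g i (Substate Bu) = h0 u by rewrite -hg; congr h0; exact: pt_inj.
  have ev : g i (Substate Bv) = h0 v by rewrite -hg; congr h0; exact: pt_inj.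
  have [w we] := arr_cast (map_exec (g i) a) eu ev.
  by exists w, i, (Substate Bu), (Substate Bv), a.
have agree i (u v : substate (Bf i)) (a : subexec (Bf i) u v) :
    arr (h _ _ (subexec_incl (sub i) a)) = arr (map_exec (g i) a).
  apply: (@ext_agree R k d Q (Bf i) B (sub i) Z h0 h h_concat (g i)) => {u v a} u v a ia.
  have [j [u' [v' [b [e1 ->]]]]] := h_atom _ _ (subexec_incl (sub i) a) ia.
  exact: compat.
have cell_cont (u v : substate B) n (s : mono 'I_n.+1 (chain u v))
    (hs : forall t : simplex R n, gen B (rpoint (K := nerve (chain u v)) s t : E u v)) :
    (s ord0 = [:: (v : Q)] :> seq Q) -> continuous (fun t => h _ _ (subpath (hs t))).
  move=> s0; have [t0 t0_gt0] := simplex_interior R n.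
  pose z0 : E u v := rpoint (K := nerve (chain u v)) s t0.
  have sz0 : supp z0 = range s by exact: supp_rpoint.
  have iz0 : ind z0 by apply/ind_rpoint.
  have [i gi] := cover _ _ _ iz0 (hs t0); have [Bu Bv] := gen_states gi.
  have hi t : gen (Bf i) (rpoint (K := nerve (chain u v)) s t : E u v).
    by apply: gen_closed gi _ => //; rewrite sz0; exact: supp_rpoint_sub.
  apply: (@arr_continuous R k _ Z _ _ (g i (Substate Bu)) (g i (Substate Bv)) _
    (fun t => map_exec (g i) (subpath (u := Substate Bu) (v := Substate Bv) (hi t)))).
  - by rewrite -hg; congr h0; exact: pt_inj.
  - by rewrite -hg; congr h0; exact: pt_inj.
  - by move=> t; rewrite -agree; apply: arr_subexec.
  exact: (continuous_compose (@subpath_rpoint_continuous (Bf i) (Substate Bu) (Substate Bv) n s hi)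
    (@map_exec_continuous R k (Sub (Bf i)) Z (g i) _ _)).
exists (ext_map cB h_concat cell_cont); split => // i.
by apply: flow_map_ext => [u|u v a] /=; [exact: hg|exact: agree].
Qed.

Section diagram.
Context {d' : Order.disp_t} {W : orderType d'}.
Variables (Bf : W -> set (@preitem d Q)) (Bf_homo : forall v w, (v <= w)%O -> Bf v `<=` Bf w).

Definition sub_diagram : diagram R k W.
Proof.
apply: (@Diagram R k d' W (fun w => Sub (Bf w)) (fun v w h => sub_incl (Bf_homo h))).
- by move=> w h; exact: sub_incl_id.
- by move=> u v w h h' h''; exact: sub_incl_comp.
Defined.

(** A path is generated by finitely many items, which by directedness all belong to one
    Bf w. *)
Lemma gen_union (A : W -> Prop) B x y (z : E x y) : 
  (forall q, B q -> exists2 w, A w & Bf w q) -> gen B z -> exists2 w, A w & gen (Bf w) z.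
Proof.
move=> BA; elim=> {x y z} [x y z iz Bz Bx By|x y z p a b _ [v Av ga] _ [w Aw gb] e].
  have [w1 A1 h1] := BA _ Bz; have [w2 A2 h2] := BA _ Bx; have [w3 A3 h3] := BA _ By.
  have upper v w : A v -> A w -> exists m, [/\ A m, (v <= m)%O & (w <= m)%O].
    by move=> Av Aw; case: (leP v w) => [l|/ltW l]; [exists w|exists v].
  have [m [Am l1 l2]] := upper _ _ A1 A2; have [w [Aw l l3]] := upper _ _ Am A3.
  have {}l1 := le_trans l1 l; have {}l2 := le_trans l2 l.
  by exists w => //; apply: gen_atom; [|exact: (Bf_homo l1)|exact: (Bf_homo l2)|exact: (Bf_homo l3)].
case: (leP v w) => [l|/ltW l].
  by exists w => //; apply: gen_comp (gen_sub (Bf_homo l) ga) gb e.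
by exists v => //; apply: gen_comp ga (gen_sub (Bf_homo l) gb) e.
Qed.

(** A compatible family of maps on the Bf w glues to the union by [glue_maps]; on states
    the value is taken at any stage that contains the state. *)
Lemma sub_colimit (A : W -> Prop) B (sub : forall w, A w -> Bf w `<=` B) :
  closed_items R k B -> (forall w, closed_items R k (Bf w)) ->
  (forall q, B q -> exists2 w, A w & Bf w q) ->
  is_colimit (D := sub_diagram) (fun w (Aw : A w) => sub_incl (sub w Aw)).
Proof.
move=> cB cBf BA; split=> [v w h Av Aw|Z g gc].
  by rewrite /= -(sub_incl_comp _ _ (sub v Av)).
have compat v w (Av : A v) (Aw : A w) (x y : substate (Bf v)) (x' y' : substate (Bf w))
     (a : subexec (Bf v) x y) (a' : subexec (Bf w) x' y') :
     path_arr (set_val a : E _ _) = path_arr (set_val a' : E _ _) ->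
     arr (map_exec (g v Av) a) = arr (map_exec (g w Aw) a').
  have le_case v1 w1 (Av1 : A v1) (Aw1 : A w1) (h : (v1 <= w1)%O)
      (x1 y1 : substate (Bf v1)) (x2 y2 : substate (Bf w1))
      (b : subexec (Bf v1) x1 y1) (b' : subexec (Bf w1) x2 y2) :
     path_arr (set_val b : E _ _) = path_arr (set_val b' : E _ _) ->
     arr (map_exec (g v1 Av1) b) = arr (map_exec (g w1 Aw1) b').
    move=> e; rewrite -(flow_map_eq_arr _ (gc _ _ h Av1 Aw1)).
    apply: (@arr_map R k (Sub (Bf w1)) Z (g w1 Aw1)); exact: sub_arr_eq.
  move=> e; case: (leP v w) => [l|/ltW l]; first exact: le_case.
  exact/esym/le_case.
have compat0 v w (Av : A v) (Aw : A w) (x : substate (Bf v)) (x' : substate (Bf w)) :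
    pt x = pt x' -> g v Av x = g w Aw x'.
  have le_case v1 w1 (Av1 : A v1) (Aw1 : A w1) (h : (v1 <= w1)%O)
      (x1 : substate (Bf v1)) (x2 : substate (Bf w1)) : pt x1 = pt x2 -> g v1 Av1 x1 = g w1 Aw1 x2.
    by move=> e; rewrite -(gc _ _ h Av1 Aw1) /=; congr (g _ _ _); exact: pt_inj.
  move=> e; case: (leP v w) => [l|/ltW l]; first exact: le_case.
  exact/esym/le_case.
pose I := {w | A w}.
have pick (u : substate B) : {i : I | Bf (sval i) (inl (pt u))}.
  by have /cid2[w Aw Bw] := BA _ (ptP u); exists (exist _ w Aw).
pose h0 (u : substate B) := g _ (proj2_sig (sval (pick u))) (Substate (proj2_sig (pick u))).
have [//|i|x y z _ /(gen_union BA)[w Aw gw]|i u|i j u v u' v' a a'|f [f0 fE]] :=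
    @glue_maps I (fun i => Bf (sval i)) B (fun i => sub _ (proj2_sig i)) Z h0 (fun i => g _ (proj2_sig i)).
- exact: cBf.
- by exists (exist _ w Aw).
- exact: compat0.
- exact: compat.
exists f; split=> [w Aw|f' f'E]; first exact: (fE (exist _ w Aw)).
apply: sub_map_unique => [u|u v a _].
  have [w Aw Bw] := BA _ (ptP u).
  have -> : u = substate_incl (sub w Aw) (Substate Bw) by exact: pt_inj.
  have /= -> := @flow_map_eq_state R k (Sub (Bf w)) Z _ _ (Substate Bw) (fE (exist _ w Aw)).
  by have /= -> := @flow_map_eq_state R k (Sub (Bf w)) Z _ _ (Substate Bw) (f'E w Aw).
have [w Aw gw] := gen_union BA (subexecP a); have [Bu Bv] := gen_states gw.
pose a' := subpath (u := Substate Bu) (v := Substate Bv) gw.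
have e : @arr R k (Sub B) _ _ a = @arr R k (Sub B) _ _ (subexec_incl (sub w Aw) a') by exact: sub_arr_eq.
rewrite (arr_map f e) (arr_map f' e).
have /= -> := @flow_map_eq_arr R k (Sub (Bf w)) Z _ _ (Substate Bu) (Substate Bv) a' (fE (exist _ w Aw)).
by have /= -> := @flow_map_eq_arr R k (Sub (Bf w)) Z _ _ (Substate Bu) (Substate Bv) a' (f'E w Aw).
Qed.

End diagram.
End gluing.

(** * Attaching one state or one cell *)

Section globe.
Context {R : realType} {k : Top_choice}.
Implicit Types (Z : Top R k) (X : flow R k).

Definition glob_lift_exec Z X (x y : X) (f : Z -> exec x y) (u v : bool) :
    Glob_exec Z u v -> exec (if u then y else x) (if v then y else x) :=
  match u, v with
  | false, true => f
  | false, false | true, _ => fun a => False_rect _ (Top_void_false a)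
  end.

Definition glob_lift Z X (x y : X) (f : Z -> exec x y) (cf : continuous f) :
  flow_map (Glob Z) X.
Proof.
apply: (@FlowMap R k (Glob Z) X (fun u : bool => if u then y else x) (glob_lift_exec f)).
- by move=> [] [] //; apply: continuous_from_void => -[].
- by move=> u v w a b; case: (Glob_exec_false a b).
Defined.

Lemma glob_ext Z X (f g : flow_map (Glob Z) X) :
  f false = g false -> f true = g true ->
  (forall a : Z, arr (@map_exec R k (Glob Z) X f false true a) =
                 arr (@map_exec R k (Glob Z) X g false true a)) -> f = g.
Proof.
by move=> e0 e1 e; apply: flow_map_ext => [[]|[] [] a] //; case: a.
Qed.

End globe.

Section pushouts.
Context {R : realType} {k : Top_choice} {d : Order.disp_t} {Q : porderType d}.
Local Notation E := (Ch_exec R k).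
Implicit Types B : set (@preitem d Q).
Local Notation Sub := (subflow R k).
Local Notation subexec := (subexec R k).
Local Notation gen := (gen R k).
Local Notation path_arr := (@path_arr R k d Q _ _).

(** The new state is isolated: no generated path begins or ends there, so that a map on
    the larger subflow is a map on the smaller one and a choice of image for the new
    state. *)
Lemma state_pushout B B' q (sub : B `<=` B') : closed_items R k B -> closed_items R k B' ->
  ~ B (inl q) -> B' (inl q) -> (forall p, B' (inl p) -> B (inl p) \/ p = q) ->
  (forall x y (z : E x y), gen B' z -> gen B z) ->
  pushout_of_generator (sub_incl sub : flow_map (Sub B) (Sub B')).
Proof.
move=> cB cB' nBq Bq Bstates gB.
exists (set_flow R k void), (set_flow R k unit),
  (@set_flow_map R k void (set_flow R k unit) (fun x => match x with end)),
  (@set_flow_map R k void (Sub B) (fun x => match x with end)),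
  (@set_flow_map R k unit (Sub B') (fun=> Substate Bq)).
split; first exact: gen_C.
split; first by apply: flow_map_ext => -[].
move=> Z f g _.
pose h0 (u : substate B') : Z := if pselect (B (inl (pt u))) is left Bu then g (Substate Bu) else f tt.
have [//|//|x y z _ /gB gz|_ u|_ _ u v u' v' a a' e|F [F0 FE]] :=
    @glue_maps R k d Q unit (fun=> B) B' (fun=> sub) Z h0 (fun=> g).
- by exists tt.
- rewrite /h0; case: pselect => [Bu|[]]; last exact: (ptP u).
  by congr (g _); exact: pt_inj.
- by apply: arr_map; exact: sub_arr_eq.
exists F; split=> [|F' [F'f F'g]].
  split; last exact: (FE tt).
  apply: flow_map_ext => [[]|[] [] []]; rewrite /= F0 /h0 /=.
  by case: pselect.
apply: sub_map_unique => [u|u v a _].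
  case: (Bstates _ (ptP u)) => [Bu|uq].
    have -> : u = substate_incl sub (Substate Bu) by exact: pt_inj.
    have /= -> := @flow_map_eq_state R k (Sub B) Z _ _ (Substate Bu) (FE tt).
    by have /= -> := @flow_map_eq_state R k (Sub B) Z _ _ (Substate Bu) F'g.
  have -> : u = Substate Bq by exact: pt_inj.
  have /= -> := @flow_map_eq_state R k (set_flow R k unit) Z _ _ tt F'f.
  by rewrite F0 /h0 /=; case: pselect.
have ga := gB _ _ _ (subexecP a); have [Bu Bv] := gen_states ga.
pose a' := subpath (u := Substate Bu) (v := Substate Bv) ga.
have e : @arr R k (Sub B') _ _ a = @arr R k (Sub B') _ _ (subexec_incl sub a') by exact: sub_arr_eq.
rewrite (arr_map F e) (arr_map F' e).
have /= -> := @flow_map_eq_arr R k (Sub B) Z _ _ (Substate Bu) (Substate Bv) a' (FE tt).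
by have /= -> := @flow_map_eq_arr R k (Sub B) Z _ _ (Substate Bu) (Substate Bv) a' F'g.
Qed.

Lemma supp_sub_rpoint d' (C : porderType d') (z : realization R (nerve C)) n (s : mono 'I_n.+1 C) :
  injective s -> supp z `<=` range s -> exists t, z = rpoint (K := nerve C) s t.
Proof.
move=> sI; have [m [r [t [-> rI t0]]]] := rpoint_nf z; rewrite supp_rpoint // => h.
have [i|f rE] := mono_factor (s := r) sI.
  by have [j _ <-] := h (r i) (ex_intro2 _ _ i I erefl); exists j.
by exists (simplex_map f t); rewrite rE rpoint_comp.
Qed.

Lemma bary_rpoint d' (C : porderType d') n (s : mono 'I_n.+1 C) (t : simplex R n) i :
  injective s -> bary (rpoint (K := nerve C) s t) (s i) = set_val t ord0 i.
Proof. by move=> sI; rewrite baryE (big_pred1 i) // => j; exact: (inj_eq sI). Qed.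

Lemma rpoint_inj d' (C : porderType d') n (s : mono 'I_n.+1 C) :
  injective s -> injective (@rpoint R (nerve C) n s).
Proof.
move=> sI t t' e; apply/val_inj/rowP => i.
by have := bary_rpoint t i sI; rewrite e bary_rpoint // => <-.
Qed.

Lemma cell_ends (x y x' y' : Q) (c : set (chain x y)) (c' : set (chain x' y')) :
  cell c = cell c' -> x = x' /\ y = y'.
Proof. by move=> /(congr1 (fun q : preitem => if q is inr w then projT1 w else (x, y)))[]. Qed.

Lemma cell_inj (x y : Q) : injective (@cell d Q x y).
Proof.
pose ch (xy : Q * Q) := set (chain xy.1 xy.2).
move=> c c' /(congr1 (fun q : preitem => if q is inr w then w else existT ch (x, y) c)) e.
have := projT2_eq e.
by rewrite (Prop_irrelevance (projT1_eq e) erefl).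
Qed.

Section cell.
Variables (B B' : set (@preitem d Q)) (sub : B `<=` B') (x y : Q) (zj : E x y).
Hypotheses (cB : closed_items R k B) (cB' : closed_items R k B') (ind_zj : ind zj).
Hypotheses (Bx : B (inl x)) (By : B (inl y)) (nB : ~ B (cell (supp zj))) (B'c : B' (cell (supp zj))).
Hypothesis B'_sub : forall q, B' q -> B q \/ q = cell (supp zj).
Hypothesis boundary : forall z : E x y, supp z `<=` supp zj -> supp z <> supp zj -> gen B z.

(** The characteristic map of the new cell is the homeomorphism of the disk with the
    closed simplex of zj.  Its interior consists of the indecomposable paths that are
    new, and its boundary is generated by B; hence a map on the smaller subflow and a
    compatible map on the disk prescribe coherent values on all indecomposable paths,
    and freeness applies. *)
Lemma cell_pushout : pushout_of_generator (sub_incl sub : flow_map (Sub B) (Sub B')).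
Proof.
have [n [s [tj [zjE sI tj0]]]] := rpoint_nf (zj : realization R (nerve (chain x y))).
have szj : supp zj = range s by rewrite zjE supp_rpoint.
have [Phi [Psi [cPhi cPsi PhiK PsiK bPhi]]] := disk_simplex_homeomorphism R n.
pose pnt (p : disk R n) : E x y := rpoint (K := nerve (chain x y)) s (Phi p).
have pnt_inj p p' : pnt p = pnt p' -> p = p'.
  by move=> /(rpoint_inj sI)/(can_inj PhiK).
have gzj : gen B' zj by apply: gen_atom => //; exact: sub.
have gpnt p : gen B' (pnt p).
  by apply: gen_closed gzj _ => //; rewrite szj; exact: supp_rpoint_sub.
have interior p : ~ disk_boundary p -> forall i, 0 < set_val (Phi p) ord0 i.
  move=> nb i; rewrite lt_def (set_valP (Phi p)).1 andbT; apply/eqP => i0.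
  by apply: nb; apply/bPhi; exists i.
have ind_pnt p : ~ disk_boundary p -> ind (pnt p).
  move=> nb; apply/(@ind_rpoint R k d Q x y n s (Phi p) (interior p nb)).
  by apply/(@ind_rpoint R k d Q x y n s tj tj0); rewrite -zjE.
have gbd p : disk_boundary p <-> gen B (pnt p).
  rewrite bPhi; split=> [[i i0]|gp].
    apply: boundary; first by rewrite szj; exact: supp_rpoint_sub.
    move=> e; have : supp (pnt p) (s i) by rewrite e szj; exists i.
    by rewrite /supp /= bary_rpoint // i0 ltxx.
  apply: contrapT => /bPhi nb; have pos := interior p nb; apply: nB.
  have e : supp (pnt p) = supp zj by rewrite szj supp_rpoint.
  by rewrite -e; apply: gen_ind_inv => //; exact: ind_pnt.
pose ux := Substate Bx; pose uy := Substate By.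
pose ux' := substate_incl sub ux; pose uy' := substate_incl sub uy.
have gsph (p : Top_sphere R k n) : gen B (pnt (sphere_disk p)).
  by apply/gbd; exact: (set_valP p).
pose att (p : Top_sphere R k n) : subexec B ux uy := subpath (u := ux) (v := uy) (gsph p).
pose chr (p : Top_disk R k n) : subexec B' ux' uy' := subpath (u := ux') (v := uy') (gpnt p).
have cpnt : continuous (pnt : disk R n -> realization R (nerve (chain x y))).
  exact: (continuous_compose cPhi (@rpoint_continuous R (nerve (chain x y)) n s)).
have catt : continuous att.
  apply: (@Delta_map_continuous R (sphere R n) (set_type (subset_exec R k B ux uy)) att).
  apply: (@set_type_continuous (sphere R n) _ (subset_exec R k B ux uy) (fun p => pnt (sphere_disk p))).
  have csd : continuous (@sphere_disk R k n : sphere R n -> disk R n).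
    apply: (@set_type_continuous (sphere R n) _ (@disk_set R n) set_val).
    exact: initial_continuous.
  exact: (continuous_compose csd cpnt).
have cchr : continuous chr.
  apply: (@Delta_map_continuous R (disk R n) (set_type (subset_exec R k B' ux' uy')) chr).
  exact: (@set_type_continuous (disk R n) _ (subset_exec R k B' ux' uy') pnt).
exists (Glob (Top_sphere R k n)), (Glob (Top_disk R k n)), (Glob_map (@sphere_disk_continuous R k n)),
  (@glob_lift R k _ (Sub B) ux uy att catt), (@glob_lift R k _ (Sub B') ux' uy' chr cchr).
split; first exact: gen_globe.
split.
  apply: glob_ext => // a /=; exact: sub_arr_eq.
move=> Z f g fg.
have gx : f false = g ux := @flow_map_eq_state R k (Glob (Top_sphere R k n)) Z _ _ false fg.
have gy : f true = g uy := @flow_map_eq_state R k (Glob (Top_sphere R k n)) Z _ _ true fg.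
pose fe (p : disk R n) : exec (f false) (f true) := @map_exec R k (Glob (Top_disk R k n)) Z f false true p.
have fatt (p : Top_sphere R k n) : arr (map_exec g (att p)) = arr (fe (sphere_disk p)).
  exact: (esym (@flow_map_eq_arr R k (Glob (Top_sphere R k n)) Z _ _ false true p fg)).
have B'B q : B' (inl q) -> B (inl q) by case/B'_sub.
pose h0 (u : substate B') : Z := g (Substate (B'B _ (ptP u))).
have h0x : h0 ux' = f false by rewrite gx; congr (g _); exact: pt_inj.
have h0y : h0 uy' = f true by rewrite gy; congr (g _); exact: pt_inj.
have bdE p : disk_boundary p -> exists q : Top_sphere R k n, sphere_disk q = p.
  move=> pb; have pS : set_val p \in @sphere_set R n by apply/mem_set.
  by exists (SigSub pS); exact: val_inj.
(* The two prescriptions agree where they overlap: a point of the disk that is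
   generated by B lies on the sphere. *)
have gf (u v : substate B) (a : subexec B u v) p :
    path_arr (set_val a : E _ _) = path_arr (pnt p) -> arr (map_exec g a) = arr (fe p).
  move=> e; have [/= eu ev] := arr_ends e.
  have gp : gen B (pnt p).
    case: u v a e eu ev => [u Bu] [v Bv] a e /= eu ev; subst u v.
    by have := @subexecP R k d Q B (Substate Bu) (Substate Bv) a; rewrite (path_arr_inj e).
  have [q qp] := bdE p (proj2 (gbd p) gp); subst p.
  rewrite -fatt; apply: arr_map; exact: sub_arr_eq.
pose Theta (u v : substate B') (z : E u v) (w : exec (h0 u) (h0 v)) :=
  (exists (u' v' : substate B) (a : subexec B u' v'),
     path_arr (set_val a : E _ _) = path_arr z /\ arr w = arr (map_exec g a)) \/
  (exists p, path_arr (pnt p) = path_arr z /\ arr w = arr (fe p)).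
have cases u v (z : E u v) : ind z -> gen B' z -> gen B z \/ exists p, path_arr (pnt p) = path_arr z.
  move=> iz gz; have [/B'B Bu /B'B Bv] := gen_states gz.
  have [Bc|cE] := B'_sub (gen_ind_inv iz gz); [by left; exact: gen_atom|right].
  have [eu ev] := cell_ends cE; subst u v; have ez := cell_inj cE.
  have [t zE] : exists t, z = rpoint (K := nerve (chain x y)) s t.
    by apply: supp_sub_rpoint => //; rewrite ez szj.
  by exists (Psi t); rewrite /pnt PsiK zE.
have [|u v z iz gz|h [h_atom h_concat]] := @free_extension R k d Q B' Z h0 Theta.
- move=> u v z w w' _ _ [[u1 [v1 [a [e1 e2]]]]|[p [e1 e2]]] [[u2 [v2 [b [e3 e4]]]]|[q [e3 e4]]];
    apply: arr_inj; rewrite e2 e4.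
  + by apply: arr_map; apply: sub_arr_eq; rewrite e1 e3.
  + by apply: gf; rewrite e1 e3.
  + by apply/esym/gf; rewrite e1 e3.
  + by congr (arr (fe _)); apply: pnt_inj; apply: path_arr_inj; rewrite e1 e3.
- have [gz'|[p pz]] := cases _ _ _ iz gz.
    have [Bu Bv] := gen_states gz'; pose a := subpath (u := Substate Bu) (v := Substate Bv) gz'.
    have eu : g (Substate Bu) = h0 u by congr (g _); exact: pt_inj.
    have ev : g (Substate Bv) = h0 v by congr (g _); exact: pt_inj.
    have [w we] := arr_cast (map_exec g a) eu ev.
    by exists w; left; exists (Substate Bu), (Substate Bv), a.
  have [xu yv] := arr_ends pz; have eu : ux' = u by exact: pt_inj.
  have ev : uy' = v by exact: pt_inj.
  have [w we] := arr_cast (fe p) (etrans (esym h0x) (congr1 h0 eu)) (etrans (esym h0y) (congr1 h0 ev)).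
  by exists w; right; exists p.
have agree (u v : substate B) (a : subexec B u v) :
    arr (h _ _ (subexec_incl sub a)) = arr (map_exec g a).
  apply: (@ext_agree R k d Q B B' sub Z h0 h h_concat g) => {u v a} u v a ia.
  have [[u' [v' [b [e1 ->]]]]|[p [e1 ->]]] := h_atom _ _ (subexec_incl sub a) ia.
    by apply: arr_map; exact: sub_arr_eq.
  by apply/esym/gf; rewrite e1.
have agree_disk p : arr (h _ _ (chr p)) = arr (fe p).
  have [/bdE[q qp]|np] := pselect (disk_boundary p).
    by subst p; rewrite -fatt -agree; exact: arr_subexec.
  have ip := ind_pnt p np.
  have [[u' [v' [b [e1 ->]]]]|[q [e1 ->]]] := h_atom _ _ (chr p) ip; first exact: gf.
  by congr (arr (fe _)); apply: pnt_inj; apply: path_arr_inj.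
have cell_cont (u v : substate B') m (r : mono 'I_m.+1 (chain u v))
    (hr : forall t : simplex R m, gen B' (rpoint (K := nerve (chain u v)) r t : E u v)) :
    (r ord0 = [:: (v : Q)] :> seq Q) -> continuous (fun t => h _ _ (subpath (hr t))).
  move=> r0; have [t0 t0_gt0] := simplex_interior R m.
  pose z0 : E u v := rpoint (K := nerve (chain u v)) r t0.
  have iz0 : ind z0 by apply/ind_rpoint.
  have sz0 : supp z0 = range r by exact: supp_rpoint.
  have [gz0|[p pz0]] := cases _ _ _ iz0 (hr t0).
    have [Bu Bv] := gen_states gz0.
    have hi t : gen B (rpoint (K := nerve (chain u v)) r t : E u v).
      by apply: gen_closed gz0 _ => //; rewrite sz0; exact: supp_rpoint_sub.
    apply: (@arr_continuous R k _ Z _ _ (g (Substate Bu)) (g (Substate Bv)) _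
      (fun t => map_exec g (subpath (u := Substate Bu) (v := Substate Bv) (hi t)))).
    - by congr (g _); exact: pt_inj.
    - by congr (g _); exact: pt_inj.
    - by move=> t; rewrite -agree; apply: arr_subexec.
    exact: (continuous_compose (@subpath_rpoint_continuous R k d Q B (Substate Bu) (Substate Bv) m r hi)
      (@map_exec_continuous R k (Sub B) Z g _ _)).
  have [xu yv] := arr_ends pz0; have eu : u = ux' by exact: pt_inj.
  have ev : v = uy' by exact: pt_inj.
  subst u v; have /path_arr_inj zE := pz0.
  have [i|q rE] := mono_factor (s := r) sI.
    have : supp (pnt p) `<=` range s by exact: supp_rpoint_sub.
    rewrite zE sz0 => /(_ (r i) (ex_intro2 _ _ i I erefl))[j _ <-]; by exists j.
  apply: (@arr_continuous R k _ Z _ _ (f false) (f true) _ (fun t => fe (Psi (simplex_map q t)))) => //.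
    move=> t; rewrite -agree_disk; apply: arr_subexec; congr path_arr.
    change (rpoint (K := nerve (chain x y)) r t =
      rpoint (K := nerve (chain x y)) s (Phi (Psi (simplex_map q t)))).
    by rewrite PsiK rE rpoint_comp.
  have cq := continuous_compose (@simplex_map_continuous R _ _ q) cPsi.
  have cq' := Delta_generated_continuous (@simplex_Delta_generated R m) cq.
  exact: (continuous_compose cq' (@map_exec_continuous R k (Glob (Top_disk R k n)) Z f false true)).
exists (ext_map cB' h_concat cell_cont); split=> [|F [Ff Fg]].
  split; last by apply: flow_map_ext => [u|u v a] /=; [congr (g _); exact: pt_inj|exact: agree].
  by apply: glob_ext => //= p; exact: agree_disk.
apply: sub_map_unique => [u|u v a ia].
  rewrite (_ : u = substate_incl sub (Substate (B'B _ (ptP u)))); last exact: pt_inj.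
  have /= -> := @flow_map_eq_state R k (Sub B) Z _ _ (Substate (B'B _ (ptP u))) Fg.
  by rewrite /h0; congr (g _); exact: pt_inj.
have [ga|[p pa]] := cases _ _ _ ia (subexecP a).
  have [Bu Bv] := gen_states ga.
  pose a' := subpath (u := Substate Bu) (v := Substate Bv) ga.
  have e : @arr R k (Sub B') _ _ a = @arr R k (Sub B') _ _ (subexec_incl sub a') by exact: sub_arr_eq.
  rewrite (arr_map F e) (arr_map (ext_map cB' h_concat cell_cont) e) /=.
  have /= -> := @flow_map_eq_arr R k (Sub B) Z _ _ (Substate Bu) (Substate Bv) a' Fg.
  exact: agree.
have e : @arr R k (Sub B') _ _ a = @arr R k (Sub B') _ _ (chr p) by apply: sub_arr_eq; rewrite -pa.
rewrite (arr_map F e) (arr_map (ext_map cB' h_concat cell_cont) e) /= agree_disk.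
exact: (esym (@flow_map_eq_arr R k (Glob (Top_disk R k n)) Z _ _ false true p Ff)).
Qed.

End cell.

End pushouts.

(** * A well-order compatible with dimension *)

Section staged_well_order.
Variables (T : choiceType) (stage : T -> nat).

Let r : rel T := sval (wochoice.well_ordering_principle T).
Let r_wo : wochoice.well_order r := svalP (wochoice.well_ordering_principle T).

Let r_min (A : {pred T}) : (exists a, a \in A) -> exists z, wochoice.minimum_of r A z.
Proof. by move=> /r_wo[z [zm _]]; exists z. Qed.

Let r_refl : reflexive r.
Proof.
by move=> a; have [|z [/eqP -> h]] := @r_min (pred1 a); [exists a; exact: eqxx|apply: h; exact: eqxx].
Qed.

Let r_total : total r.
Proof.
move=> a b; have [|z [/orP[/eqP|/eqP] -> h]] := @r_min (pred2 a b).
- by exists a; rewrite inE eqxx.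
- by rewrite (h b) // inE eqxx orbT.
- by rewrite (h a) ?orbT // inE eqxx.
Qed.

Let r_anti : antisymmetric r.
Proof.
move=> a b /andP[ab ba]; have [|z [_ zU]] := r_wo (A := pred2 a b); first by exists a; rewrite inE eqxx.
have az : z = a by apply: zU; split=> [|c /orP[]/eqP ->] //; rewrite inE eqxx.
have bz : z = b by apply: zU; split=> [|c /orP[]/eqP ->] //; rewrite inE eqxx orbT.
by rewrite -az.
Qed.

Let r_trans : transitive r.
Proof.
move=> b a c ab bc; have [|z [/or3P[] /eqP -> h]] := @r_min (pred3 a b c).
- by exists a; rewrite inE eqxx.
- by apply: h; rewrite inE eqxx !orbT.
- have <- // : b = a by apply: r_anti; rewrite ab andbT h // inE eqxx.
have <- // : b = c by apply: r_anti; rewrite bc h // inE eqxx orbT.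
Qed.

(** The well-order is first by stage and then by an arbitrary well-order; None is added
    as a greatest element, at which everything has been attached. *)
Definition staged_of (f : T -> nat) : Type := option T.
Local Notation staged := (staged_of stage).
HB.instance Definition _ := Choice.on staged.

Definition staged_le (v w : staged) : bool :=
  match v, w with
  | _, None => true
  | None, Some _ => false
  | Some a, Some b => (stage a < stage b)%N || (stage a == stage b) && r a b
  end.

Lemma staged_le_refl : reflexive staged_le.
Proof. by case=> [a|] //=; rewrite eqxx r_refl orbT. Qed.

Lemma staged_le_anti : antisymmetric staged_le.
Proof.
move=> [a|] [b|] //= /andP[/orP[ab|/andP[/eqP ab rab]] /orP[ba|/andP[/eqP ba rba]]]; try lia.
by congr Some; apply: r_anti; rewrite rab.
Qed.

Lemma staged_le_trans : transitive staged_le.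
Proof.
move=> [b|] [a|] [c|] //= /orP[ab|/andP[/eqP -> rab]] /orP[bc|/andP[/eqP bc rbc]].
- by rewrite (ltn_trans ab bc).
- by rewrite -bc ab.
- by rewrite bc.
- by rewrite bc eqxx (r_trans rab rbc) orbT.
Qed.

Lemma staged_le_total : total staged_le.
Proof.
move=> [a|] [b|] //=; case: ltngtP => //= _; exact: r_total.
Qed.

Fact staged_display : Order.disp_t. Proof. exact: Order.Disp tt tt. Qed.
HB.instance Definition _ := Order.Le_isPOrder.Build staged_display staged
  staged_le_refl staged_le_anti staged_le_trans.
HB.instance Definition _ := Order.POrder_isTotal.Build staged_display staged staged_le_total.

Lemma staged_le_None (w : staged) : (w <= None)%O.
Proof. by case: w. Qed.

Lemma staged_lt_stage (a b : T) : (stage a < stage b)%N -> ((Some a : staged) < (Some b : staged))%O.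
Proof.
move=> ab; rewrite lt_neqAle; apply/andP; split.
  by apply/eqP => -[e]; rewrite e ltnn in ab.
by rewrite /Order.le /= ab.
Qed.

(** A least element of P: minimize the stage first, and then use the arbitrary
    well-order among the elements of that stage. *)
Lemma staged_least (P : staged -> Prop) : (exists w, P w) ->
  exists w, P w /\ forall v, P v -> (w <= v)%O.
Proof.
move=> [w Pw]; have [[a Pa]|nP] := pselect (exists a : T, P (Some a)); last first.
  exists w; split=> // -[a|] Pv; first by case: nP; exists a.
  exact: staged_le_None.
have ex : exists n, `[< exists a, P (Some a) /\ stage a = n >].
  by exists (stage a); apply/asboolP; exists a.
case: (ex_minnP ex) => n /asboolP[b [Pb bn]] nmin.
have [|z [/asboolP[Pz zn] zmin]] := @r_min [pred a | `[< P (Some a) /\ stage a = n >]].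
  by exists b; apply/asboolP.
exists (Some z); split=> // -[c|] Pc; last exact: staged_le_None.
have : (n <= stage c)%N by apply: nmin; apply/asboolP; exists c.
rewrite /Order.le /= zn leq_eqVlt => /orP[/eqP cn|-> //].
by rewrite -cn ltnn eqxx /=; apply: zmin; apply/asboolP.
Qed.

Lemma staged_wf : well_founded (fun v w : staged => (v < w)%O).
Proof.
move=> w; apply: contrapT => nw.
have [v [nv vmin]] := @staged_least (fun w => ~ Acc (fun v w : staged => (v < w)%O) w) (ex_intro _ w nw).
apply: nv; constructor => u uv; apply: contrapT => /vmin; by rewrite leNgt uv.
Qed.

End staged_well_order.

(** * The relative cell complex *)

Section flow_category.
Context {R : realType} {k : Top_choice}.
Implicit Types X Y Z T : flow R k.

Lemma flow_compA X Y Z T (f : flow_map X Y) (g : flow_map Y Z) (h : flow_map Z T) :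
  flow_comp h (flow_comp g f) = flow_comp (flow_comp h g) f.
Proof. exact: flow_map_ext. Qed.

Lemma flow_comp_idl X Y (f : flow_map X Y) : flow_comp (flow_id Y) f = f.
Proof. exact: flow_map_ext. Qed.

Lemma flow_comp_idr X Y (f : flow_map X Y) : flow_comp f (flow_id X) = f.
Proof. exact: flow_map_ext. Qed.

Lemma is_iso_comp X Y Z (f : flow_map X Y) (g : flow_map Y Z) :
  is_iso f -> is_iso g -> is_iso (flow_comp g f).
Proof.
move=> [f' [ff' f'f]] [g' [gg' g'g]]; exists (flow_comp f' g'); split.
  by rewrite -flow_compA [flow_comp g' _]flow_compA gg' flow_comp_idl.
by rewrite -flow_compA [flow_comp f _]flow_compA f'f flow_comp_idl.
Qed.

End flow_category.

Section cell_complex.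
Context {R : realType} {k : Top_choice} {d : Order.disp_t} {Q : porderType d}.
Implicit Types x y : Q.
Local Notation E := (Ch_exec R k).
Implicit Types B : set (@preitem d Q).
Local Notation Sub := (subflow R k).
Local Notation gen := (gen R k).

Lemma sub_incl_iso B B' (h : B `<=` B') : B' `<=` B ->
  is_iso (sub_incl h : flow_map (Sub B) (Sub B')).
Proof.
move=> h'; exists (sub_incl h'); rewrite -!sub_incl_comp //; try by [].
by move=> *; rewrite !sub_incl_id.
Qed.

(** Among the preitems, those that are a state or the support of an indecomposable path. *)
Definition is_item (q : @preitem d Q) := 
  (exists x, q = inl x) \/ exists x y (z : E x y), ind z /\ q = cell (supp z).

(** States first, then cells by dimension; a cell of dimension n has stage n + 1. *)
Definition stage (q : @preitem d Q) : nat :=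
  match q with inl _ => 0%N | inr c => #|` fset_set (projT2 c)| end.

Lemma stage_cell x y (z : E x y) : stage (cell (supp z)) = scard z.
Proof. by []. Qed.

Lemma scard_gt0 x y (z : E x y) : (0 < scard z)%N.
Proof.
rewrite /scard cardfs_gt0; apply/fset0Pn; exists (least z).
by rewrite in_fset_set; [exact: mem_set (least_supp z)|exact: supp_finite].
Qed.

Variable B0 : set (@preitem d Q).
Hypothesis B0_closed : closed_items R k B0.
Hypothesis B0_ends : forall x y (c : set (chain x y)), B0 (cell c) -> B0 (inl x) /\ B0 (inl y).

Definition item : choiceType := {classic {q | is_item q /\ ~ B0 q}}.
Local Notation W := (staged_of (fun i : item => stage (sval i))).

(** What has been attached before the step w. *)
Definition items_below (w : W) : set (@preitem d Q) :=
  [set q | B0 q \/ exists2 i : item, sval i = q & ((Some i : W) < w)%O].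

Lemma items_below_homo v w : (v <= w)%O -> items_below v `<=` items_below w.
Proof. by move=> vw q [Bq|[i iq iv]]; [left|right; exists i => //; exact: lt_le_trans vw]. Qed.

Lemma items_below_stage (i : item) (w : W) q : ((Some i : W) <= w)%O -> is_item q ->
  (stage q < stage (sval i))%N -> items_below w q.
Proof.
move=> iw iq lt; have [Bq|nBq] := pselect (B0 q); [by left|right].
exists (exist _ q (conj iq nBq)) => //; apply: lt_le_trans iw.
exact: (@staged_lt_stage item (fun i => stage (sval i)) (exist _ q (conj iq nBq)) i).
Qed.

(** The indecomposable factors of z have at most the dimension of z. *)
Lemma gen_of_items B x y (z : E x y) :
  (forall q, is_item q -> (stage q <= scard z)%N -> B q) -> gen B z.
Proof.
have [n] := ubnP (len z); elim: n x y z => // n IH x y z ln h.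
case: (ind_or_concat z) => [iz|[p [a [b e]]]].
  apply: gen_atom => //; apply: h => //; try by left; eexists.
  by right; exists x, y, z.
have [sa sb] := scard_concat a b; rewrite -e in sa sb.
have la := len_gt0 a; have lb := len_gt0 b; move: ln; rewrite e len_concat => ln.
apply: gen_comp (erefl _); apply: IH; try lia.
  by move=> q iq l; apply: h => //; exact: leq_trans sa.
by move=> q iq l; apply: h => //; exact: leq_trans sb.
Qed.

Lemma gen_below (i : item) (w : W) x y (z : E x y) : ((Some i : W) <= w)%O ->
  (scard z < stage (sval i))%N -> gen (items_below w) z.
Proof.
move=> iw lt; apply: gen_of_items => q iq l.
by apply: items_below_stage iw iq _; exact: leq_ltn_trans lt.
Qed.

(** A proper face of a cell has smaller dimension, so that all its factors were attached
    earlier. *)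
Lemma items_below_closed w : closed_items R k (items_below w).
Proof.
move=> x y z z' iz gz sz'; have [Bx By] := gen_states gz.
case: (gen_ind_inv iz gz) => [Bz|[i iE iw]].
  have [Bx0 By0] := B0_ends Bz; apply: (@gen_sub R k d Q B0); first by left.
  by apply: B0_closed sz' => //; exact: gen_atom.
have [e|ne] := pselect (supp z' = supp z); last first.
  by apply: (gen_below (ltW iw)); rewrite iE stage_cell; exact: scard_ltn.
apply: gen_atom => //; last by rewrite e; right; exists i.
rewrite /ind /len (@leastE _ _ _ _ (least z)) // e; first exact: least_supp.
exact: least_le.
Qed.

Lemma items_below_self (i : item) : ~ items_below (Some i : W) (sval i).
Proof.
case=> [Bi|[j ji]]; first by case: (svalP i).
suff -> : j = i by rewrite ltxx.
exact: eq_sig_hprop.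
Qed.

Lemma items_below_covers (i : item) (w : W) : covers (Some i : W) w ->
  items_below w (sval i) /\ forall q, items_below w q -> items_below (Some i : W) q \/ q = sval i.
Proof.
move=> [iw cov]; split; first by right; exists i.
move=> q [Bq|[j jq /cov]]; first by left; left.
by rewrite le_eqVlt => /orP[/eqP[<-]|ji]; [right|left; right; exists j].
Qed.

(** A successor step attaches exactly one item: a state, with no path at that moment, or
    a cell, whose ends and boundary are already there. *)
Lemma items_below_step v w (h : covers v w) :
  pushout_of_generator (sub_incl (items_below_homo (ltW h.1)) :
    flow_map (Sub (items_below v)) (Sub (items_below w))).
Proof.
case: v h => [i|] h; last by exfalso; have := h.1; rewrite ltNge staged_le_None.
have [wi wE] := items_below_covers h; have nvi := @items_below_self i.
have [iq nBi] := svalP i; case: iq => [[q qE]|[x [y [z [iz qE]]]]]; rewrite qE in wi wE nvi.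
  apply: (@state_pushout R k d Q (items_below (Some i : W)) (items_below w) q _ _ _ nvi wi); try exact: items_below_closed.
    by move=> p /wE[|[->]]; [left|right].
  move=> x y z; elim=> {x y z} [x y z iz Bz Bx By|x y z p a b _ ga _ gb e]; last exact: gen_comp ga gb e.
  have {}Bz : items_below (Some i : W) (cell (supp z)) by case: (wE _ Bz).
  suff [Bx' By'] : items_below (Some i : W) (inl x) /\ items_below (Some i : W) (inl y) by exact: gen_atom.
  case: (Bz) => [Bz0|[j jE ji]]; first by have [? ?] := B0_ends Bz0; split; left.
  by split; apply: (items_below_stage (ltW ji)); rewrite ?jE ?stage_cell ?scard_gt0 //; left; eexists.
have st : stage (sval i) = scard z by rewrite qE stage_cell.
have Bs (p : Q) : items_below (Some i : W) (inl p).
  apply: (items_below_stage (lexx _)); first by left; exists p.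
  by rewrite st scard_gt0.
apply: (@cell_pushout R k d Q _ _ _ x y z) => //; try exact: items_below_closed.
move=> z' sz' ne; apply: (gen_below (lexx _)); rewrite st; exact: scard_ltn.
Qed.

(** At a limit, an item attached before w is attached before some u below w, since w is
    not the successor of that item. *)
Lemma items_below_limit (bot w : W) : (forall v : W, (bot <= v)%O) -> w <> bot ->
  (forall v, ~ covers v w) -> forall q, items_below w q -> exists2 v, (v < w)%O & items_below v q.
Proof.
move=> botP wb ncov q [Bq|[i iq iw]].
  by exists bot; [rewrite lt_neqAle botP andbT; apply/eqP => e; exact: wb|left].
have [u uw iu] : exists2 u, (u < w)%O & ((Some i : W) < u)%O.
  apply: contrapT => nu; apply: (ncov (Some i : W)); split=> // u uw.
  by rewrite leNgt; apply/negP => iu; apply: nu; exists u.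
by exists u => //; right; exists i.
Qed.

Definition all_items : set (@preitem d Q) := [set q | B0 q \/ is_item q].

Lemma items_below_all w : items_below w `<=` all_items.
Proof. by move=> q [Bq|[i <- _]]; [left|right; case: (svalP i)]. Qed.

Lemma all_items_below : all_items `<=` items_below (None : W).
Proof.
move=> q [Bq|iq]; first by left.
have [Bq|nBq] := pselect (B0 q); [by left|right].
by exists (exist _ q (conj iq nBq)) => //; rewrite lt_neqAle staged_le_None.
Qed.

Lemma B0_all : B0 `<=` all_items. Proof. by left. Qed.

(** The sequence is indexed by all the remaining items and the greatest element None; at
    None everything is attached, which makes the colimit of the whole sequence the last
    stage. *)
Theorem sub_relative_cell_complex (X Y : flow R k) (i0 : flow_map X (Sub B0))
    (phi : flow_map (Sub all_items) Y) : is_iso i0 -> is_iso phi ->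
  relative_cell_complex (flow_comp phi (flow_comp (sub_incl B0_all) i0)).
Proof.
move=> iso0 [psi [phiK psiK]].
have [bot [_ botP]] := @staged_least item (fun i => stage (sval i)) (fun=> True) (ex_intro _ None I).
have {}botP (v : W) : (bot <= v)%O by exact: botP.
have B0bot : B0 `<=` items_below bot by left.
pose c (w : W) (_ : True) := flow_comp phi (sub_incl (@items_below_all w)).
exists staged_display, W, bot, (sub_diagram items_below_homo),
  (flow_comp (sub_incl B0bot) i0), c; split.
- by split; [exact: staged_wf|exact: botP].
- exact: items_below_step.
- move=> w wb ncov.
  exact: (@sub_colimit R k d Q _ _ _ items_below_homo (fun v => (v < w)%O) (items_below w)
    (fun v h => items_below_homo (ltW h)) (@items_below_closed w) (@items_below_closed)
    (items_below_limit botP wb ncov)).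
- split=> [v w h [] []|Z g gc].
    by rewrite /c /= -flow_compA -(sub_incl_comp _ _ (@items_below_all v)).
  have hN (w : W) : (w <= (None : W))%O by exact: staged_le_None.
  exists (flow_comp (g None I) (flow_comp (sub_incl all_items_below) psi)); split.
    move=> w []; rewrite /c -!flow_compA [flow_comp psi _]flow_compA phiK flow_comp_idl.
    by rewrite -(sub_incl_comp _ _ (items_below_homo (hN w))); exact: gc.
  have hA : all_items `<=` all_items by [].
  move=> h' h'E; rewrite -(h'E None I) /c -!flow_compA.
  rewrite [flow_comp (sub_incl _) (flow_comp _ _)]flow_compA -(sub_incl_comp _ _ hA).
  by rewrite sub_incl_id flow_comp_idl psiK flow_comp_idr.
split.
  apply: is_iso_comp iso0 _; apply: sub_incl_iso => q [//|[i _]].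
  by rewrite ltNge botP.
by rewrite /c -!flow_compA; congr flow_comp; rewrite flow_compA -(sub_incl_comp _ _ B0_all).
Qed.

End cell_complex.

(** * The image of Ch(P) in Ch(Q) *)

Lemma subseq_map_inj (T T' : eqType) (f : T -> T') (s t : seq T) : injective f ->
  subseq (map f s) (map f t) -> subseq s t.
Proof.
move=> fI; elim: t s => [|y t IH] [|x s] //=.
by rewrite (inj_eq fI); case: ifP => _ h; [exact: IH|exact: (IH (x :: s))].
Qed.

Section image.
Context {R : realType} {k : Top_choice} {d d' : Order.disp_t} {P : porderType d} {Q : porderType d'}.
Variables (f : P -> Q) (fI : injective f) (fP : {homo f : x y / (x < y)%O}).
Local Notation E := (Ch_exec R k).
Local Notation F := (@Ch_map_exec R k d d' P Q f fP _ _).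
Local Notation gen := (gen R k).
Local Notation Sub := (subflow R k).
Local Notation path_arr := (@path_arr R k _ _ _ _).
Implicit Types p q : P.

Lemma chain_map_le p q (s t : chain p q) :
  (chain_map fP p q s <= chain_map fP p q t)%O -> (s <= t)%O.
Proof. exact: subseq_map_inj. Qed.

Lemma chain_map_inj p q : injective (chain_map fP p q).
Proof. by move=> s t e; apply/le_anti; rewrite !chain_map_le // e. Qed.

Lemma supp_Ch_map p q (z : E p q) : supp (F z) = chain_map fP p q @` supp z.
Proof. exact: supp_map. Qed.

Lemma Ch_map_inj p q : injective (@Ch_map_exec R k d d' P Q f fP p q).
Proof. exact: (nmap_inj (@chain_map_inj p q)). Qed.

Lemma Ch_map_lift p q (z : E p q) (z' : E (f p) (f q)) : supp z' `<=` supp (F z) ->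
  exists z0 : E p q, F z0 = z'.
Proof.
move=> sz'; apply: (@nmap_lift R _ _ _ _ (chain_map fP p q) z' (@chain_map_le p q)).
by move=> c /sz'; rewrite supp_Ch_map => -[s _ <-]; exists s.
Qed.

Lemma len_Ch_map p q (z : E p q) : len (F z) = len z.
Proof.
rewrite /len (@leastE _ _ _ _ (chain_map fP p q (least z))) ?supp_Ch_map ?size_map //.
  by exists (least z) => //; exact: least_supp.
by move=> _ [c zc <-]; apply: monoP; exact: least_le.
Qed.

Lemma Ch_map_concat p q r (a : E p q) (b : E q r) :
  F (Ch_concat a b) = Ch_concat (F a) (F b).
Proof. exact: (map_concat (Ch_map R k fP)). Qed.

Lemma path_arr_Ch_map_inj p q p' q' (z : E p q) (z' : E p' q') :
  path_arr (F z) = path_arr (F z') -> path_arr z = path_arr z'.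
Proof.
move=> e; have [/fI ep /fI eq] := arr_ends e; subst.
by rewrite (Ch_map_inj (path_arr_inj e)).
Qed.

(** The states and cells of Q that come from P. *)
Definition image_items : set (@preitem d' Q) := [set x |
  (exists p, x = inl (f p)) \/ exists p q (z : E p q), ind z /\ x = cell (supp (F z))].

Lemma gen_image p q (z : E p q) : gen image_items (F z).
Proof.
have [n] := ubnP (len z); elim: n p q z => // n IH p q z ln.
case: (ind_or_concat z) => [iz|[r [a [b e]]]].
  apply: gen_atom; first by rewrite /ind len_Ch_map.
  - by right; exists p, q, z.
  - by left; exists p.
  - by left; exists q.
have la := len_gt0 a; have lb := len_gt0 b; move: ln; rewrite e len_concat => ln.
by rewrite Ch_map_concat; apply: gen_comp (erefl _); apply: IH; lia.
Qed.

(** The paths generated by the cells of P are images of paths of Ch(P): a path supported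
    on images of chains lifts, and lifts can be concatenated because f is injective. *)
Lemma image_of_gen x y (z : E x y) : gen image_items z ->
  exists p q (z0 : E p q), path_arr (F z0) = path_arr z.
Proof.
elim=> {x y z} [x y z iz [[p //]|[p [q [z0 [_ cE]]]]] _ _|x y z r a b _ [p [q [a0 ea]]] _ [q' [s [b0 eb]]] e].
  have [ex ey] := cell_ends cE; subst x y; have sE := cell_inj cE.
  by have [|z1 <-] := @Ch_map_lift p q z0 z; [rewrite sE|exists p, q, z1].
have [_ /= qr] := arr_ends ea; have [/= q'r _] := arr_ends eb.
have qq' : q' = q by apply: fI; rewrite qr q'r.
subst q'; exists p, s, (Ch_concat a0 b0); rewrite Ch_map_concat e.
exact: (@arr_concat R k (Ch R k Q) _ _ _ _ _ _ _ _ _ _ ea eb).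
Qed.

Lemma image_closed : closed_items R k image_items.
Proof.
move=> x y z z' iz gz sz'; have := gen_ind_inv iz gz.
case=> [[p //]|[p [q [z0 [_ cE]]]]].
have [ex ey] := cell_ends cE; subst x y; have sE := cell_inj cE.
by have [|z1 <-] := @Ch_map_lift p q z0 z'; [rewrite -sE|exact: gen_image].
Qed.

Lemma image_ends x y (c : set (chain x y)) : image_items (cell c) ->
  image_items (inl x) /\ image_items (inl y).
Proof.
case=> [[p //]|[p [q [z0 [_ cE]]]]].
by have [-> ->] := cell_ends cE; split; left; [exists p|exists q].
Qed.

Lemma image_state (u : substate image_items) : exists p, f p = pt u.
Proof.
case: (ptP u) => [[p [->]]|[p [q [z [_ //]]]]]; by exists p.
Qed.

Definition image_in_exec p q (z : E p q) :
  subexec R k image_items (Substate (or_introl (ex_intro _ p erefl)))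
                          (Substate (or_introl (ex_intro _ q erefl))) :=
  subpath (u := Substate _) (v := Substate _) (gen_image z).

Definition image_in : flow_map (Ch R k P) (Sub image_items).
Proof.
apply: (@FlowMap R k (Ch R k P) (Sub image_items)
  (fun p => Substate (or_introl (ex_intro _ p erefl))) image_in_exec).
- move=> p q; apply: (@Delta_map_continuous R (realization R (nerve (chain p q)))
    (set_type (subset_exec R k image_items _ _)) (@image_in_exec p q)).
  apply: (@set_type_continuous (realization R (nerve (chain p q))) _ (subset_exec R k image_items
     (Substate _) (Substate _)) (@Ch_map_exec R k d d' P Q f fP p q)).
  exact: realization_map_continuous.
- by move=> p q r a b; apply: subexec_eq; exact: Ch_map_concat.
Defined.

(** If an interior point of a simplex comes from P, then so do all its vertices, hence
    the whole simplex. *)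
Lemma image_simplex x y p q n (r : mono 'I_n.+1 (chain x y)) (t0 : simplex R n) (z0 : E p q) :
  (forall i, 0 < set_val t0 ord0 i) ->
  path_arr (F z0) = path_arr (rpoint (K := nerve (chain x y)) r t0 : E x y) ->
  exists r' : mono 'I_n.+1 (chain p q), forall t,
    path_arr (F (rpoint (K := nerve (chain p q)) r' t)) =
    path_arr (rpoint (K := nerve (chain x y)) r t : E x y).
Proof.
move=> t00 e; have [ex ey] := arr_ends e; simpl in ex, ey; subst x y.
have {}e := path_arr_inj e.
have /choice[r' rE] i : exists c : chain p q, chain_map fP p q c = r i.
  have : supp (F z0) (r i) by rewrite e supp_rpoint //; exists i.
  by rewrite supp_Ch_map => -[c _ <-]; exists c.
have rM : {homo r' : i j / (i <= j)%O}.
  by move=> i j ij; have := monoP r ij; rewrite -!rE => /chain_map_le.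
exists (Mono rM) => t; congr path_arr.
rewrite /Ch_map_exec realization_mapE; congr (rpoint _ _).
by apply: mono_eq => i; exact: rE.
Qed.

(** The inverse sends a path to its unique lift; it is continuous because simplices lift
    to simplices. *)
Lemma image_in_iso : is_iso image_in.
Proof.
have /choice[h0 h0E] := image_state.
have hx (u v : substate image_items) (a : subexec R k image_items u v) :
    exists z : E (h0 u) (h0 v), path_arr (F z) = path_arr (set_val a : E _ _).
  have [p [q [z ze]]] := image_of_gen (subexecP a); have [/= pu qv] := arr_ends ze.
  have ep : p = h0 u by apply: fI; rewrite h0E pu.
  have eq : q = h0 v by apply: fI; rewrite h0E qv.
  by subst p q; exists z.
pose h u v a : E (h0 u) (h0 v) := sval (cid (hx u v a)).
have hE u v a : path_arr (F (h u v a)) = path_arr (set_val a : E _ _) by rewrite /h; case: cid.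
have Finj p q (z z' : E p q) : path_arr (F z) = path_arr (F z') -> z = z'.
  by move=> /path_arr_inj/Ch_map_inj.
have h_concat u v w (a : subexec R k image_items u v) (b : subexec R k image_items v w) :
    h _ _ (sub_concat a b) = Ch_concat (h _ _ a) (h _ _ b).
  apply: Finj; rewrite hE Ch_map_concat; apply/esym.
  exact: (@arr_concat R k (Ch R k Q) _ _ _ _ _ _ _ _ _ _ (hE _ _ a) (hE _ _ b)).
have h_cell (u v : substate image_items) n (r : mono 'I_n.+1 (chain u v))
    (hr : forall t : simplex R n, gen image_items (rpoint (K := nerve (chain u v)) r t : E u v)) :
    r ord0 = [:: (v : Q)] :> seq Q ->
    continuous (fun t => h _ _ (subpath (hr t)) : exec (h0 u : Ch R k P) (h0 v)).
  move=> _; have [t0 t0_gt0] := simplex_interior R n.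
  have [r' r'E] := image_simplex t0_gt0 (hE _ _ (subpath (hr t0))).
  have -> : (fun t => h _ _ (subpath (hr t))) = (fun t => rpoint (K := nerve (chain (h0 u) (h0 v))) r' t).
    by apply/funext => t; apply: Finj; rewrite hE r'E.
  apply: (Delta_generated_continuous (@simplex_Delta_generated R n)).
  exact: rpoint_continuous.
exists (@ext_map R k d' Q image_items (Ch R k P) h0 h image_closed h_concat h_cell); split.
  apply: flow_map_ext => [p|p q z] /=; first by apply: fI; rewrite h0E.
  by apply: path_arr_Ch_map_inj; rewrite hE.
apply: flow_map_ext => [u|u v a] /=; first by apply: pt_inj; rewrite /= h0E.
by apply: sub_arr_eq; rewrite /= hE.
Qed.

End image.

Section whole.
Context {R : realType} {k : Top_choice} {d : Order.disp_t} {Q : porderType d}.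
Local Notation Sub := (subflow R k).

Definition sub_in (B : set (@preitem d Q)) : flow_map (Sub B) (Ch R k Q).
Proof.
apply: (@FlowMap R k (Sub B) (Ch R k Q) (@pt d Q B)
  (fun u v (a : subexec R k B u v) => set_val a : Ch_exec R k u v)) => // u v.
apply: (@Delta_map_continuous R (set_type (subset_exec R k B u v)) (realization R (nerve (chain u v)))).
exact: initial_continuous.
Defined.

(** A subflow with all the states and cells is everything, since every path is a
    concatenation of indecomposable ones. *)
Lemma sub_in_iso (B : set (@preitem d Q)) : @is_item R k d Q `<=` B -> is_iso (sub_in B).
Proof.
move=> BT; have Bs (x : Q) : B (inl x) by apply: BT; left; exists x.
have Bg (x y : Q) (z : Ch_exec R k x y) : gen R k B z by apply: gen_of_items => q iq _; exact: BT.
pose h (x y : Q) (z : Ch_exec R k x y) : subexec R k B (Substate (Bs x)) (Substate (Bs y)) :=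
  subpath (u := Substate (Bs x)) (v := Substate (Bs y)) (Bg x y z).
have ch (x y : Q) : continuous (@h x y).
  apply: (@Delta_map_continuous R (realization R (nerve (chain x y))) (set_type (subset_exec R k B _ _)) (@h x y)).
  apply: (@set_type_continuous (realization R (nerve (chain x y))) _
    (subset_exec R k B (Substate (Bs x)) (Substate (Bs y))) (fun z => z)).
  by move=> z; exact: cvg_id.
have hc (x y z : Q) (a : Ch_exec R k x y) (b : Ch_exec R k y z) : 
    h _ _ (Ch_concat a b) = sub_concat (h _ _ a) (h _ _ b) by exact: subexec_eq.
exists (@FlowMap R k (Ch R k Q) (Sub B) (fun x => Substate (Bs x)) h ch hc); split.
  by apply: flow_map_ext => [u|u v a] /=; [exact: pt_inj|exact: sub_arr_eq].
exact: flow_map_ext.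
Qed.

End whole.

Section main.
Variables (R : realType) (k : Top_choice).

Lemma relative_cell_complex_q_cofibration (X Y : flow R k) (f : flow_map X Y) :
  relative_cell_complex f -> q_cofibration f.
Proof.
move=> cf; exists X, Y, f; split => //.
by exists (flow_id X), (flow_id X), (flow_id Y), (flow_id Y); split;
  rewrite ?flow_comp_idl ?flow_comp_idr.
Qed.

Lemma Ch_map_relative_cell_complex d d' (P : porderType d) (Q : porderType d') (f : P -> Q)
    (fI : injective f) (fP : {homo f : x y / (x < y)%O}) :
  relative_cell_complex (Ch_map R k fP).
Proof.
pose B0 := @image_items R k d d' P Q f fP.
have iso : is_iso (@sub_in R k d' Q (@all_items R k d' Q B0)).
  by apply: sub_in_iso => q iq; right.
have := @sub_relative_cell_complex R k d' Q B0 (@image_closed R k d d' P Q f fI fP) (@image_ends R k d d' P Q f fP)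
  _ _ (image_in fP) _ (image_in_iso fI fP) iso.
by rewrite (_ : flow_comp _ _ = Ch_map R k fP) //; exact: flow_map_ext.
Qed.

(** The same construction, starting from no state and no cell. *)
Lemma Ch_q_cofibrant d (P : porderType d) : q_cofibrant (Ch R k P).
Proof.
apply: relative_cell_complex_q_cofibration.
pose B0 : set (@preitem d P) := set0.
have g0 x y (z : Ch_exec R k x y) : ~ gen R k B0 z by elim.
have c0 : closed_items R k B0 by move=> x y z z' _ /g0.
pose i0 : flow_map (set_flow R k void) (subflow R k B0) :=
  @set_flow_map R k void (subflow R k B0) (fun x : void => match x with end).
have iso0 : is_iso i0.
  pose j0 (u : substate B0) : void := False_rect _ (ptP u).
  pose je (u v : substate B0) (a : subexec R k B0 u v) : exec (j0 u : set_flow R k void) (j0 v) :=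
    False_rect _ (ptP u).
  have jc (u v : substate B0) : continuous (je u v) by case: u => x [].
  exists (@FlowMap R k (subflow R k B0) (set_flow R k void) j0 je jc
    (fun u v w a b => False_rect _ (ptP u))); split; apply: flow_map_ext => -[] //= x [].
have iso : is_iso (@sub_in R k d P (@all_items R k d P B0)).
  by apply: sub_in_iso => q iq; right.
have := @sub_relative_cell_complex R k d P B0 c0 (fun _ _ _ => False_rect _) _ _ i0 _ iso0 iso.
by congr relative_cell_complex; apply: flow_map_ext => -[].
Qed.

End main.

Theorem proposition3p3 (R : realType) (k : Top_choice)
    (d : Order.disp_t) (P : porderType d) :
  [/\ q_cofibrant (Ch R k P),
      trivial_q_fibration (augmentation R k P) &
      forall (d' : Order.disp_t) (Q : porderType d') (i : P -> Q)
        (i_inj : injective i) (i_le : {homo i : x y / (x <= y)%O}),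
        q_cofibration (Ch_map R k (inj_homo_lt i_inj i_le)) /\
        relative_cell_complex (Ch_map R k (inj_homo_lt i_inj i_le))].
Proof.
split; [exact: Ch_q_cofibrant|exact: augmentation_trivial_q_fibration|].
move=> d' Q i i_inj i_le; have c := Ch_map_relative_cell_complex R k i_inj (inj_homo_lt i_inj i_le).
by split=> //; exact: relative_cell_complex_q_cofibration.
Qed.
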